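(* Let $\ell\ge2$ and let $q\in\mathbb C^\times$ be such that $q^2$ is a primitive $\ell$-th root of unity. Let $i,r,s\in\mathbb Z_{\ge0}$ satisfy $s<\ell$ and $i=r\ell+s$. Then, as $\mathcal LU_q$-modules, $$L_q(i)\otimes L_q(1)\simeq(1-\delta_{s,0})M_q(i-1)\oplus(1-\delta_{s,\ell-1})L_q(i+1),$$ where $M_q(i-1)=L_q(i-1)$ if $s\ne\ell-1$ and $M_q(i-1)=P_q(i-1)$ if $s=\ell-1$; and, if $s\neq\ell-1$, $$P_q(i)\otimes L_q(1)\simeq(1+\delta_{s,\ell-2})P_q(i+1)\oplus(1-\delta_{r,0}\delta_{s,0})P_q(i-1)\oplus\delta_{s,0}P_q(i+2\ell-1).$$ (When $s=\ell-1$, $P_q(i)\simeq L_q(i)$ and only the first rule applies.)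
   Context: For a module $M$ and $n\in\mathbb Z_{\ge0}$, $nM$ denotes the direct sum of $n$ copies of $M$ ($0M=0$). **$q$-numbers.** $[n]_t=\frac{t^n-t^{-n}}{t-t^{-1}}$, $[n]_t!=[n]_t\cdots[1]_t$, $\begin{bmatrix}m\\ n\end{bmatrix}_t=\frac{[m]_t!}{[n]_t![m-n]_t!}$ if $m\ge n\ge0$ and $0$ otherwise; at $t=q$, $q$-binomials are limits $t\to q$. **Lusztig's quantum group.** For a formal parameter $t$, $U_t\mathfrak{sl}_2$ is the $\mathbb Q(t)$-algebra generated by $E,F,K^{\pm1}$ with $KEK^{-1}=t^2E$, $KFK^{-1}=t^{-2}F$, $KK^{-1}=K^{-1}K=1$, $K-K^{-1}=(t-t^{-1})(EF-FE)$. $U_{\mathrm{res}}$ is its $\mathbb Z[t,t^{-1}]$-subalgebra generated by $K^{\pm1}$, $E^{(n)}=E^n/[n]_t!$, $F^{(n)}=F^n/[n]_t!$, $n\ge0$. $\mathcal LU_q$ is the $\mathbb C$-algebra obtained from $U_{\mathrm{res}}$ by specializing $t\mapsto q$. Tensor products of modules use the coproduct $\Delta(K)=K\otimes K$, $$\Delta(E^{(n)})=\sum_{m=0}^nq^{-m(n-m)}E^{(n-m)}K^{-m}\otimes E^{(m)},\qquad\Delta(F^{(n)})=\sum_{m=0}^nq^{m(n-m)}F^{(m)}\otimes K^mF^{(n-m)}.$$ The element $(K^{2\ell}-1)/\Phi_\ell(t^2)$, $\Phi_\ell$ the $\ell$-th cyclotomic polynomial, lies in $U_{\mathrm{res}}$;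 $H\in\mathcal LU_q$ is $\epsilon_q^{-1}$ times its specialization, $\epsilon_q=\lim_{t\to q}(t^{2\ell}-1)/\Phi_\ell(t^2)\ne0$. **Modules.** For $i\ge0$ the Weyl module $\Delta_q(i)$ has basis $m_0,\dots,m_i$ with $Km_k=q^{i-2k}m_k$, $E^{(n)}m_k=\begin{bmatrix}i-k+n\\ n\end{bmatrix}_qm_{k-n}$, $F^{(n)}m_k=\begin{bmatrix}k+n\\ n\end{bmatrix}_qm_{k+n}$ ($m_s=0$ for $s<0$ or $s>i$). Its head $L_q(i)=\operatorname{top}\Delta_q(i)$ is simple. Type I modules: finite-dimensional modules that are direct sums of subspaces, indexed by integers $n$, on which $H$ acts as $n$ and $K$ as $q^n$. $P_q(i)$ is the projective cover of $L_q(i)$ in the category of finite-dimensional type I $\mathcal LU_q$-modules. *)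

(* Defs.v *)
From HB Require Import structures.
From mathcomp Require Import all_boot all_order all_algebra all_field.
From mathcomp Require Import generic_quotient complex.
From mathcomp Require Import boolp classical_sets reals.

Set Implicit Arguments.
Unset Strict Implicit.
Unset Printing Implicit Defensive.

Import GRing.Theory.
Local Open Scope ring_scope.
Local Open Scope quotient_scope.

(* Associative unital algebras given by generators and relations.  The result *)
(* may be the zero ring, so it is only a pzRingType with an lmodType          *)
(* structure; scalars are central by pa_scalerAl and pa_scalerAr.             *)

Inductive pa_term (K : fieldType) (X : Type) : Type :=
| PaVar of X
| PaScal of K
| PaAdd of pa_term K X & pa_term K X
| PaMul of pa_term K X & pa_term K X.
Arguments PaVar {K X}.
Arguments PaScal {K X}.

Inductive pa_cong (K : fieldType) (X : Type)
    (rels : pa_term K X -> pa_term K X -> Prop) :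
    pa_term K X -> pa_term K X -> Prop :=
| pac_rel a b : rels a b -> pa_cong rels a b
| pac_refl a : pa_cong rels a a
| pac_sym a b : pa_cong rels a b -> pa_cong rels b a
| pac_trans a b c : pa_cong rels a b -> pa_cong rels b c -> pa_cong rels a c
| pac_add a a' b b' : pa_cong rels a a' -> pa_cong rels b b' ->
    pa_cong rels (PaAdd a b) (PaAdd a' b')
| pac_mul a a' b b' : pa_cong rels a a' -> pa_cong rels b b' ->
    pa_cong rels (PaMul a b) (PaMul a' b')
| pac_addA a b c : pa_cong rels (PaAdd a (PaAdd b c)) (PaAdd (PaAdd a b) c)
| pac_addC a b : pa_cong rels (PaAdd a b) (PaAdd b a)
| pac_add0 a : pa_cong rels (PaAdd (PaScal 0) a) a
| pac_mulA a b c : pa_cong rels (PaMul a (PaMul b c)) (PaMul (PaMul a b) c)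
| pac_mul1 a : pa_cong rels (PaMul (PaScal 1) a) a
| pac_mulDl a b c :
    pa_cong rels (PaMul (PaAdd a b) c) (PaAdd (PaMul a c) (PaMul b c))
| pac_mulDr a b c :
    pa_cong rels (PaMul a (PaAdd b c)) (PaAdd (PaMul a b) (PaMul a c))
| pac_scalD x y :
    pa_cong rels (PaScal (x + y)) (PaAdd (PaScal x) (PaScal y))
| pac_scalM x y :
    pa_cong rels (PaScal (x * y)) (PaMul (PaScal x) (PaScal y))
| pac_scalC x a :
    pa_cong rels (PaMul (PaScal x) a) (PaMul a (PaScal x))
| pac_scal0 a : pa_cong rels (PaMul (PaScal 0) a) (PaScal 0).

HB.instance Definition _ K X := gen_eqMixin (pa_term K X).
HB.instance Definition _ K X := gen_choiceMixin (pa_term K X).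

Section PresentedAlgebra.
Variables (K : fieldType) (X : Type).
Variable rels : pa_term K X -> pa_term K X -> Prop.

Definition pa_congb (a b : pa_term K X) : bool := `[< pa_cong rels a b >].

Lemma pa_congb_refl : reflexive pa_congb.
Proof. by move=> a; apply/asboolP; exact: pac_refl. Qed.

Lemma pa_congb_sym : symmetric pa_congb.
Proof.
by move=> a b; apply/asboolP/asboolP; exact: pac_sym.
Qed.

Lemma pa_congb_trans : transitive pa_congb.
Proof.
move=> b a c /asboolP ab /asboolP bc; apply/asboolP; exact: pac_trans ab bc.
Qed.

Canonical pa_congb_equiv :=
  EquivRel pa_congb pa_congb_refl pa_congb_sym pa_congb_trans.

Definition palg : Type := {eq_quot pa_congb}.
HB.instance Definition _ := Choice.on palg.
HB.instance Definition _ := EqQuotient.on palg.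

Definition pa_class (a : pa_term K X) : palg := \pi_palg a.

Lemma pa_classP a b : pa_class a = pa_class b <-> pa_cong rels a b.
Proof.
split=> [/eqmodP /asboolP //|ab]; by apply/eqmodP/asboolP.
Qed.

Lemma pa_repr a : pa_cong rels (repr (pa_class a)) a.
Proof. by apply/pa_classP; rewrite /pa_class reprK. Qed.

Definition pa_add (x y : palg) := pa_class (PaAdd (repr x) (repr y)).
Definition pa_mul (x y : palg) := pa_class (PaMul (repr x) (repr y)).
Definition pa_scale (c : K) (x : palg) := pa_class (PaMul (PaScal c) (repr x)).
Definition pa_opp (x : palg) := pa_scale (-1) x.

Lemma pa_addE a b : pa_add (pa_class a) (pa_class b) = pa_class (PaAdd a b).
Proof. by apply/pa_classP; apply: pac_add; exact: pa_repr. Qed.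

Lemma pa_mulE a b : pa_mul (pa_class a) (pa_class b) = pa_class (PaMul a b).
Proof. by apply/pa_classP; apply: pac_mul; exact: pa_repr. Qed.

Lemma pa_scaleE c a : pa_scale c (pa_class a) = pa_class (PaMul (PaScal c) a).
Proof.
by apply/pa_classP; apply: pac_mul; [exact: pac_refl|exact: pa_repr].
Qed.

Lemma pa_surj (x : palg) : exists a, x = pa_class a.
Proof. by exists (repr x); rewrite /pa_class reprK. Qed.

Fact pa_addA : associative pa_add.
Proof.
move=> x y z; have [a ->] := pa_surj x; have [b ->] := pa_surj y.
have [c ->] := pa_surj z; rewrite !pa_addE; apply/pa_classP; exact: pac_addA.
Qed.

Fact pa_addC : commutative pa_add.
Proof.
move=> x y; have [a ->] := pa_surj x; have [b ->] := pa_surj y.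
rewrite !pa_addE; apply/pa_classP; exact: pac_addC.
Qed.

Fact pa_add0 : left_id (pa_class (PaScal 0)) pa_add.
Proof.
move=> x; have [a ->] := pa_surj x.
rewrite !pa_addE; apply/pa_classP; exact: pac_add0.
Qed.

Fact pa_scaleDl x : {morph pa_scale^~ x : c d / c + d >-> pa_add c d}.
Proof.
move=> c d; have [a ->] := pa_surj x; rewrite !pa_scaleE pa_addE.
apply/pa_classP; apply: pac_trans (pac_mulDl _ _ _ _).
by apply: pac_mul; [exact: pac_scalD|exact: pac_refl].
Qed.

Fact pa_scale1 : left_id 1 pa_scale.
Proof.
move=> x; have [a ->] := pa_surj x.
by rewrite pa_scaleE; apply/pa_classP; exact: pac_mul1.
Qed.

Fact pa_addN : left_inverse (pa_class (PaScal 0)) pa_opp pa_add.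
Proof.
move=> x; rewrite /pa_opp -[X in pa_add _ X]pa_scale1 -pa_scaleDl addNr.
have [a ->] := pa_surj x; rewrite pa_scaleE; apply/pa_classP; exact: pac_scal0.
Qed.

HB.instance Definition _ :=
  GRing.isZmodule.Build palg pa_addA pa_addC pa_add0 pa_addN.

Lemma pa_addrE a b : pa_class a + pa_class b = pa_class (PaAdd a b).
Proof. exact: pa_addE. Qed.

Fact pa_mulA : associative pa_mul.
Proof.
move=> x y z; have [a ->] := pa_surj x; have [b ->] := pa_surj y.
have [c ->] := pa_surj z; rewrite !pa_mulE; apply/pa_classP; exact: pac_mulA.
Qed.

Fact pa_mul1 : left_id (pa_class (PaScal 1)) pa_mul.
Proof.
move=> x; have [a ->] := pa_surj x.
rewrite !pa_mulE; apply/pa_classP; exact: pac_mul1.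
Qed.

Fact pa_mulr1 : right_id (pa_class (PaScal 1)) pa_mul.
Proof.
move=> x; have [a ->] := pa_surj x; rewrite !pa_mulE; apply/pa_classP.
exact: pac_trans (pac_sym (pac_scalC _ _ _)) (pac_mul1 _ _).
Qed.

Fact pa_mulDl : left_distributive pa_mul +%R.
Proof.
move=> x y z; have [a ->] := pa_surj x; have [b ->] := pa_surj y.
have [c ->] := pa_surj z; rewrite ?(pa_addrE, pa_mulE).
apply/pa_classP; exact: pac_mulDl.
Qed.

Fact pa_mulDr : right_distributive pa_mul +%R.
Proof.
move=> x y z; have [a ->] := pa_surj x; have [b ->] := pa_surj y.
have [c ->] := pa_surj z; rewrite ?(pa_addrE, pa_mulE).
apply/pa_classP; exact: pac_mulDr.
Qed.

HB.instance Definition _ :=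
  GRing.Zmodule_isPzRing.Build palg pa_mulA pa_mul1 pa_mulr1 pa_mulDl pa_mulDr.

Fact pa_scaleA c d x : pa_scale c (pa_scale d x) = pa_scale (c * d) x.
Proof.
have [a ->] := pa_surj x; rewrite !pa_scaleE; apply/pa_classP.
apply: pac_trans (pac_mulA _ _ _ _) _.
by apply: pac_mul; [exact/pac_sym/pac_scalM|exact: pac_refl].
Qed.

Fact pa_scaleDr : right_distributive pa_scale +%R.
Proof.
move=> c x y; have [a ->] := pa_surj x; have [b ->] := pa_surj y.
rewrite !(pa_addrE, pa_scaleE).
apply/pa_classP; exact: pac_mulDr.
Qed.

HB.instance Definition _ := GRing.Zmodule_isLmodule.Build K palg
  pa_scaleA pa_scale1 pa_scaleDr pa_scaleDl.

Lemma pa_scalerAl (c : K) (x y : palg) : c *: (x * y) = (c *: x) * y.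
Proof.
have [a ->] := pa_surj x; have [b ->] := pa_surj y.
rewrite -[LHS]/(pa_scale _ (pa_mul _ _)) -[RHS]/(pa_mul (pa_scale _ _) _).
rewrite !(pa_mulE, pa_scaleE); apply/pa_classP; exact: pac_mulA.
Qed.

Lemma pa_scalerAr (c : K) (x y : palg) : c *: (x * y) = x * (c *: y).
Proof.
have [a ->] := pa_surj x; have [b ->] := pa_surj y.
rewrite -[LHS]/(pa_scale _ (pa_mul _ _)) -[RHS]/(pa_mul _ (pa_scale _ _)).
rewrite !(pa_mulE, pa_scaleE).
apply/pa_classP; apply: pac_trans (pac_mulA _ _ _ _) _.
apply: pac_trans (pac_sym (pac_mulA _ _ _ _)).
by apply: pac_mul; [exact: pac_scalC|exact: pac_refl].
Qed.

Definition pa_gen (x : X) : palg := pa_class (PaVar x).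

End PresentedAlgebra.

Definition Qt : fieldType := {fraction {poly rat}}.
Definition qt : Qt := tofrac ('X : {poly rat}).

Definition qnum (n : nat) : Qt := (qt ^+ n - qt ^- n) / (qt - qt^-1).
Definition qfact (n : nat) : Qt := \prod_(1 <= j < n.+1) qnum j.
Definition qbinom (m n : nat) : Qt :=
  if (n <= m)%N then qfact m / (qfact n * qfact (m - n)) else 0.

Inductive Ut_generator := GenE | GenF | GenK | GenKi.

Local Notation tE := (PaVar GenE).
Local Notation tF := (PaVar GenF).
Local Notation tK := (PaVar GenK).
Local Notation tKi := (PaVar GenKi).

Inductive Ut_rel : pa_term Qt Ut_generator -> pa_term Qt Ut_generator -> Prop :=
| Ut_KE : Ut_rel (PaMul (PaMul tK tE) tKi) (PaMul (PaScal (qt ^+ 2)) tE)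
| Ut_KF : Ut_rel (PaMul (PaMul tK tF) tKi) (PaMul (PaScal (qt ^- 2)) tF)
| Ut_KKi : Ut_rel (PaMul tK tKi) (PaScal 1)
| Ut_KiK : Ut_rel (PaMul tKi tK) (PaScal 1)
| Ut_EF : Ut_rel (PaAdd tK (PaMul (PaScal (-1)) tKi))
    (PaMul (PaScal (qt - qt^-1))
       (PaAdd (PaMul tE tF) (PaMul (PaScal (-1)) (PaMul tF tE)))).

Definition Ut := palg Ut_rel.
HB.instance Definition _ := GRing.PzRing.on Ut.
HB.instance Definition _ := GRing.Lmodule.on Ut.

Definition Ut_E : Ut := pa_gen Ut_rel GenE.
Definition Ut_F : Ut := pa_gen Ut_rel GenF.
Definition Ut_K : Ut := pa_gen Ut_rel GenK.
Definition Ut_Ki : Ut := pa_gen Ut_rel GenKi.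
Definition Ut_Ediv (n : nat) : Ut := (qfact n)^-1 *: Ut_E ^+ n.
Definition Ut_Fdiv (n : nat) : Ut := (qfact n)^-1 *: Ut_F ^+ n.

Definition laurentZ (c : Qt) : Prop :=
  exists (p : {poly int}) (n : nat), c = tofrac (map_poly intr p : {poly rat}) * qt ^- n.

Inductive Ures : Ut -> Prop :=
| Ures_one : Ures 1
| Ures_K : Ures Ut_K
| Ures_Ki : Ures Ut_Ki
| Ures_E n : Ures (Ut_Ediv n)
| Ures_F n : Ures (Ut_Fdiv n)
| Ures_add x y : Ures x -> Ures y -> Ures (x + y)
| Ures_mul x y : Ures x -> Ures y -> Ures (x * y)
| Ures_scale c x : laurentZ c -> Ures x -> Ures (c *: x).

Section Specialization.
Variables (R : realType) (q : R[i]).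

(* lim_at f is the limit of the rational function f(t) as t tends to q, i.e.  *)
(* the value at q of f when f is regular there (and 0 if it has a pole).      *)
Definition lim_at (f : Qt) : R[i] :=
  xget 0 [set a | exists n d : {poly rat},
    [/\ f = tofrac n / tofrac d, (map_poly ratr d).[q] != 0
      & a = (map_poly ratr n).[q] / (map_poly ratr d).[q]]]%classic.

Definition qbinom_at (m n : nat) : R[i] := lim_at (qbinom m n).

(* LU_q is the base change of Ures along Z[t, t^-1] -> C, t |-> q: the        *)
(* C-algebra generated by symbols [x], x in Ures, such that x |-> [x] is a    *)
(* ring morphism with [t x] = q [x].  The relations [t^-1 x] = q^-1 [x] and   *)
(* [m x] = m [x], m in Z, follow.                                             *)
Definition Ures_type := {x : Ut | Ures x}.

Local Notation br := (@PaVar R[i] Ures_type).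

Inductive LU_rel :
    pa_term R[i] Ures_type -> pa_term R[i] Ures_type -> Prop :=
| LU_one x : sval x = 1 -> LU_rel (br x) (PaScal 1)
| LU_add x y z : sval z = sval x + sval y ->
    LU_rel (br z) (PaAdd (br x) (br y))
| LU_mul x y z : sval z = sval x * sval y ->
    LU_rel (br z) (PaMul (br x) (br y))
| LU_spec x z : sval z = qt *: sval x ->
    LU_rel (br z) (PaMul (PaScal q) (br x)).

Definition LU := palg LU_rel.
HB.instance Definition _ := GRing.PzRing.on LU.
HB.instance Definition _ := GRing.Lmodule.on LU.

(* Specialization Ures -> LU, extended by 0 to the elements of U_t that are   *)
(* not in Ures.                                                               *)
Definition LU_of (x : Ut) : LU :=
  match pselect (Ures x) with
  | left h => pa_gen LU_rel (exist _ x h)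
  | right _ => 0
  end.

Definition LK : LU := LU_of Ut_K.
Definition LKi : LU := LU_of Ut_Ki.
Definition LE (n : nat) : LU := LU_of (Ut_Ediv n).
Definition LF (n : nat) : LU := LU_of (Ut_Fdiv n).

Definition Phi_t2 (l : nat) : Qt := 
  tofrac (map_poly intr 'Phi_l \Po 'X^2 : {poly rat}).

Definition eps_q (l : nat) : R[i] := lim_at ((qt ^+ (2 * l) - 1) / Phi_t2 l).

Definition LH (l : nat) : LU :=
  (eps_q l)^-1 *: LU_of ((Phi_t2 l)^-1 *: (Ut_K ^+ (2 * l) - 1)).

Record LUmod := LUMod {
  LUcarrier :> vectType R[i];
  LUact : LU -> LUcarrier -> LUcarrier;
  LUact_linear : forall x, linear (LUact x);
  LUact_linearl : forall u (a : R[i]) (x y : LU),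
    LUact (a *: x + y) u = a *: LUact x u + LUact y u;
  LUact1 : forall u, LUact 1 u = u;
  LUactM : forall x y u, LUact (x * y) u = LUact x (LUact y u)
}.

Local Notation "x ∙ v" := (LUact x v) (at level 40, v at next level).

Definition LUhom (V W : LUmod) (f : 'Hom(V, W)) : Prop :=
  forall (x : LU) (v : V), f (x ∙ v) = x ∙ f v.

Definition LUsurj (V W : LUmod) (f : 'Hom(V, W)) : Prop :=
  forall w : W, exists v : V, f v = w.

Definition LUiso (V W : LUmod) : Prop :=
  exists2 f : 'Hom(V, W), LUhom f & bijective f.

Definition submodule (V : LUmod) (N : {vspace V}) : Prop :=
  forall (x : LU) (v : V), v \in N -> x ∙ v \in N.

Definition maximal_submodule (V : LUmod) (N : {vspace V}) : Prop :=
  [/\ submodule N, N <> fullv &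
    forall N' : {vspace V}, submodule N' -> (N <= N')%VS ->
      N' = N \/ N' = fullv].

Definition in_rad (V : LUmod) (v : V) : Prop :=
  forall N : {vspace V}, maximal_submodule N -> v \in N.

Definition is_top (V T : LUmod) : Prop :=
  exists f : 'Hom(V, T),
    [/\ LUhom f, LUsurj f & forall v, f v = 0 <-> in_rad v].

Definition is_weyl (i : nat) (D : LUmod) : Prop :=
  exists m : int -> D,
    [/\ basis_of fullv [seq m k%:Z | k <- iota 0 i.+1],
        forall k : int, (k < 0) || (i%:Z < k) -> m k = 0,
        forall k : nat, (k <= i)%N ->
          LK ∙ m k%:Z = q ^ (i%:Z - 2 * k%:Z) *: m k%:Z,
        forall n k : nat, (k <= i)%N ->
          LE n ∙ m k%:Z = qbinom_at (i - k + n) n *: m (k%:Z - n%:Z)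
      & forall n k : nat, (k <= i)%N ->
          LF n ∙ m k%:Z = qbinom_at (k + n) n *: m (k%:Z + n%:Z)].

Definition is_Lq (i : nat) (V : LUmod) : Prop :=
  exists2 D : LUmod, is_weyl i D & is_top D V.

Definition type_I (l : nat) (V : LUmod) : Prop :=
  exists (p : nat) (w : 'I_p -> int) (W : 'I_p -> {vspace V}),
    [/\ injective w, directv (\sum_j W j), (\sum_j W j)%VS = fullv
      & forall j (v : V), v \in W j ->
          LH l ∙ v = (w j)%:~R *: v /\ LK ∙ v = q ^ (w j) *: v].

Definition projective_type_I (l : nat) (P : LUmod) : Prop :=
  type_I l P /\
  forall (V W : LUmod) (g : 'Hom(V, W)) (f : 'Hom(P, W)),
    type_I l V -> type_I l W -> LUhom g -> LUsurj g -> LUhom f ->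
    exists2 h : 'Hom(P, V), LUhom h & forall x, g (h x) = f x.

Definition projective_cover (l : nat) (P V : LUmod) : Prop :=
  projective_type_I l P /\
  exists f : 'Hom(P, V),
    [/\ LUhom f, LUsurj f &
      forall N : {vspace P}, submodule N -> (N + lker f)%VS = fullv ->
        N = fullv].

Definition is_Pq (l i : nat) (P : LUmod) : Prop :=
  exists2 V : LUmod, is_Lq i V & projective_cover l P V.

Section DirectSum.
Variables V W : LUmod.

Definition dsum_act (x : LU) (u : V * W) : V * W := (x ∙ u.1, x ∙ u.2).

Fact dsum_act_linear x : linear (dsum_act x).
Proof. by move=> a u v; rewrite /dsum_act /= !LUact_linear. Qed.

Fact dsum_act_linearl u (a : R[i]) (x y : LU) :
  dsum_act (a *: x + y) u = a *: dsum_act x u + dsum_act y u.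
Proof. by rewrite /dsum_act !LUact_linearl. Qed.

Fact dsum_act1 u : dsum_act 1 u = u.
Proof. by case: u => u1 u2; rewrite /dsum_act !LUact1. Qed.

Fact dsum_actM x y u : dsum_act (x * y) u = dsum_act x (dsum_act y u).
Proof. by rewrite /dsum_act !LUactM. Qed.

Definition dsum : LUmod :=
  @LUMod (V * W)%type dsum_act dsum_act_linear dsum_act_linearl
    dsum_act1 dsum_actM.

End DirectSum.

Section Copies.
Variables (n : nat) (V : LUmod).

Definition copies_act (x : LU) (u : {ffun 'I_n -> V}) : {ffun 'I_n -> V} :=
  [ffun j => x ∙ u j].

Fact copies_act_linear x : linear (copies_act x).
Proof. by move=> a u v; apply/ffunP=> j; rewrite !ffunE LUact_linear. Qed.

Fact copies_act_linearl u (a : R[i]) (x y : LU) :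
  copies_act (a *: x + y) u = a *: copies_act x u + copies_act y u.
Proof. by apply/ffunP=> j; rewrite !ffunE LUact_linearl. Qed.

Fact copies_act1 u : copies_act 1 u = u.
Proof. by apply/ffunP=> j; rewrite !ffunE LUact1. Qed.

Fact copies_actM x y u : copies_act (x * y) u = copies_act x (copies_act y u).
Proof. by apply/ffunP=> j; rewrite !ffunE LUactM. Qed.

Definition copies : LUmod :=
  @LUMod {ffun 'I_n -> V} copies_act copies_act_linear copies_act_linearl
    copies_act1 copies_actM.

End Copies.

Definition bilinear_map (V W Z : vectType R[i]) (b : V -> W -> Z) : Prop :=
  (forall v, linear (b v)) /\ (forall w, linear (b^~ w)).

(* T is the module V (x) W: its carrier is the tensor product of vector       *)
(* spaces (universal bilinear map b), and K, E^(n), F^(n) act on pure tensors *)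
(* through the coproduct.  These elements (with K^-1) generate LU_q, hence T  *)
(* is determined up to isomorphism.                                           *)
Definition is_tensor (V W T : LUmod) : Prop :=
  exists b : V -> W -> T,
    [/\ bilinear_map b,
        forall (Z : vectType R[i]) (f : V -> W -> Z), bilinear_map f ->
          exists! g : 'Hom(T, Z), forall v w, g (b v w) = f v w,
        forall v w, LK ∙ b v w = b (LK ∙ v) (LK ∙ w),
        forall n v w, LE n ∙ b v w =
          \sum_(m < n.+1) q ^- (m * (n - m)) *:
            b ((LE (n - m) * LKi ^+ m) ∙ v) (LE m ∙ w)
      & forall n v w, LF n ∙ b v w =
          \sum_(m < n.+1) q ^+ (m * (n - m)) *:
            b (LF m ∙ v) ((LK ^+ m * LF (n - m)) ∙ w)].

Definition tensor_iso (V W N : LUmod) : Prop :=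
  exists2 T : LUmod, is_tensor V W T & LUiso T N.

End Specialization.

(* Main.v *)
(* The module [V (x) L(1)] is realized on [V * V].  Since [L(1)] is self-dual, this *)
(* functor is its own adjoint; it is exact, hence preserves projectives. *)
(* The divided powers satisfy E^(a) F^(b) = sum_j F^(b-j) [K; 2j-a-b; j] E^(a-j), *)
(* and on a vector of weight n the torus element [K; c; j] acts as the value at q *)
(* of a Gaussian binomial.  So a primitive vector of weight n generates a quotient *)
(* of the Weyl module, and L(i) has the basis F^(k) v, k <= i, k mod l <= i mod l. *)
(* If n = -1 mod l, primitive vectors of weight n lift along surjections, so L(n) *)
(* is projective. *)
(* By adjunction, explicit primitive vectors in L(b) (x) L(1) produce nonzero maps *)
(* P(i) (x) L(1) -> L(b) for every P(b) in the asserted decomposition, and by *)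
(* projectivity a surjection of P(i) (x) L(1) onto the asserted sum.  The resulting *)
(* inequalities say that the dimensions of the P(rl + s) form a concave sequence in *)
(* s; its end values are those of projective simple modules, and P((r+1)l - 2) is a *)
(* quotient of L((r+1)l - 1) (x) L(1).  Hence the sequence is constant and all the *)
(* surjections are isomorphisms. *)

Require Import Defs.
From HB Require Import structures.
From mathcomp Require Import all_boot all_order all_algebra complex reals.
From mathcomp Require Import all_field boolp classical_sets ring zify.

Set Implicit Arguments.
Unset Strict Implicit.
Unset Printing Implicit Defensive.

Import GRing.Theory.
Local Open Scope ring_scope.

(** Computations take place in the ring of rational functions regular at q, a discrete valuation
    ring with uniformizer t^(2l) - 1. There [n]! has valuation floor(n/l) ([qfact_val]), so for k <=
    n the binomial [n; k] is nonzero at q exactly when k mod l <= n mod l. The formula for E^(a)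
    F^(b) ([EF_comm]), whose torus coefficients act on weight vectors by Gaussian binomials
    evaluated at q ([tbin_act]), then describes the simple modules: L(i) has the basis F^(k) v0 with
    [i; k] nonzero at q ([is_Lq_hw]), hence dimension (r+1)(s+1) ([dim_L]).

    Two facts produce projectives. For n = -1 mod l, primitive vectors of weight n lift along
    surjections, one simple layer of the kernel at a time ([steinberg_lift]), so L(n) is its own
    projective cover ([steinberg_Pq]). And tensoring with L(1) is its own adjoint ([adj_left],
    [adj_right]) and keeps maps surjective, so it preserves projectives ([TL_projective]).

    For s <> l-1, primitive vectors give nonzero maps from L(i) (x) L(1) onto L(i+1) and, if s > 0,
    onto L(i-1); they are jointly surjective and the dimensions agree ([L_rule]).

    For the second rule, nonzero maps P(i) -> L(b) (x) L(1) become by adjunction maps P(i) (x) L(1)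
    -> L(b), which lift to P(b); together they map P(i) (x) L(1) onto the asserted sum ([onto_PL1]).
    A second copy of P(i+1) at s = l-2 comes from [P_up2], the summand P(i+2l-1) at s = 0 from
    [P_far]. Put y_k = dim P(rl+k-1) for 0 < k < l and y_0 = y_l = 2(r+1)l. The surjections say y_s
    + y_(s+2) <= 2 y_(s+1), and the surjection of L((r+1)l-1) (x) L(1) onto P((r+1)l-2) says y_(l-1)
    <= y_l. A concave sequence with these end conditions is constant ([concave_const],
    [pdim_const]), so all these surjections are isomorphisms, including the one that gives the first
    rule at s = l-1. *)

Lemma geo_div (F : fieldType) (x d u : F) : x != 0 -> d != 0 -> u != 0 ->
  (x - x^-1) / d / u = d^-1 * x^-1 * ((x * x - 1) / u).
Proof. by move=> x0 d0 u0; field; rewrite x0 d0 u0. Qed.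

Lemma unif_cancel (F : fieldType) (x y z u v : F) :
  x != 0 -> y != 0 -> z != 0 -> u != 0 -> v != 0 ->
  x / (u * v) / (y / u * (z / v)) = x / (y * z).
Proof. by move=> *; field; apply/and4P. Qed.

Lemma unif_cancel1 (F : fieldType) (w x y z u v : F) :
  w != 0 -> x != 0 -> y != 0 -> z != 0 -> u != 0 -> v != 0 ->
  w * (x / (w * (u * v)) / (y / u * (z / v))) = x / (y * z).
Proof. by move=> *; field; do !(apply/andP; split). Qed.

(** * Rational functions regular at q *)

Section PolyEval.
Variables (C : numFieldType) (q : C).

Definition pev (p : {poly rat}) : C := (map_poly ratr p).[q].

Lemma pevD : {morph pev : p r / p + r}.
Proof. by move=> p r; rewrite /pev rmorphD hornerD. Qed.
Lemma pevM : {morph pev : p r / p * r}.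
Proof. by move=> p r; rewrite /pev rmorphM hornerM. Qed.
Lemma pevN p : pev (- p) = - pev p.
Proof. by rewrite /pev rmorphN hornerN. Qed.
Lemma pev1 : pev 1 = 1.
Proof. by rewrite /pev rmorph1 hornerC. Qed.
Lemma pevX : pev 'X = q.
Proof. by rewrite /pev map_polyX hornerX. Qed.
Lemma pevXn n : pev ('X^n) = q ^+ n.
Proof. by rewrite /pev map_polyXn hornerXn. Qed.

Hypothesis q0 : q != 0.
Variable l : nat.
Hypotheses (hl : (2 <= l)%N) (hq : l.-primitive_root (q ^+ 2)).

Lemma q2l : q ^+ (2 * l) = 1.
Proof. by rewrite exprM (prim_expr_order hq). Qed.

Lemma char0 n : (n%:R == 0 :> C) = (n == 0)%N.
Proof. exact: Num.Theory.pnatr_eq0. Qed.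

(** The derivative 2l X^(2l-1) of X^(2l) - 1 is nonzero at q, so q is a simple root and cannot be a
    root of both factors. *)
Lemma simple_root_X2l (g c : {poly rat}) :
  'X^(2 * l) - 1 = g * c -> pev g = 0 -> pev c != 0.
Proof.
move=> e g0; apply/eqP => c0.
have /(congr1 (fun p => (map_poly ratr p : {poly C})^`().[q])) := e.
rewrite rmorphM /= derivM !hornerE.
rewrite -[(map_poly ratr g).[q]]/(pev g) -[(map_poly ratr c).[q]]/(pev c) g0 c0.
rewrite mulr0 mul0r addr0 rmorphB /= map_polyXn rmorph1 derivB derivXn derivC subr0.
rewrite hornerMn hornerXn => /eqP; rewrite -mulr_natr mulf_eq0 expf_eq0 (negPf q0) andbF /= char0.
by rewrite muln_eq0 /= gtn_eqF // (leq_trans _ hl).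
Qed.

Variables (F : fieldType) (iota : {rmorphism {poly rat} -> F}).
Hypothesis iota_inj : injective iota.

(** Phrased for an abstract field [F] containing the rational polynomials, so that [field] meets
    only abstract elements; [vat] is the instance at [Qt]. *)
Definition gvat (f : F) (a : C) : Prop := exists n d : {poly rat},
  [/\ f = iota n / iota d, pev d != 0 & a = pev n / pev d].

Lemma pev_neq0 d : pev d != 0 -> iota d != 0.
Proof.
apply: contraNneq => /eqP; rewrite -(rmorph0 iota) (inj_eq iota_inj) => /eqP ->.
by rewrite /pev rmorph0 horner0.
Qed.

Lemma gvat_uniq f a b : gvat f a -> gvat f b -> a = b.
Proof.
move=> [n [d [-> d0 ->]]] [n' [d' [/eqP e d0' ->]]].
move: e; rewrite eqr_div ?pev_neq0 // -!rmorphM (inj_eq iota_inj) => /eqP e.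
by apply/eqP; rewrite eqr_div // -!pevM e.
Qed.

Lemma gvat_poly p : gvat (iota p) (pev p).
Proof. by exists p, 1; rewrite rmorph1 pev1 oner_eq0 !divr1. Qed.

Lemma gvatD f g a b : gvat f a -> gvat g b -> gvat (f + g) (a + b).
Proof.
move=> [n [d [-> d0 ->]]] [n' [d' [-> d0' ->]]].
exists (n * d' + n' * d), (d * d'); split.
- by rewrite rmorphD !rmorphM /= addf_div ?pev_neq0.
- by rewrite pevM mulf_neq0.
- by rewrite pevD !pevM addf_div.
Qed.

Lemma gvatM f g a b : gvat f a -> gvat g b -> gvat (f * g) (a * b).
Proof.
move=> [n [d [-> d0 ->]]] [n' [d' [-> d0' ->]]].
exists (n * n'), (d * d'); split.
- by rewrite !rmorphM /= mulf_div.
- by rewrite pevM mulf_neq0.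
- by rewrite !pevM mulf_div.
Qed.

Lemma gvatN f a : gvat f a -> gvat (- f) (- a).
Proof.
move=> [n [d [-> d0 ->]]]; exists (- n), d; split => //.
- by rewrite rmorphN mulNr.
- by rewrite pevN mulNr.
Qed.

Lemma gvatV f a : gvat f a -> a != 0 -> gvat f^-1 a^-1.
Proof.
move=> [n [d [-> d0 ->]]] a0; exists d, n; split; rewrite ?invf_div //.
by apply: contraNneq a0 => ->; rewrite mul0r.
Qed.

Lemma iotaX2l_neq0 : iota 'X ^+ (2 * l) - 1 != 0.
Proof.
rewrite -rmorphXn -(rmorph1 iota) -rmorphB /= -(rmorph0 iota) (inj_eq iota_inj).
by rewrite -size_poly_eq0 size_XnsubC // muln_gt0 /= (leq_trans _ hl).
Qed.

(** By Bezout the gcd [g] of the numerator and X^(2l) - 1 still vanishes at q. As q is a simple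
    root, the cofactor of [g] in X^(2l) - 1 does not, and it can go into the denominator. *)
Lemma gvat_div_unif f :
  gvat f 0 -> exists a, gvat (f / (iota 'X ^+ (2 * l) - 1)) a.
Proof.
move=> [n [d [-> d0 /esym/eqP]]]; rewrite mulf_eq0 invr_eq0 (negPf d0) orbF => /eqP n0.
pose g := gcdp n ('X^(2 * l) - 1).
have gn : g %| n := dvdp_gcdl _ _; have gX : g %| 'X^(2 * l) - 1 := dvdp_gcdr _ _.
have g0 : pev g = 0.
  have [[u v] /=] := Bezoutp n ('X^(2 * l) - 1); rewrite -/g => /andP[/dvdpP[c ->] _].
  rewrite pevM pevD !pevM n0 pevD pevXn pevN pev1 q2l.
  by rewrite subrr !mulr0 addr0 mulr0.
have [b eb] := dvdpP _ _ gn; have [c ec] := dvdpP _ _ gX.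
have c0 : pev c != 0 by apply: simple_root_X2l g0; rewrite ec mulrC.
have eX : iota 'X ^+ (2 * l) - 1 = iota c * iota g.
  by rewrite -rmorphM -ec rmorphB /= rmorphXn rmorph1.
have gne : iota g != 0.
  by apply: contraNneq iotaX2l_neq0 => g00; rewrite eX g00 mulr0.
exists (pev b / pev (d * c)), b, (d * c); split=> //; last by rewrite pevM mulf_neq0.
rewrite eX {1}eb !rmorphM /=.
by field; rewrite gne !pev_neq0.
Qed.

End PolyEval.

Lemma tofrac_poly_inj : injective (@tofrac _ : {poly rat} -> Qt).
Proof. by move=> p r /eqP; rewrite tofrac_eq => /eqP. Qed.

Lemma qt_neq0 : qt != 0.
Proof. by rewrite /qt tofrac_eq0 polyX_eq0. Qed.

Section Regular.
Variables (C : numFieldType) (q : C).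

(* [vat f a]: the rational function [f] is regular at [q], with value [a]. *)
Definition vat : Qt -> C -> Prop := gvat q (@tofrac _).

Lemma vat_uniq f a b : vat f a -> vat f b -> a = b.
Proof. exact: gvat_uniq tofrac_poly_inj _ _ _. Qed.

Lemma vat_poly p : vat (tofrac p) (pev q p).
Proof. exact: gvat_poly. Qed.
Lemma vatD f g a b : vat f a -> vat g b -> vat (f + g) (a + b).
Proof. exact: (gvatD tofrac_poly_inj). Qed.
Lemma vatM f g a b : vat f a -> vat g b -> vat (f * g) (a * b).
Proof. exact: gvatM. Qed.
Lemma vatN f a : vat f a -> vat (- f) (- a).
Proof. exact: gvatN. Qed.
Lemma vatV f a : vat f a -> a != 0 -> vat f^-1 a^-1.
Proof. exact: gvatV. Qed.
Lemma vatB f g a b : vat f a -> vat g b -> vat (f - g) (a - b).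
Proof. by move=> hf hg; apply/vatD/vatN. Qed.

Lemma vat1 : vat 1 1.
Proof. by have := vat_poly 1; rewrite pev1 tofrac1. Qed.
Lemma vat_qt : vat qt q.
Proof. by have := vat_poly 'X; rewrite pevX. Qed.

Definition qtl (l : nat) : Qt := qt ^+ (2 * l) - 1.

Lemma vat_div_qtl l f : q != 0 -> (2 <= l)%N -> l.-primitive_root (q ^+ 2) ->
  vat f 0 -> exists a, vat (f / qtl l) a.
Proof. by move=> q0 hl hq; exact: (gvat_div_unif q0 hl hq tofrac_poly_inj). Qed.

Lemma qtl_neq0 l : (2 <= l)%N -> qtl l != 0.
Proof. move=> hl; have := @iotaX2l_neq0 l hl _ (@tofrac {poly rat}) tofrac_poly_inj.
by []. Qed.

#[local] Strategy opaque [Qt qt].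

Lemma vat0 : vat 0 0.
Proof. by rewrite -(subrr 1) -[X in vat _ X](subrr 1); apply: vatB; exact: vat1. Qed.

Lemma vat_sum (I : Type) (r : seq I) (P : pred I) (f : I -> Qt) g :
  (forall i, P i -> vat (f i) (g i)) ->
  vat (\sum_(i <- r | P i) f i) (\sum_(i <- r | P i) g i).
Proof.
move=> h; elim/big_rec2: _ => [|i x y Pi hxy]; first exact: vat0.
exact: vatD (h _ Pi) hxy.
Qed.

Lemma vatX f a n : vat f a -> vat (f ^+ n) (a ^+ n).
Proof.
move=> h; elim: n => [|n ih]; first exact: vat1.
by rewrite !exprS; apply: vatM.
Qed.

Variable l : nat.
Hypotheses (q0 : q != 0) (hl : (2 <= l)%N) (hq : l.-primitive_root (q ^+ 2)).

(* A uniformizer of the local ring of rational functions regular at [q]. *)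
Definition unif : Qt := qtl l.

Lemma unif_neq0 : unif != 0. Proof. exact: qtl_neq0. Qed.

Lemma vat_div_unif f : vat f 0 -> exists a, vat (f / unif) a.
Proof. exact: vat_div_qtl. Qed.

Lemma vat_unif : vat unif 0.
Proof.
have := vatB (vatX (2 * l) vat_qt) vat1.
by rewrite (q2l hq) subrr.
Qed.

Lemma vat_qtz (n : int) : vat (qt ^ n) (q ^ n).
Proof.
case: n => n; rewrite ?NegzE ?exprnN -?exprnP; first exact: vatX vat_qt.
by apply: vatV; [exact: vatX vat_qt|rewrite expf_neq0].
Qed.

Definition aunit (f : Qt) := exists2 a, vat f a & a != 0.

Lemma aunitM f g : aunit f -> aunit g -> aunit (f * g).
Proof.
by move=> [a ha a0] [b hb b0]; exists (a * b); [exact: vatM|rewrite mulf_neq0].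
Qed.

Lemma aunitV f : aunit f -> aunit f^-1.
Proof. by move=> [a ha a0]; exists a^-1; [exact: vatV|rewrite invr_eq0]. Qed.

Lemma aunit_neq0 f : aunit f -> f != 0.
Proof.
by move=> [a ha a0]; apply: contraNneq a0 => f0; rewrite f0 in ha; rewrite (vat_uniq ha vat0).
Qed.

Lemma aunit1 : aunit 1.
Proof. by exists 1; [exact: vat1|exact: oner_neq0]. Qed.

Lemma aunit_qtz n : aunit (qt ^ n).
Proof. by exists (q ^ n); [exact: vat_qtz|rewrite expfz_neq0]. Qed.

Lemma q_neq_V : q - q^-1 != 0.
Proof.
rewrite subr_eq0; apply/eqP => /(congr1 (fun x => x * q)); rewrite mulVf // -expr2.
move/eqP; rewrite -(prim_order_dvd hq 1) dvdn1; lia.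
Qed.

Definition qden : Qt := qt - qt^-1.

Lemma vat_qden : vat qden (q - q^-1).
Proof. by apply: vatB; [exact: vat_qt|apply: vatV => //; exact: vat_qt]. Qed.

Lemma aunit_qden : aunit qden.
Proof. by exists (q - q^-1); [exact: vat_qden|exact: q_neq_V]. Qed.

Lemma qden_neq0 : qden != 0.
Proof. exact: aunit_neq0 aunit_qden. Qed.

Definition qint (n : int) : Qt := (qt ^ n - qt ^ (- n)) / qden.
Definition qintv (n : int) : C := (q ^ n - q ^ (- n)) / (q - q^-1).

Lemma vat_qint n : vat (qint n) (qintv n).
Proof.
apply: vatM; first by apply: vatB; exact: vat_qtz.
exact: vatV vat_qden q_neq_V.
Qed.

Lemma qnumE n : qnum n = qint n%:Z.
Proof. by rewrite /qnum /qint -exprnN exprnP. Qed.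

Lemma qintv_neq0 (n : nat) : ~~ (l %| n)%N -> qintv n%:Z != 0.
Proof.
move=> hn; rewrite mulf_neq0 ?invr_eq0 ?q_neq_V // subr_eq0; apply: contra hn => /eqP.
move/(congr1 (fun x => x * q ^ n%:Z)) => /=; rewrite -!expfzDr // addNr expr0z -PoszD addnn -mul2n => e.
by rewrite (prim_order_dvd hq) -exprM; apply/eqP.
Qed.

Lemma unif_geo n : qt ^+ (2 * l * n) - 1 = unif * \sum_(k < n) qt ^+ (2 * l * k).
Proof. by rewrite exprM subrX1; congr (_ * _); apply: eq_bigr => k _; rewrite -exprM. Qed.

(** A geometric sum of n terms, each equal to 1 at q. For K = t^n the quotient is (K^(2l) -
    1)/(t^(2l) - 1), which is why [H] acts as n in weight n. *)
Lemma vat_geo n : vat ((qt ^+ (2 * l * n) - 1) / unif) n%:R.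
Proof.
rewrite unif_geo mulrAC divff ?unif_neq0 // mul1r.
have -> : n%:R = \sum_(k < n) q ^+ (2 * l * k).
  rewrite (eq_bigr (fun=> 1)) ?sumr_const ?card_ord // => k _.
  by rewrite exprM (q2l hq) expr1n.
by apply: vat_sum => k _; apply: vatX vat_qt.
Qed.

Lemma vat_geoz (n : int) : vat ((qt ^ (n * (2 * l)%N) - 1) / unif) n%:~R.
Proof.
case: n => n; first by rewrite -PoszM mulnC; exact: vat_geo.
rewrite NegzE mulNr -PoszM mulrNz.
have -> : (qt ^ (- (n.+1 * (2 * l))%N%:Z) - 1) / unif =
  - (qt ^ (- (n.+1 * (2 * l))%N%:Z) * ((qt ^+ (2 * l * n.+1) - 1) / unif)).
  rewrite mulrA mulrBr -[qt ^+ _]/(qt ^ (_%:Z)) -expfzDr ?qt_neq0 // mulnC addNr.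
  by rewrite expr0z mulr1 -mulNr opprB.
apply: vatN; have := vatM (vat_qtz (- (n.+1 * (2 * l))%N%:Z)) (vat_geo n.+1).
suff -> : q ^ (- (n.+1 * (2 * l))%N%:Z) = 1 by rewrite mul1r.
by rewrite -exprnN mulnC exprM (q2l hq) expr1n invr1.
Qed.

Lemma qnum_dvd n : (0 < n)%N -> aunit (qnum (n * l) / unif).
Proof.
move=> n0; have -> : qnum (n * l) / unif =
   qden^-1 * qt ^ (- (n * l)%N%:Z) * ((qt ^+ (2 * l * n) - 1) / unif).
  rewrite qnumE /qint.
  have -> : (2 * l * n = n * l + n * l)%N by lia.
  rewrite exprD -[qt ^ (- _)]exprnN -[qt ^ _%:Z]/(qt ^+ _).
  apply: geo_div; [exact: expf_neq0 _ qt_neq0|exact: qden_neq0|exact: unif_neq0].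
apply: aunitM; first by apply: aunitM (aunit_qtz _); exact: aunitV aunit_qden.
by exists n%:R; [exact: vat_geo|rewrite char0 -lt0n].
Qed.

Lemma aunit_qnum n : ~~ (l %| n)%N -> aunit (qnum n).
Proof. by move=> h; exists (qintv n%:Z); [rewrite qnumE; exact: vat_qint|exact: qintv_neq0]. Qed.

Lemma qfactS n : qfact n.+1 = qfact n * qnum n.+1.
Proof. by rewrite /qfact big_nat_recr. Qed.

(** Among [1], ..., [n] exactly the floor(n/l) factors with index divisible by l vanish at q, each
    to first order by [qnum_dvd]. *)
Lemma qfact_val n : aunit (qfact n / unif ^+ (n %/ l)).
Proof.
have l0 : (0 < l)%N by lia.
elim: n => [|n ih]; first by rewrite /qfact big_geq // div0n divr1; exact: aunit1.
rewrite qfactS; have [/dvdnP[m em]|nd] := boolP (l %| n.+1)%N; last first.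
  have -> : (n.+1 %/ l = n %/ l)%N.
    by rewrite divnS // (negPf nd).
  by rewrite mulrAC; apply: aunitM ih (aunit_qnum nd).
have -> : (n.+1 %/ l = (n %/ l).+1)%N by rewrite divnS // em dvdn_mull // addn1.
have -> : qfact n * qnum n.+1 / unif ^+ (n %/ l).+1 =
    qfact n / unif ^+ (n %/ l) * (qnum (m * l) / unif).
  by rewrite em exprSr invfM mulrACA.
by apply: aunitM ih _; apply: qnum_dvd; case: m em.
Qed.

Lemma qfact_neq0 n : qfact n != 0.
Proof.
have := aunit_neq0 (qfact_val n); apply: contraNneq => ->; by rewrite mul0r.
Qed.

(** Adding k and n - k produces no carry in the lowest digit, so floor(n/l) = floor(k/l) +
    floor((n-k)/l) and the powers of the uniformizer cancel. *)
Lemma qbinom_unit n k : (k <= n)%N -> (k %% l <= n %% l)%N -> aunit (qbinom n k).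
Proof.
move=> kn km; rewrite /qbinom kn.
have e : (n %/ l = k %/ l + (n - k) %/ l)%N.
  have l0 := ltnW hl.
  have nl : (n %% l < l)%N by rewrite ltn_mod.
  have := divn_eq (n - k) l; have := ltn_pmod (n - k) l0.
  have := divn_eq n l; have := divn_eq k l.
  move: (n %/ l)%N (k %/ l)%N (n %% l)%N (k %% l)%N ((n - k) %/ l)%N ((n - k) %% l)%N km nl.
  clear -kn => a b s t c u km nl ek en ul ec.
  have {}ec : (a * l + s = b * l + t + c * l + u)%N by lia.
  have : (a * l < (b + c).+1 * l)%N by rewrite !mulSn mulnDl; lia.
  have : ((b + c) * l < a.+1 * l)%N by rewrite mulnDl mulSn; lia.
  by rewrite !ltn_mul2r; lia.
have := aunitM (qfact_val n) (aunitV (aunitM (qfact_val k) (qfact_val (n - k)))).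
rewrite e exprD; congr aunit.
by apply: unif_cancel; first [exact: qfact_neq0 | exact: expf_neq0 _ unif_neq0].
Qed.

(** For k <= n the addition of k and n - k carries in the lowest digit, and one power of the
    uniformizer is left in the numerator. *)
Lemma qbinom_van n k : (n %% l < k %% l)%N -> vat (qbinom n k) 0.
Proof.
move=> km; rewrite /qbinom; case: leqP => kn; last exact: vat0.
have l0 := ltnW hl.
have e : (n %/ l = (k %/ l + (n - k) %/ l).+1)%N.
  have kl : (k %% l < l)%N by rewrite ltn_mod.
  have := divn_eq (n - k) l; have := ltn_pmod (n - k) l0.
  have := divn_eq n l; have := divn_eq k l.
  move: (n %/ l)%N (k %/ l)%N (n %% l)%N (k %% l)%N ((n - k) %/ l)%N ((n - k) %% l)%N km kl.
  clear -kn => a b s t c u km kl ek en ul ec.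
  have {}ec : (a * l + s = b * l + t + c * l + u)%N by lia.
  have : (a * l < (b + c).+2 * l)%N by rewrite !mulSn mulnDl; lia.
  have : ((b + c) * l < a * l)%N by rewrite mulnDl; lia.
  by rewrite !ltn_mul2r; lia.
have [c hc _] := aunitM (qfact_val n) (aunitV (aunitM (qfact_val k) (qfact_val (n - k)))).
have := vatM vat_unif hc; rewrite mul0r; congr vat.
rewrite e exprS exprD.
by apply: unif_cancel1; first [exact: qfact_neq0 | exact: expf_neq0 _ unif_neq0 | exact: unif_neq0].
Qed.

End Regular.

Lemma vat_lim (R : realType) (q : R[i]) f a : vat q f a -> lim_at q f = a.
Proof.
move=> h; rewrite /lim_at; case: xgetP => [b _ hb|/(_ a) []//].
exact: vat_uniq hb h.
Qed.

(** * Gaussian binomials and the torus part of the quantum group *)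

Lemma qbinomE n k : (k <= n)%N -> qbinom n k = qfact n / (qfact k * qfact (n - k)).
Proof. by rewrite /qbinom => ->. Qed.

Lemma qbinom_small n k : (n < k)%N -> qbinom n k = 0.
Proof. by rewrite /qbinom ltnNge => /negPf ->. Qed.

Lemma qfact0 : qfact 0 = 1.
Proof. by rewrite /qfact big_geq. Qed.

Lemma qintE n : qint n = (qt ^ n - qt ^ (- n)) / qden.
Proof. by []. Qed.

Lemma qtz_neq0 n : qt ^ n != 0.
Proof. exact: expfz_neq0 qt_neq0. Qed.

Lemma qtzD m n : qt ^ (m + n) = qt ^ m * qt ^ n.
Proof. exact: expfzDr qt_neq0. Qed.

Lemma pascal_id (F : fieldType) (x y d : F) : x != 0 -> y != 0 -> d != 0 ->
  (x * y - (x * y)^-1) / d = x^-1 * ((y - y^-1) / d) + y * ((x - x^-1) / d).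
Proof. by move=> *; field; do !(apply/andP; split). Qed.

Lemma pascal_div (F : fieldType) (f g h a b c u v : F) :
  g != 0 -> h != 0 -> a != 0 -> b != 0 -> c = u * b + v * a ->
  f * c / (g * a * (h * b)) = u * (f / (g * a * h)) + v * (f / (g * (h * b))).
Proof. by move=> *; subst c; field; do !(apply/andP; split). Qed.

Lemma scal_cancel (F : fieldType) (f p g u : F) : f != 0 -> p != 0 -> g != 0 -> u != 0 ->
  f / u / (p * g) / f * p = u^-1 / g.
Proof. by move=> *; field; do !(apply/andP; split). Qed.

Lemma fact_cancel (F : fieldType) (f g h : F) : f != 0 -> g != 0 -> h != 0 ->
  f^-1 = (f / (g * h))^-1 * (h^-1 * g^-1).
Proof. by move=> *; field; do !(apply/andP; split). Qed.

Lemma div_mulK (F : fieldType) (f a b : F) : b != 0 -> f / (a * b) * b = f / a.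
Proof. by move=> b0; rewrite invfM mulrA divfK. Qed.

Lemma div_add1 (F : fieldType) (g u : F) : g != 0 -> u != 0 ->
  (1 + g) / u / g = u^-1 / g + u^-1.
Proof. by move=> *; field; do !(apply/andP; split). Qed.

(** Central scalars from Q(t) together with an invertible K. Identities proved for every such ring
    hold in U_t ([Ut_torus]) and also in Q(t) with K = t^n ([num_torus]), which computes the action
    on weight n. *)
Record torus (B : pzRingType) := Torus {
  tS : Qt -> B; tK : B; tKi : B;
  tS1 : tS 1 = 1;
  tSD : {morph tS : x y / x + y};
  tSM : {morph tS : x y / x * y};
  tSC : forall c x, tS c * x = x * tS c;
  tKKi : tK * tKi = 1;
  tKiK : tKi * tK = 1 }.

Section Torus.
Variables (C : numFieldType) (q : C) (l : nat).
Hypotheses (q0 : q != 0) (hl : (2 <= l)%N) (hq : l.-primitive_root (q ^+ 2)).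

Let qf0 n : qfact n != 0 := qfact_neq0 q0 hl hq n.

Lemma qint_add m n : qint (m + n) = qt ^ (- m) * qint n + qt ^ n * qint m.
Proof.
rewrite !qintE opprD !qtzD -!invr_expz -invfM.
by apply: pascal_id; [exact: qtz_neq0|exact: qtz_neq0|exact: qden_neq0 q0 hl hq].
Qed.

Lemma qnum_neq0 n : qnum n.+1 != 0.
Proof. by have := qf0 n.+1; rewrite qfactS; apply: contraNneq => ->; rewrite mulr0. Qed.

Lemma qbinom0 n : qbinom n 0 = 1.
Proof. by rewrite qbinomE // subn0 qfact0 mul1r divff ?qf0. Qed.

Lemma qbinomnn n : qbinom n n = 1.
Proof. by rewrite qbinomE // subnn qfact0 mulr1 divff ?qf0. Qed.

Lemma qbinomS n j : qbinom n.+1 j.+1 =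
  qt ^ (- j.+1%:Z) * qbinom n j.+1 + qt ^ (n%:Z - j%:Z) * qbinom n j.
Proof.
have [jn|jn|->] := ltngtP j n; last first.
- by rewrite !qbinomnn qbinom_small // mulr0 add0r subrr mulr1.
- by rewrite !qbinom_small ?mulr0 ?addr0 //; lia.
rewrite (@qbinomE n.+1) ?ltnS ?(ltnW jn) // subSS (@qbinomE n j.+1) // (@qbinomE n j) ?(ltnW jn) //.
have -> : (n - j = (n - j.+1).+1)%N by lia.
rewrite !qfactS; set m := (n - j.+1)%N.
apply: pascal_div; [exact: qf0|exact: qf0|exact: qnum_neq0|exact: qnum_neq0|].
rewrite !qnumE.
have -> : n.+1%:Z = j.+1%:Z + m.+1%:Z by rewrite /m; lia.
have -> : n%:Z - j%:Z = m.+1%:Z by rewrite /m; lia.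
exact: qint_add.
Qed.

Section OneTorus.
Variables (B : pzRingType) (d : torus B).
Local Notation S := (tS d).

Lemma tS0 : S 0 = 0.
Proof. by apply: (addrI (S 0)); rewrite -tSD !addr0. Qed.
Lemma tSN x : S (- x) = - S x.
Proof. by apply: (addrI (S x)); rewrite -tSD !subrr tS0. Qed.
Lemma tSCA x c y : x * (S c * y) = S c * (x * y).
Proof. by rewrite !mulrA tSC. Qed.
Lemma tSM2 a x b y : S a * x * (S b * y) = S (a * b) * (x * y).
Proof. by rewrite mulrA -(mulrA (S a)) -tSC mulrA -tSM -mulrA. Qed.
Lemma tSK c x : c != 0 -> S c^-1 * (S c * x) = x.
Proof. by move=> c0; rewrite mulrA -tSM mulVf // tS1 mul1r. Qed.

(** These are Lusztig's [K; c] and [K; c; j]; [tH] is (K^(2l) - 1)/(t^(2l) - 1), which specializes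
    to [LH] by [spr_H]. *)
Definition tint (c : int) : B :=
  S qden^-1 * (S (qt ^ c) * tK d - S (qt ^ (- c)) * tKi d).
Definition tbin (c : int) (j : nat) : B :=
  S (qfact j)^-1 * \prod_(s < j) tint (c - s%:Z).
Definition tH : B := S (unif l)^-1 * (tK d ^+ (2 * l) - 1).

(** The q-binomial theorem, by induction through the Pascal rule [qbinomS]. *)
Lemma gauss_binomial (z : B) n :
  \prod_(s < n) (1 + S (qt ^ (s%:Z * 2)) * z) =
  \sum_(j < n.+1) S (qt ^ (j%:Z * (n%:Z - 1)) * qbinom n j) * z ^+ j.
Proof.
elim: n => [|n ih].
  by rewrite big_ord0 big_ord_recl big_ord0 /= mul0r expr0z qbinom0 !mulr1 tS1 addr0.
rewrite big_ord_recr /= ih mulrDr mulr1.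
have z0 m k : S (qt ^ ((0%:Z : int) * m) * qbinom k 0) * z ^+ 0 = 1.
  by rewrite mul0r expr0z qbinom0 expr0 !mulr1 tS1.
rewrite [RHS]big_ord_recl [X in X + _ = _]big_ord_recl /= !z0.
rewrite -[LHS]addrA; congr (_ + _).
rewrite mulr_suml.
have -> : \sum_(i < n) S (qt ^ ((bump 0 i)%:Z * (n%:Z - 1)) * qbinom n (bump 0 i)) * z ^+ bump 0 i
   = \sum_(i < n.+1) S (qt ^ (i.+1%:Z * (n%:Z - 1)) * qbinom n i.+1) * z ^+ i.+1.
  by rewrite big_ord_recr /= (qbinom_small (ltnSn n)) mulr0 tS0 mul0r addr0.
rewrite -big_split /=; apply: eq_bigr => i _ /=.
have -> : S (qt ^ (i%:Z * (n%:Z - 1)) * qbinom n i) * z ^+ i * (S (qt ^ (n%:Z * 2)) * z)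
   = S (qt ^ (i%:Z * (n%:Z - 1)) * qbinom n i * qt ^ (n%:Z * 2)) * z ^+ i.+1.
  by rewrite tSM2 -exprSr.
rewrite -mulrDl -tSD qbinomS; congr (S _ * _).
rewrite [RHS]mulrDr !mulrA -!qtzD /bump /= add1n; congr (qt ^ _ * _ + _).
  by rewrite -addn1 PoszD; ring.
rewrite mulrAC -qtzD; congr (qt ^ _ * _).
by rewrite !intS; ring.
Qed.

Lemma tint_fact c : tint c = S (- qden^-1 * qt ^ (- c)) *
  (tKi d * (1 + S (- qt ^ (c * 2)) * tK d ^+ 2)).
Proof.
rewrite /tint [tKi d * _]mulrDr mulr1 [tKi d * _]tSCA expr2 [tKi d * (_ * _)]mulrA tKiK mul1r.
rewrite [LHS]mulrDr [RHS]mulrDr addrC -!mulNr -!tSN; congr (_ + _).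
  by rewrite mulrA -tSM mulrN mulNr.
by rewrite !mulrA -!tSM mulrN !mulNr opprK -mulrA -qtzD; congr (S (_ * qt ^ _) * _); ring.
Qed.

Lemma tKi_comm c : tKi d * (1 + S c * tK d ^+ 2) = (1 + S c * tK d ^+ 2) * tKi d.
Proof.
rewrite mulrDr mulrDl mulr1 mul1r tSCA -mulrA; congr (_ + _ * _).
by rewrite expr2 mulrA tKiK -mulrA tKKi mulr1 mul1r.
Qed.

Lemma tint_prod c n : \prod_(s < n) tint (c - s%:Z) =
  S (\prod_(s < n) (- qden^-1 * qt ^ (s%:Z - c))) *
  (tKi d ^+ n * \prod_(s < n) (1 + S (- qt ^ ((c - s%:Z) * 2)) * tK d ^+ 2)).
Proof.
elim: n => [|n ih]; first by rewrite !big_ord0 tS1 !mul1r.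
rewrite !big_ord_recr /= ih tint_fact opprB.
set X := \prod_(s < n) (1 + _); set y := 1 + _.
have Xc : X * tKi d = tKi d * X.
  rewrite /X; elim: (n) => [|m ih2]; first by rewrite !big_ord0 mulr1 mul1r.
  by rewrite !big_ord_recr /= -mulrA -tKi_comm mulrA ih2 mulrA.
by rewrite tSM2; congr (_ * _); rewrite exprSr !mulrA -[_ * X * _]mulrA Xc !mulrA.
Qed.

Lemma tprod_gauss c n : \prod_(s < n) (1 + S (- qt ^ ((c - s%:Z) * 2)) * tK d ^+ 2) =
  \sum_(j < n.+1) S (qt ^ (j%:Z * (n%:Z - 1)) * qbinom n j * (- qt ^ ((c - n%:Z + 1) * 2)) ^+ j)
    * tK d ^+ (2 * j).
Proof.
have := gauss_binomial (S (- qt ^ ((c - n%:Z + 1) * 2)) * tK d ^+ 2) n.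
have -> : \prod_(s < n) (1 + S (qt ^ (s%:Z * 2)) * (S (- qt ^ ((c - n%:Z + 1) * 2)) * tK d ^+ 2))
   = \prod_(s < n) (1 + S (- qt ^ ((c - s%:Z) * 2)) * tK d ^+ 2).
  (* The q-binomial theorem runs through the exponents in the opposite order; the factors commute,
     so the product may be reversed. *)
  rewrite (eq_bigr (fun s : 'I_n => 1 + S (- qt ^ ((c - (n - s.+1)%N%:Z) * 2)) * tK d ^+ 2)); last first.
    move=> s _; rewrite mulrA -tSM mulrN -qtzD; congr (1 + S (- qt ^ _) * _).
    by rewrite -subzn // -[s.+1]addn1 PoszD; ring.
  have cm a b : (1 + S a * tK d ^+ 2) * (1 + S b * tK d ^+ 2) =
                (1 + S b * tK d ^+ 2) * (1 + S a * tK d ^+ 2).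
    rewrite !mulrDr !mulrDl !mulr1 !mul1r -!addrA; congr (_ + _).
    rewrite addrCA; congr (_ + (_ + _)).
    by rewrite !tSM2 (mulrC a).
  pose f k := 1 + S (- qt ^ ((c - k%:Z) * 2)) * tK d ^+ 2.
  rewrite -[LHS]/(\prod_(s < n) f (n - s.+1)%N) -[RHS]/(\prod_(s < n) f s).
  have fc a b : f a * f b = f b * f a by exact: cm.
  elim: (n) => [|m ih]; first by rewrite !big_ord0.
  rewrite big_ord_recl big_ord_recr /= subn1 /=.
  rewrite (eq_bigr (fun s : 'I_m => f (m - s.+1)%N)) => [|s _]; last by congr f; rewrite /bump; lia.
  rewrite ih; elim: (m) {ih} (f m) (fc m) => [|k ih2] x xc; first by rewrite !big_ord0 mulr1 mul1r.
  by rewrite big_ord_recr /= mulrA ih2 // -mulrA xc mulrA.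
move=> ->; apply: eq_bigr => j _.
have -> (a : Qt) (x : B) m : (S a * x) ^+ m = S (a ^+ m) * x ^+ m.
  elim: m => [|m ih]; first by rewrite tS1 mul1r.
  by rewrite !exprS ih tSM2.
by rewrite mulrA -tSM -exprM.
Qed.

End OneTorus.

Fact num_torus_subproof n : qt ^ n * qt ^ (- n) = 1 :> Qt.
Proof. by rewrite -qtzD subrr expr0z. Qed.

Definition num_torus (n : int) : torus Qt :=
  @Torus Qt id (qt ^ n) (qt ^ (- n)) erefl (fun _ _ => erefl) (fun _ _ => erefl)
    (fun _ _ => mulrC _ _) (num_torus_subproof n)
    (etrans (mulrC _ _) (num_torus_subproof n)).

(** Up to a scalar and K^(-l), [K; c; l] is a polynomial of degree l in K^2. Its inner coefficients
    vanish at q and its end coefficients are 1 and -1 there, so division by t^(2l) - 1 leaves [tH]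
    plus terms with regular coefficients. As [b] and [e] do not depend on the ring, the relation can
    be read in U_t and in Q(t) at once. *)
Lemma tbin_tH c : exists b : Qt, exists e : nat -> Qt,
  [/\ aunit q b, forall j, exists a, vat q (e j) a &
    forall (B : pzRingType) (d : torus B), tS d b * tbin d c l =
      tKi d ^+ l * (tH d + \sum_(j < l) tS d (e j) * tK d ^+ (2 * j))].
Proof.
have l0 := ltnW hl.
pose g (j : nat) := qt ^ (j%:Z * (l%:Z - 1)) * qbinom l j * (- qt ^ ((c - l%:Z + 1) * 2)) ^+ j.
have g0 : g 0 = 1 by rewrite /g mul0r expr0z qbinom0 expr0 !mulr1.
have gmid j : (0 < j < l)%N -> vat q (g j) 0.
  move=> /andP[j0 jl]; rewrite -(mul0r ((- q ^ ((c - l%:Z + 1) * 2)) ^+ j)).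
  rewrite -(mulr0 (q ^ (j%:Z * (l%:Z - 1)))).
  apply: vatM; last by apply/vatX/vatN/vat_qtz.
  apply: vatM (vat_qtz q0 _) _; apply: (qbinom_van q0 hl hq).
  by rewrite modnn modn_small.
pose P := \prod_(s < l) (- qden^-1 * qt ^ (s%:Z - c)).
have uP : aunit q P.
  apply: big_ind => [|x y|s _]; [exact: aunit1|exact: aunitM|].
  apply: aunitM (aunit_qtz q0 _).
  have [a ha a0] := aunitV (aunit_qden q0 hl hq).
  by exists (- a); [exact: vatN|rewrite oppr_eq0].
have [k hk] : exists k, vat q (g l) k.
  rewrite /g qbinomnn mulr1; eexists; apply: vatM; first exact: vat_qtz.
  exact/vatX/vatN/vat_qtz.
(* At K = t^(-c) the factor s = 0 of the product is zero, and the value of the expansion at q is 1 +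
   k. *)
have k1 : k = -1.
  have e : \sum_(j < l.+1) g j * tK (num_torus (- c)) ^+ (2 * j) = 0.
    have := tprod_gauss (num_torus (- c)) c l; rewrite /= -/g => <-.
    rewrite (bigD1 (Ordinal l0)) //= subr0.
    have -> : 1 + - qt ^ (c * 2) * (qt ^ (- c)) ^+ 2 = 0 :> Qt.
      have -> : (qt ^ (- c)) ^+ 2 = qt ^ (- (c * 2)) :> Qt by rewrite expr2 -qtzD; congr (qt ^ _); ring.
      by rewrite mulNr -qtzD subrr expr0z subrr.
    by rewrite mul0r.
  pose v (j : nat) : C := if j == 0 then 1 else if j == l then k else 0.
  have hv : vat q (\sum_(j < l.+1) g j * tK (num_torus (- c)) ^+ (2 * j))
                 (\sum_(j < l.+1) v j * (q ^ (- c)) ^+ (2 * j)).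
    apply: vat_sum => j _; apply: vatM; last exact/vatX/vat_qtz.
    rewrite /v; have [->|j0] := eqVneq (j : nat) 0%N; first by rewrite g0; exact: vat1.
    have [->//|jl] := eqVneq (j : nat) l; apply: gmid.
    by rewrite lt0n j0 ltn_neqAle jl -ltnS ltn_ord.
  have qc : (q ^ (- c)) ^+ (2 * l) = 1.
    rewrite exprnP exprzAC -exprnP; have := q2l hq; rewrite exprnP => ->; exact: exp1rz.
  rewrite e in hv; have := vat_uniq (vat0 q) hv.
  rewrite big_ord_recr /= (bigD1 (Ordinal l0)) //= big1 => [|j j0]; last first.
    rewrite /v ifN; last by apply: contraNneq j0 => jj; exact/eqP/val_inj.
    by rewrite ltn_eqF ?mul0r.
  rewrite addr0 muln0 expr0 mulr1 /v /= gtn_eqF // eqxx qc mulr1.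
  by move/esym/eqP; rewrite addrC addr_eq0 => /eqP.
have k0 : k != 0 by rewrite k1 oppr_eq0 oner_eq0.
have ug : aunit q (g l) by exists k.
have gl0 := aunit_neq0 ug; have P0 := aunit_neq0 uP; have u0 := unif_neq0 hl.
pose e (j : nat) := if j == 0 then (1 + g l) / unif l / g l else
  if (j < l)%N then g j / unif l / g l else 0.
exists (qfact l / unif l / (P * g l)), e; split.
- apply: aunitM; last by apply/aunitV/aunitM.
  by have := qfact_val q0 hl hq l; rewrite divnn l0 expr1.
- move=> j; rewrite /e; have [_|j0] := eqVneq j 0%N.
    have [|a ha] := @vat_div_unif _ q l q0 hl hq (1 + g l).
      by rewrite -(subrr 1) -k1; apply: vatD (vat1 q) hk.
    by exists (a / k); apply: vatM ha (vatV hk k0).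
  case: ltnP => jl; last by exists 0; exact: vat0.
  have [|a ha] := vat_div_unif q0 hl hq (gmid j _); first by rewrite lt0n j0.
  by exists (a / k); apply: vatM ha (vatV hk k0).
have HP B (d : torus B) : \prod_(s < l) tint d (c - s%:Z) = tS d P * (tKi d ^+ l *
    \sum_(j < l.+1) tS d (g j) * tK d ^+ (2 * j)).
  by rewrite tint_prod tprod_gauss.
move=> B d; rewrite /tbin HP; clear HP; clearbody g P.
set w := (unif l)^-1 / g l.
have -> (x : B) : tS d (qfact l / unif l / (P * g l)) * (tS d (qfact l)^-1 * (tS d P * x)) = tS d w * x.
  rewrite !mulrA -!tSM; congr (tS d _ * _).
  exact: scal_cancel (qf0 l) P0 gl0 u0.
rewrite -tSCA; congr (_ * _).
have wg (j : 'I_l) : j != Ordinal l0 -> tS d w * (tS d (g j) * tK d ^+ (2 * j)) = tS d (e j) * tK d ^+ (2 * j).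
  move=> j0; rewrite mulrA -tSM /e ifN ?ltn_ord; last by apply: contraNneq j0 => jj; exact/eqP/val_inj.
  by congr (tS d _ * _); rewrite /w [LHS]mulrC mulrA.
rewrite big_ord_recr /= (bigD1 (Ordinal l0)) //= [in RHS](bigD1 (Ordinal l0)) //= muln0 expr0 !mulr1.
rewrite g0 tS1 !mulrDr mulr1 mulr_sumr (eq_bigr _ wg) /tH mulrBr mulr1.
have -> : e 0 = w + (unif l)^-1 by exact: div_add1.
have -> : tS d w * (tS d (g l) * tK d ^+ (2 * l)) = tS d (unif l)^-1 * tK d ^+ (2 * l).
  by rewrite mulrA -tSM; congr (tS d _ * _); exact: divfK.
rewrite tSD; set X := \sum_(i < l | _) _; set a := tS d _; set b := tS d _; set y := _ * _.
by rewrite [LHS]addrC -[RHS]addrA; congr (_ + _); rewrite [a + b]addrC -[b + a + X]addrA addKr.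
Qed.

Lemma tbinD (B : pzRingType) (d : torus B) c m n :
  tbin d c (m + n) =
  tS d (qbinom (m + n) n)^-1 * (tbin d c m * tbin d (c - m%:Z) n).
Proof.
rewrite /tbin tSM2 mulrA -tSM; congr (tS d _ * _).
  rewrite qbinomE ?leq_addl // addnK.
  exact: fact_cancel (qf0 _) (qf0 _) (qf0 _).
rewrite big_split_ord /=; congr (_ * _); apply: eq_bigr => s _.
by rewrite PoszD opprD addrA.
Qed.

Definition torus_elt := forall B : pzRingType, torus B -> B.

(* Elements of the torus part of the localization of [U_res] at [t = q]; both *)
(* [U_t] and the rational functions [t^n] for integral weights [n] evaluate them. *)
Inductive tame : torus_elt -> Prop :=
| tame_S f a : vat q f a -> tame (fun B d => tS d f)
| tame_K : tame (fun B d => tK d)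
| tame_Ki : tame (fun B d => tKi d)
| tame_H : tame (fun B d => tH d)
| tame_add x y : tame x -> tame y -> tame (fun B d => x B d + y B d)
| tame_mul x y : tame x -> tame y -> tame (fun B d => x B d * y B d)
| tame_ext x y : tame x -> (forall B d, x B d = y B d) -> tame y.

Lemma tame_prod n (x : nat -> torus_elt) : (forall i, tame (x i)) ->
  tame (fun B d => \prod_(i < n) x i B d).
Proof.
move=> h; elim: n => [|n ih].
  by apply: tame_ext (tame_S (vat1 q)) _ => B d; rewrite big_ord0 tS1.
by apply: tame_ext (tame_mul ih (h n)) _ => B d; rewrite big_ord_recr.
Qed.

Lemma tame_sum n (x : nat -> torus_elt) : (forall i, tame (x i)) ->
  tame (fun B d => \sum_(i < n) x i B d).
Proof.
move=> h; elim: n => [|n ih].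
  by apply: tame_ext (tame_S (vat0 q)) _ => B d; rewrite big_ord0 tS0.
by apply: tame_ext (tame_add ih (h n)) _ => B d; rewrite big_ord_recr.
Qed.

Lemma tame_exp n x : tame x -> tame (fun B d => x B d ^+ n).
Proof.
move=> h; apply: tame_ext (tame_prod n (fun=> h)) _ => B d.
by rewrite prodr_const card_ord.
Qed.

Lemma tame_unit f : aunit q f -> tame (fun B d => tS d f^-1).
Proof. by move=> /aunitV [a ha _]; exact: tame_S ha. Qed.

Lemma tame_tint c : tame (fun B d => tint d c).
Proof.
apply: tame_mul (tame_unit (aunit_qden q0 hl hq)) _.
apply: tame_ext (tame_add (tame_mul (tame_S (vat_qtz q0 c)) tame_K)
  (tame_mul (tame_S (vatN (vat_qtz q0 (- c)))) tame_Ki)) _ => B d.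
by rewrite tSN mulNr.
Qed.

(** For j < l the factorial is a unit; for j = l this is [tbin_tH]; for j > l a factor [K; c'; l]
    splits off by [tbinD] at the cost of 1/[j; l], a unit because l has residue 0. *)
Lemma tame_tbin c j : tame (fun B d => tbin d c j).
Proof.
have l0 := ltnW hl.
elim/ltn_ind: j c => j ih c; have [jl|lj] := ltnP j l.
  apply: tame_mul (tame_prod _ (fun s => tame_tint (c - s%:Z))).
  by apply: tame_unit; have := qfact_val q0 hl hq j; rewrite divn_small // divr1.
have tl c' : tame (fun B d => tbin d c' l).
  have [b [e [ub he H]]] := tbin_tH c'.
  apply: tame_ext (tame_mul (tame_unit ub) (tame_mul (tame_exp l tame_Ki)
    (tame_add tame_H (tame_sum l (x := fun j B d => tS d (e j) * tK d ^+ (2 * j)) _)))) _.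
    move=> k; have [a ha] := he k.
    exact: tame_mul (tame_S ha) (tame_exp _ tame_K).
  by move=> B d /=; rewrite -H; apply: tSK; exact: aunit_neq0 ub.
have [->//|jl] := eqVneq j l.
apply: tame_ext (tame_mul (tame_unit (qbinom_unit q0 hl hq (n := j) (k := l) _ _))
  (tame_mul (ih (j - l)%N _ c) (tl (c - (j - l)%N%:Z)))) _ => //.
- by rewrite modnn.
- by rewrite ltn_subrL l0 (leq_trans l0).
by move=> B d; rewrite -{4}(subnK lj) tbinD subnK.
Qed.

Definition gbin (z : int) (j : nat) : Qt := (qfact j)^-1 * \prod_(s < j) qint (z - s%:Z).

Lemma tbin_num n c j : tbin (num_torus n) c j = gbin (n + c) j.
Proof.
rewrite /tbin /gbin /=; congr (_ * _); apply: eq_bigr => s _.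
by rewrite /tint /= qintE mulrC -!qtzD; congr ((qt ^ _ - qt ^ _) / _); ring.
Qed.

Lemma qint0 : qint 0 = 0.
Proof. by rewrite qintE oppr0 subrr mul0r. Qed.

Lemma qintN n : qint (- n) = - qint n.
Proof. by rewrite !qintE opprK -mulNr opprB. Qed.

Lemma gbin_nat (m j : nat) : gbin m%:Z j = qbinom m j.
Proof.
rewrite /gbin; have [jm|mj] := leqP j m; last first.
  by rewrite qbinom_small // (bigD1 (Ordinal mj)) //= subrr qint0 mul0r mulr0.
rewrite qbinomE //.
have -> : \prod_(s < j) qint (m%:Z - s%:Z) = qfact m / qfact (m - j).
  elim: j jm => [|j ih] jm; first by rewrite big_ord0 subn0 divff ?qf0.
  rewrite big_ord_recr /= (ih (ltnW jm)).
  have -> : (m - j = (m - j.+1).+1)%N by lia.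
  rewrite qfactS qnumE; have -> : m%:Z - j%:Z = (m - j.+1).+1%:Z by lia.
  have := qnum_neq0 (m - j.+1); rewrite qnumE => h.
  exact: div_mulK.
by rewrite mulrC -mulrA -invfM mulrC [qfact (m - j) * _]mulrC mulrC.
Qed.

Lemma gbin_opp (p j : nat) : gbin (- p.+1%:Z) j = (-1) ^+ j * qbinom (p + j) j.
Proof.
rewrite -gbin_nat /gbin mulrCA; congr (_ * _).
rewrite (reindex_inj rev_ord_inj) /= -[j in (-1) ^+ j]card_ord -prodr_const -big_split /=.
apply: eq_bigr => s _; rewrite mulN1r -qintN; congr qint.
by have := ltn_ord s; lia.
Qed.

End Torus.

Lemma inv_cancel (F : fieldType) (f n : F) : n != 0 -> (f * n)^-1 * n = f^-1.
Proof. by move=> n0; rewrite invfM -mulrA mulVf // mulr1. Qed.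

Lemma fact_cancel2 (F : fieldType) (f g h : F) : f != 0 ->
  g^-1 * h^-1 = f / (g * h) * f^-1.
Proof. by move=> f0; rewrite mulrAC divff // mul1r invfM. Qed.

(** * Commuting divided powers *)

Section Sl2.
Variables (A : fieldType) (t : A) (den : A) (qi : int -> A) (qf : nat -> A).
Hypotheses (t0 : t != 0) (qi1 : qi 1 = 1) (qiS : forall n, qi n.+1%:Z != 0).
Hypothesis qi_add : forall m n, qi (m + n) = t ^ (- m) * qi n + t ^ n * qi m.
Hypotheses (qf0 : qf 0 = 1) (qfS : forall n, qf n.+1 = qf n * qi n.+1%:Z).
Variables (B : pzRingType) (sc : A -> B -> B).
Hypothesis sc_l : forall c x y, sc c x * y = sc c (x * y).
Hypothesis sc_r : forall c x y, x * sc c y = sc c (x * y).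
Hypothesis scA : forall a b x, sc a (sc b x) = sc (a * b) x.
Hypothesis scDl : forall a b x, sc (a + b) x = sc a x + sc b x.
Hypothesis scDr : forall a x y, sc a (x + y) = sc a x + sc a y.
Hypothesis sc1 : forall x, sc 1 x = x.
Variables (K Ki E F : B) (ti : int -> B) (tb : int -> nat -> B) (ED FD : nat -> B).
Hypotheses (KKi : K * Ki = 1) (KiK : Ki * K = 1).
Hypothesis tiE : forall c, ti c = sc den^-1 (sc (t ^ c) K - sc (t ^ (- c)) Ki).
Hypothesis tbE : forall c j, tb c j = sc (qf j)^-1 (\prod_(s < j) ti (c - s%:Z)).
Hypotheses (KE : K * E = sc (t ^ 2) (E * K)) (KF : K * F = sc (t ^ (-2)) (F * K)).
Hypothesis EF : E * F = F * E + ti 0.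
Hypothesis EDE : forall n, ED n = sc (qf n)^-1 (E ^+ n).
Hypothesis FDE : forall n, FD n = sc (qf n)^-1 (F ^+ n).

Let sc_out := (sc_l, sc_r, scA).
Let tzD m n : t ^ (m + n) = t ^ m * t ^ n := expfzDr m n t0.

Let scN a x : sc a (- x) = - sc a x.
Proof.
apply: (addrI (sc a x)); rewrite -scDr !subrr.
by apply: (addrI (sc a 0)); rewrite -scDr !addr0.
Qed.

Let scBr a x y : sc a (x - y) = sc a x - sc a y.
Proof. by rewrite scDr scN. Qed.

Let sc_inj c x y : c != 0 -> sc c x = sc c y -> x = y.
Proof. by move=> c0 /(congr1 (sc c^-1)); rewrite !scA mulVf // !sc1. Qed.

Let sc_sum a n (f : 'I_n -> B) : sc a (\sum_(j < n) f j) = \sum_(j < n) sc a (f j).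
Proof.
elim/big_rec2: _ => [|j x y _ <-]; last by rewrite scDr.
by apply: (addrI (sc a 0)); rewrite -scDr !addr0.
Qed.

Lemma Ki_mul x c : K * x = sc (t ^ c) (x * K) -> Ki * x = sc (t ^ (- c)) (x * Ki).
Proof.
move=> h; have e : x * Ki = sc (t ^ c) (Ki * x).
  have := congr1 (fun y => Ki * y * Ki) h; rewrite /= !sc_out.
  by rewrite -!mulrA KKi mulr1 !mulrA KiK mul1r.
by rewrite e scA -tzD addNr expr0z sc1.
Qed.

Lemma ti_mul x m c : K * x = sc (t ^ m) (x * K) -> ti c * x = x * ti (c + m).
Proof.
move=> h; rewrite !tiE !sc_out; congr (sc _ _).
by rewrite mulrBl mulrBr !sc_out h (Ki_mul h) !sc_out -!tzD opprD.
Qed.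

Lemma KX_mul x m n : K * x = sc (t ^ m) (x * K) ->
  K * x ^+ n = sc (t ^ (m * n%:Z)) (x ^+ n * K).
Proof.
move=> h; elim: n => [|n ih]; first by rewrite mulr0 expr0z sc1 expr0 mulr1 mul1r.
rewrite exprSr mulrA ih !sc_out -mulrA h !sc_out -tzD mulrA; congr (sc (t ^ _) _).
by rewrite intS; ring.
Qed.

Lemma tb_dp x m n c j : K * x = sc (t ^ m) (x * K) ->
  tb c j * x ^+ n = x ^+ n * tb (c + m * n%:Z) j.
Proof.
move=> h; rewrite !tbE !sc_out; congr (sc _ _).
elim: j => [|j ih]; first by rewrite !big_ord0 mulr1 mul1r.
rewrite !big_ord_recr /= -mulrA (ti_mul _ (KX_mul n h)) mulrA ih -!mulrA.
by congr (_ * (_ * ti _)); ring.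
Qed.

Lemma dpS (x : B) (XD : nat -> B) n : (forall n, XD n = sc (qf n)^-1 (x ^+ n)) ->
  x * XD n = sc (qi n.+1%:Z) (XD n.+1).
Proof. by move=> h; rewrite !h !sc_out -exprS qfS [qi _ * _]mulrC inv_cancel. Qed.

(** The coefficients of K and of K^-1 agree separately, by the addition rule for q-integers. *)
Lemma ti_three (p j : nat) e :
  sc (qi (p + j)%N%:Z) (ti (e - p%:Z)) =
  sc (qi p%:Z) (ti (e - p%:Z - j%:Z)) + sc (qi j%:Z) (ti e).
Proof.
rewrite !tiE !scA ![_ * den^-1]mulrC -!scA -scDr; congr (sc _ _).
rewrite !scBr !scA addrACA -opprD -!scDl PoszD.
have ea a b z : qi (a + b) * t ^ z = qi b * t ^ (z - a) + qi a * t ^ (z + b).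
  by rewrite qi_add !tzD; ring.
congr (sc _ _ - sc _ _).
  by rewrite addrC ea; congr (_ * t ^ _ + _ * t ^ _); ring.
by rewrite ea addrC; congr (_ * t ^ _ + _ * t ^ _); ring.
Qed.

(** Without the case distinction, truncated subtraction would give F^(0) = 1 instead of 0 for j >
    n. *)
Definition Fz n j := if (j <= n)%N then FD (n - j) else 0.

Lemma E_Fexp n : E * F ^+ n.+1 = F ^+ n.+1 * E + sc (qi n.+1%:Z) (F ^+ n * ti (- n%:Z)).
Proof.
elim: n => [|n ih]; first by rewrite qi1 sc1 mul1r !expr1 oppr0.
rewrite exprSr mulrA ih mulrDl -mulrA EF mulrDr mulrA -exprSr -addrA; congr (_ + _).
rewrite sc_l -mulrA (ti_mul _ KF) mulrA -exprSr -!sc_r -mulrDr; congr (_ * _).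
have := ti_three n.+1 1 0; rewrite addn1 sub0r qi1 sc1 => ->; rewrite addrC.
by congr (sc _ (ti _) + _); rewrite intS; ring.
Qed.

Lemma E_Fz n j : E * Fz n j = Fz n j * E + Fz n j.+1 * ti (j.+1%:Z - n%:Z).
Proof.
rewrite /Fz; have [jn|jn|->] := ltngtP j n; last first.
- by rewrite subnn FDE qf0 invr1 sc1 expr0 mulr1 mul1r mul0r addr0.
- by rewrite !mul0r mulr0 addr0.
rewrite !FDE; have -> : (n - j = (n - j.+1).+1)%N by lia.
rewrite !sc_out E_Fexp scDr scA qfS inv_cancel //; congr (_ + sc _ (_ * ti _)).
by lia.
Qed.

Lemma ti_comm a b : ti a * ti b = ti b * ti a.
Proof.
have KK : K * K = sc (t ^ 0) (K * K) by rewrite expr0z sc1.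
have KKi' : K * Ki = sc (t ^ 0) (Ki * K) by rewrite expr0z sc1 KKi KiK.
rewrite (tiE b) !sc_out mulrBr mulrBl !sc_out (ti_mul _ KK) (ti_mul _ KKi').
by rewrite addr0.
Qed.

(** The three torus elements share a product of j factors [ti]; what remains beside it is
    [ti_three]. *)
Lemma tb_three (m j n : nat) : (j < m.+1)%N ->
  sc (qi m.+1%:Z) (tb (2 * j.+1%:Z - m.+1%:Z - n%:Z) j.+1) =
  sc (qi (m - j)%N%:Z) (tb (2 * j.+1%:Z - m%:Z - n%:Z - 2) j.+1) +
  ti (j.+1%:Z - n%:Z) * tb (2 * j%:Z - m%:Z - n%:Z) j.
Proof.
move=> jm; rewrite !tbE big_ord_recl /= big_ord_recr /= subr0.
set c : int := 2 * j%:Z - m%:Z - n%:Z.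
have -> : \prod_(i < j) ti (2 * j.+1%:Z - m.+1%:Z - n%:Z - (bump 0 i)%:Z) = \prod_(i < j) ti (c - i%:Z).
  by apply: eq_bigr => i _; congr (ti _); rewrite /bump /c; lia.
have -> : \prod_(i < j) ti (2 * j.+1%:Z - m%:Z - n%:Z - 2 - i%:Z) = \prod_(i < j) ti (c - i%:Z).
  by apply: eq_bigr => i _; congr (ti _); rewrite /c; lia.
set X := \prod_(i < j) _.
have Xc a : ti a * X = X * ti a.
  rewrite /X; elim: (j) => [|k ih]; first by rewrite !big_ord0 mulr1 mul1r.
  by rewrite !big_ord_recr /= mulrA ih -!mulrA ti_comm.
rewrite !sc_out !Xc.
have -> : (qf j)^-1 = (qf j.+1)^-1 * qi j.+1%:Z by rewrite qfS inv_cancel.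
rewrite ![qi _ * _^-1]mulrC -!scA -scDr; congr (sc _ _).
rewrite -!sc_r -mulrDr; congr (_ * _).
have := ti_three (m - j) j.+1 (j.+1%:Z - n%:Z).
have -> : (m - j + j.+1 = m.+1)%N by lia.
have -> : 2 * j.+1%:Z - m.+1%:Z - n%:Z = j.+1%:Z - n%:Z - (m - j)%N%:Z by lia.
by move=> ->; congr (sc _ (ti _) + _); lia.
Qed.

(** Induction on m: a further E on the left passes F^(n-j) at the cost of one torus term ([E_Fz]),
    and the two contributions to each index are merged by [tb_three]. *)
Lemma EF_comm m n : ED m * FD n =
  \sum_(j < m.+1) Fz n j * tb (2 * j%:Z - m%:Z - n%:Z) j * ED (m - j).
Proof.
have tb0 c : tb c 0 = 1 by rewrite tbE big_ord0 qf0 invr1 sc1.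
have ED0 : ED 0 = 1 by rewrite EDE expr0 qf0 invr1 sc1.
elim: m => [|m ih].
  by rewrite big_ord_recl big_ord0 /= ED0 mul1r /Fz /= subn0 tb0 !mulr1 addr0.
apply: (sc_inj (qiS m)).
rewrite -sc_l -(dpS _ EDE) -mulrA ih mulr_sumr sc_sum.
rewrite (eq_bigr (fun j : 'I_m.+1 =>
    sc (qi (m.+1 - j)%N%:Z) (Fz n j * tb (2 * j%:Z - m%:Z - n%:Z - 2) j * ED (m.+1 - j)) +
    Fz n j.+1 * (ti (j.+1%:Z - n%:Z) * tb (2 * j%:Z - m%:Z - n%:Z) j) * ED (m - j))); last first.
  move=> j _; have jm : (j <= m)%N by rewrite -ltnS.
  rewrite !mulrA E_Fz [(_ + _) * tb _ _]mulrDl [(_ + _) * ED _]mulrDl; congr (_ + _).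
  rewrite -sc_r subSn // -(dpS _ EDE) -[_ * E * _]mulrA -!mulrA; congr (_ * _).
  rewrite [RHS]mulrA [LHS]mulrA; congr (_ * _).
  have := tb_dp 1 (2 * j%:Z - m%:Z - n%:Z - 2) j KE; rewrite expr1 => ->.
  by congr (_ * tb _ _); ring.
rewrite big_split /= big_ord_recl /= [in RHS]big_ord_recl /= -addrA !tb0 !subn0; congr (_ + _).
have -> : \sum_(i < m) sc (qi (m.+1 - bump 0 i)%N%:Z)
     (Fz n (bump 0 i) * tb (2 * (bump 0 i)%:Z - m%:Z - n%:Z - 2) (bump 0 i) * ED (m.+1 - bump 0 i)) =
  \sum_(i < m.+1) sc (qi (m - i)%N%:Z)
     (Fz n i.+1 * tb (2 * i.+1%:Z - m%:Z - n%:Z - 2) i.+1 * ED (m - i)).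
  rewrite [RHS]big_ord_recr /= subnn.
  have -> : qi 0 = 0.
    have := qi_add 0 0; rewrite addr0 oppr0 expr0z !mul1r => /esym/eqP.
    by rewrite -subr_eq0 addrK => /eqP.
  have -> x : sc 0 x = 0 by apply: (addrI (sc 0 x)); rewrite -scDl !addr0.
  by rewrite addr0; apply: eq_bigr => i _; rewrite /bump add1n subSS.
rewrite -big_split /=; apply: eq_bigr => i _; rewrite /bump add1n subSS.
have <- : Fz n i.+1 * sc (qi m.+1%:Z) (tb (2 * i.+1%:Z - m.+1%:Z - n%:Z) i.+1) * ED (m - i) =
    sc (qi m.+1%:Z) (Fz n i.+1 * tb (2 * i.+1%:Z - m.+1%:Z - n%:Z) i.+1 * ED (m - i)).
  by rewrite !sc_out.
by rewrite tb_three // [Fz _ _ * (_ + _)]mulrDr [RHS]mulrDl !sc_out.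
Qed.
End Sl2.

(** * Specialization at q *)

Section PresentedAlgebraLift.
Variables (K : fieldType) (X : Type) (rels : pa_term K X -> pa_term K X -> Prop).
Local Notation P := (palg rels).
Local Notation cl := (pa_class rels).

Lemma pa_class_mul a b : cl a * cl b = cl (PaMul a b). Proof. exact: pa_mulE. Qed.
Lemma pa_class_scale c a : c *: cl a = cl (PaMul (PaScal c) a). Proof. exact: pa_scaleE. Qed.
Lemma pa_class1 : cl (PaScal 1) = 1. Proof. by []. Qed.

Lemma pa_class_scal c : cl (PaScal c) = c *: (1 : P).
Proof.
rewrite -pa_class1 pa_class_scale; apply/pa_classP.
by rewrite -{1}(mulr1 c); exact: pac_scalM.
Qed.

Lemma pa_ind (Q : P -> Prop) :
  (forall x, Q (pa_gen rels x)) -> (forall c : K, Q (c *: (1 : P))) ->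
  (forall x y, Q x -> Q y -> Q (x + y)) ->
  (forall x y, Q x -> Q y -> Q (x * y)) -> forall x, Q x.
Proof.
move=> hg hs hD hM x; have [a ->] := pa_surj x.
elim: a => [y|c|a ha b hb|a ha b hb]; first exact: hg.
- by rewrite pa_class_scal.
- by rewrite -pa_addrE; exact: hD.
- by rewrite -pa_class_mul; exact: hM.
Qed.

Variables (B : pzRingType) (s : K -> B) (g : X -> B).
Hypotheses (s1 : s 1 = 1) (sD : {morph s : x y / x + y}) (sM : {morph s : x y / x * y}).
Hypothesis sC : forall c x, s c * x = x * s c.

Fixpoint pa_eval (a : pa_term K X) : B :=
  match a with
  | PaVar x => g x
  | PaScal c => s c
  | PaAdd a b => pa_eval a + pa_eval b
  | PaMul a b => pa_eval a * pa_eval b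
  end.

Hypothesis hrels : forall a b, rels a b -> pa_eval a = pa_eval b.

Lemma pa_eval_cong a b : pa_cong rels a b -> pa_eval a = pa_eval b.
Proof.
have s0 : s 0 = 0 by apply: (addrI (s 0)); rewrite -sD !addr0.
elim=> {a b} //=.
- by move=> a b c _ -> _ ->.
- by move=> a a' b b' _ -> _ ->.
- by move=> a a' b b' _ -> _ ->.
- by move=> a b c; rewrite addrA.
- by move=> a b; rewrite addrC.
- by move=> a; rewrite s0 add0r.
- by move=> a b c; rewrite mulrA.
- by move=> a; rewrite s1 mul1r.
- by move=> a b c; rewrite mulrDl.
- by move=> a b c; rewrite mulrDr.
- by move=> a; rewrite s0 mul0r.
Qed.

(** The universal property of the presented algebra: evaluation at a representative, whose choice
    does not matter by [pa_eval_cong]. *)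
Definition pa_lift (x : P) : B := pa_eval (generic_quotient.repr x).

Lemma pa_lift_class a : pa_lift (cl a) = pa_eval a.
Proof. exact/pa_eval_cong/pa_repr. Qed.

Lemma pa_lift_gen x : pa_lift (pa_gen rels x) = g x.
Proof. exact: pa_lift_class. Qed.

Lemma pa_lift1 : pa_lift 1 = 1.
Proof. by rewrite -pa_class1 pa_lift_class /= s1. Qed.

Lemma pa_liftD : {morph pa_lift : x y / x + y}.
Proof.
move=> x y; have [a ->] := pa_surj x; have [b ->] := pa_surj y.
by rewrite pa_addrE !pa_lift_class.
Qed.

Lemma pa_liftM : {morph pa_lift : x y / x * y}.
Proof.
move=> x y; have [a ->] := pa_surj x; have [b ->] := pa_surj y.
by rewrite pa_class_mul !pa_lift_class.
Qed.

Lemma pa_liftZ c x : pa_lift (c *: x) = s c * pa_lift x.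
Proof. by have [a ->] := pa_surj x; rewrite pa_class_scale !pa_lift_class. Qed.

End PresentedAlgebraLift.

Lemma Ut_scalerAl (c : Qt) (x y : Ut) : (c *: x) * y = c *: (x * y).
Proof. exact/esym/pa_scalerAl. Qed.
Lemma Ut_scalerAr (c : Qt) (x y : Ut) : x * (c *: y) = c *: (x * y).
Proof. exact/esym/pa_scalerAr. Qed.

Lemma Ut_rel_KKi : Ut_K * Ut_Ki = 1.
Proof. rewrite [LHS]pa_class_mul; apply/pa_classP; exact/pac_rel/Ut_KKi. Qed.
Lemma Ut_rel_KiK : Ut_Ki * Ut_K = 1.
Proof. rewrite [LHS]pa_class_mul; apply/pa_classP; exact/pac_rel/Ut_KiK. Qed.
Lemma Ut_rel_KE : Ut_K * Ut_E = qt ^ 2 *: (Ut_E * Ut_K).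
Proof.
have : Ut_K * Ut_E * Ut_Ki = qt ^+ 2 *: Ut_E.
  rewrite [X in X * _]pa_class_mul [LHS]pa_class_mul [RHS]pa_class_scale.
  by apply/pa_classP; exact/pac_rel/Ut_KE.
move/(congr1 (fun x => x * Ut_K)); rewrite -mulrA Ut_rel_KiK mulr1 => ->.
by rewrite Ut_scalerAl.
Qed.
Lemma Ut_rel_KF : Ut_K * Ut_F = qt ^ (-2) *: (Ut_F * Ut_K).
Proof.
have : Ut_K * Ut_F * Ut_Ki = qt ^- 2 *: Ut_F.
  rewrite [X in X * _]pa_class_mul [LHS]pa_class_mul [RHS]pa_class_scale.
  by apply/pa_classP; exact/pac_rel/Ut_KF.
move/(congr1 (fun x => x * Ut_K)); rewrite -mulrA Ut_rel_KiK mulr1 => ->.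
by rewrite Ut_scalerAl.
Qed.
Lemma Ut_rel_EF : Ut_K - Ut_Ki = (qt - qt^-1) *: (Ut_E * Ut_F - Ut_F * Ut_E).
Proof.
rewrite -[- Ut_Ki]scaleN1r -[- (Ut_F * Ut_E)]scaleN1r.
rewrite [(-1) *: Ut_Ki]pa_class_scale [LHS]pa_addrE.
rewrite [Ut_E * _]pa_class_mul [Ut_F * _]pa_class_mul [(-1) *: _]pa_class_scale.
rewrite [X in _ *: X]pa_addrE [RHS]pa_class_scale.
by apply/pa_classP; exact/pac_rel/Ut_EF.
Qed.

Fact Ut_torusM : {morph (fun c : Qt => c *: (1 : Ut)) : x y / x * y}.
Proof. by move=> x y; rewrite Ut_scalerAl mul1r scalerA. Qed.
Fact Ut_torusC (c : Qt) (x : Ut) : c *: (1 : Ut) * x = x * (c *: (1 : Ut)).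
Proof. by rewrite Ut_scalerAl Ut_scalerAr mul1r mulr1. Qed.

Definition Ut_torus : torus Ut :=
  @Torus Ut (fun c => c *: (1 : Ut)) Ut_K Ut_Ki (scale1r _) (fun x y => scalerDl _ x y)
    Ut_torusM Ut_torusC Ut_rel_KKi Ut_rel_KiK.

Lemma Ut_torusE c x : tS Ut_torus c * x = c *: x.
Proof. by rewrite /= Ut_scalerAl mul1r. Qed.

Section Specialize.
Variables (R : realType) (q : R[i]) (l : nat).
Hypotheses (q0 : q != 0) (hl : (2 <= l)%N) (hq : l.-primitive_root (q ^+ 2)).
Local Notation U := (LU q).
Local Notation lu := (LU_of q).

Lemma Ut_EF_comm m n : Ut_Ediv m * Ut_Fdiv n =
  \sum_(j < m.+1) (if (j <= n)%N then Ut_Fdiv (n - j) else 0) *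
    tbin Ut_torus (2 * j%:Z - m%:Z - n%:Z) j * Ut_Ediv (m - j).
Proof.
apply: (@EF_comm Qt qt qden qint qfact qt_neq0 _ _ (qint_add q0 hl hq) qfact0 _ Ut *:%R
  Ut_scalerAl Ut_scalerAr _ _ _ _ Ut_K Ut_Ki Ut_E Ut_F (tint Ut_torus) (tbin Ut_torus)
  Ut_Ediv Ut_Fdiv Ut_rel_KKi Ut_rel_KiK _ _ Ut_rel_KE Ut_rel_KF _ _ _) => //.
- rewrite qintE; exact: divff (qden_neq0 q0 hl hq).
- by move=> k; rewrite -qnumE; exact: (qnum_neq0 q0 hl hq).
- by move=> k; rewrite qfactS qnumE.
- exact: scalerA.
- by move=> a b x; exact: scalerDl.
- by move=> a x y; exact: scalerDr.
- exact: scale1r.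
- by move=> c; rewrite /tint !Ut_torusE.
- by move=> c j; rewrite /tbin Ut_torusE.
- rewrite /tint Ut_torusE oppr0 expr0z !Ut_torusE !scale1r Ut_rel_EF scalerA.
  by rewrite mulVf ?scale1r ?subrKC // (qden_neq0 q0 hl hq).
Qed.

Lemma Ut_dpM (x : Ut) (XD : nat -> Ut) m n : (forall n, XD n = (qfact n)^-1 *: x ^+ n) ->
  XD m * XD n = qbinom (m + n) m *: XD (m + n)%N.
Proof.
move=> h; rewrite !h Ut_scalerAl Ut_scalerAr !scalerA -exprD; congr (_ *: _).
rewrite qbinomE ?leq_addr // addKn; exact: fact_cancel2 (qfact_neq0 q0 hl hq _).
Qed.

Lemma LU_of_gen x (h : Ures x) : lu x = pa_gen (LU_rel q) (exist _ x h).
Proof.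
rewrite /LU_of; case: pselect => // h'; congr (pa_gen _ (exist _ x _)).
exact: Prop_irrelevance.
Qed.

Lemma LU_of1 : lu 1 = 1.
Proof.
rewrite (LU_of_gen Ures_one); apply/pa_classP; exact/pac_rel/LU_one.
Qed.

Lemma LU_ofD x y : Ures x -> Ures y -> lu (x + y) = lu x + lu y.
Proof.
move=> hx hy; rewrite (LU_of_gen hx) (LU_of_gen hy) (LU_of_gen (Ures_add hx hy)).
rewrite [RHS]pa_addrE; apply/pa_classP; exact/pac_rel/LU_add.
Qed.

Lemma LU_ofM x y : Ures x -> Ures y -> lu (x * y) = lu x * lu y.
Proof.
move=> hx hy; rewrite (LU_of_gen hx) (LU_of_gen hy) (LU_of_gen (Ures_mul hx hy)).
rewrite [RHS]pa_class_mul; apply/pa_classP; exact/pac_rel/LU_mul.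
Qed.

Lemma laurentZ_poly (p : {poly int}) : laurentZ (tofrac (map_poly intr p : {poly rat})).
Proof. by exists p, 0%N; rewrite expr0 invr1 mulr1. Qed.

Lemma laurentZ_qt : laurentZ qt.
Proof. by have := laurentZ_poly 'X; rewrite map_polyX. Qed.

Lemma laurentZ_qtV : laurentZ qt^-1.
Proof. by exists 1, 1%N; rewrite rmorph1 tofrac1 mul1r expr1. Qed.

Lemma laurentZ_N1 : laurentZ (-1).
Proof. by have := laurentZ_poly (-1); rewrite rmorphN rmorph1 tofracN tofrac1. Qed.

Lemma LU_of_qt x : Ures x -> lu (qt *: x) = q *: lu x.
Proof.
move=> hx; rewrite (LU_of_gen hx) (LU_of_gen (Ures_scale laurentZ_qt hx)).
rewrite [RHS]pa_class_scale; apply/pa_classP; exact/pac_rel/LU_spec.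
Qed.

(* Scalars acting compatibly on [U_res] and, through their value at [q], on [LU_q]. *)
Definition good_scalar (c : Qt) (a : R[i]) :=
  vat q c a /\ forall x, Ures x -> Ures (c *: x) /\ lu (c *: x) = a *: lu x.

Lemma good_qt : good_scalar qt q.
Proof.
split=> [|x hx]; first exact: vat_qt.
by split; [exact: Ures_scale laurentZ_qt hx|exact: LU_of_qt].
Qed.

Lemma good_scalar1 : good_scalar 1 1.
Proof. by split=> [|x hx]; [exact: vat1|rewrite !scale1r]. Qed.

Lemma good_scalarD c d a b : good_scalar c a -> good_scalar d b -> good_scalar (c + d) (a + b).
Proof.
move=> [hc1 hc2] [hd1 hd2]; split=> [|x hx]; first exact: vatD.
have [uc ec] := hc2 x hx; have [ud ed] := hd2 x hx.
by rewrite !scalerDl LU_ofD // ec ed; split=> //; exact: Ures_add.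
Qed.

Lemma good_scalarM c d a b : good_scalar c a -> good_scalar d b -> good_scalar (c * d) (a * b).
Proof.
move=> [hc1 hc2] [hd1 hd2]; split=> [|x hx]; first exact: vatM.
have [ud ed] := hd2 x hx; have [uc ec] := hc2 _ ud.
by rewrite -!scalerA ec ed.
Qed.

Lemma good_scalar0 : good_scalar 0 0.
Proof.
split=> [|x hx]; first exact: vat0.
have u0 : Ures (0 *: x).
  rewrite scale0r -(subrr 1) -scaleN1r; apply: Ures_add Ures_one _.
  exact: Ures_scale laurentZ_N1 Ures_one.
split=> //; rewrite !scale0r; apply: (addrI (lu 0)).
by rewrite -LU_ofD ?addr0 // -(scale0r x).
Qed.

Lemma good_scalarN1 : good_scalar (-1) (-1).
Proof.
split=> [|x hx]; first exact/vatN/vat1.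
have u := Ures_scale laurentZ_N1 hx; split=> //.
apply: (addrI (lu x)); rewrite -LU_ofD // !scaleN1r !subrr.
by have [_] := good_scalar0; move=> /(_ x hx) [_]; rewrite !scale0r.
Qed.

Lemma good_qtV : good_scalar qt^-1 q^-1.
Proof.
split=> [|x hx]; first by apply: vatV => //; exact: vat_qt.
have u := Ures_scale laurentZ_qtV hx; split=> //.
apply: (@scalerI _ _ q q0); rewrite -LU_of_qt // !scalerA !divff ?scale1r //.
exact: qt_neq0.
Qed.

Lemma good_int (m : int) : good_scalar m%:~R m%:~R.
Proof.
have gn (n : nat) : good_scalar n%:R n%:R.
  elim: n => [|n ih]; first exact: good_scalar0.
  by rewrite -addn1 !natrD; exact: good_scalarD ih good_scalar1.
case: m => n; first exact: gn.
by rewrite NegzE !mulrNz -![- _%:~R]mulN1r; exact: good_scalarM good_scalarN1 (gn _).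
Qed.

Lemma good_poly (p : {poly int}) :
  good_scalar (tofrac (map_poly intr p : {poly rat})) (pev q (map_poly intr p)).
Proof.
elim/poly_ind: p => [|p c ih].
  have -> : map_poly intr 0 = 0 :> {poly rat} by rewrite rmorph0.
  by rewrite tofrac0 /pev rmorph0 horner0; exact: good_scalar0.
have -> : map_poly intr (p * 'X + c%:P) = map_poly intr p * 'X + (c%:~R)%:P :> {poly rat}.
  by rewrite rmorphD rmorphM /= map_polyX map_polyC.
rewrite tofracD tofracM pevD pevM pevX.
apply: good_scalarD; first exact: good_scalarM ih good_qt.
have -> : pev q (c%:~R)%:P = c%:~R by rewrite /pev map_polyC hornerC /= rmorph_int.
have -> : tofrac (c%:~R)%:P = c%:~R :> Qt by rewrite !rmorph_int.
exact: good_int.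
Qed.

(* [spr x y]: [x] lies in the localization of [U_res] at [t = q] and *)
(* specializes to [y]. *)
Definition spr (x : Ut) (y : U) := exists c : Qt, exists a : R[i],
  [/\ good_scalar c a, a != 0, Ures (c *: x) & y = a^-1 *: lu (c *: x)].

Lemma spr_of x : Ures x -> spr x (lu x).
Proof.
by move=> hx; exists 1, 1; rewrite invr1 !scale1r; split=> //; [exact: good_scalar1|rewrite oner_eq0].
Qed.

(** After multiplication by both denominators the two candidates specialize the same element of
    [Ures]. This carries identities from U_t over to [LU]. *)
Lemma spr_uniq x y z : spr x y -> spr x z -> y = z.
Proof.
move=> [c [a [[vc hc] a0 uc ->]]] [d [b [[vd hd] b0 ud ->]]].
have [_ e1] := hc _ ud; have [_ e2] := hd _ uc.
apply: (@scalerI _ _ (a * b)); first by rewrite mulf_neq0.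
rewrite !scalerA {1}(mulrC a b) !mulfK // -e1 -e2 !scalerA.
by congr (lu (_ *: _)); exact: mulrC.
Qed.

Lemma sprD x y x' y' : spr x x' -> spr y y' -> spr (x + y) (x' + y').
Proof.
move=> [c [a [gc a0 uc ->]]] [d [b [gd b0 ud ->]]].
exists (c * d), (a * b); split; [exact: good_scalarM|by rewrite mulf_neq0| |].
  have -> : (c * d) *: (x + y) = d *: (c *: x) + c *: (d *: y).
    by rewrite scalerDr !scalerA; congr (_ *: _ + _); exact: mulrC.
  by apply: Ures_add; [exact: (gd.2 _ uc).1|exact: (gc.2 _ ud).1].
have -> : (c * d) *: (x + y) = d *: (c *: x) + c *: (d *: y).
  by rewrite scalerDr !scalerA; congr (_ *: _ + _); exact: mulrC.
rewrite LU_ofD; last first.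
- exact: (gc.2 _ ud).1.
- exact: (gd.2 _ uc).1.
rewrite (gd.2 _ uc).2 (gc.2 _ ud).2 scalerDr !scalerA invfM -mulrA mulVf // mulr1.
by rewrite mulrAC mulVf // mul1r.
Qed.

Lemma sprM x y x' y' : spr x x' -> spr y y' -> spr (x * y) (x' * y').
Proof.
move=> [c [a [gc a0 uc ->]]] [d [b [gd b0 ud ->]]].
have e : (c * d) *: (x * y) = (c *: x) * (d *: y).
  by rewrite Ut_scalerAl Ut_scalerAr scalerA.
exists (c * d), (a * b); split; [exact: good_scalarM|by rewrite mulf_neq0| |].
  by rewrite e; exact: Ures_mul.
by rewrite e LU_ofM // -pa_scalerAl -pa_scalerAr scalerA invfM.
Qed.

(** Clearing rational coefficients makes f a quotient of integer polynomials, which act on [Ures]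
    compatibly with their values at q. *)
Lemma spr_poly_ratio f a : vat q f a -> exists n d : {poly int}, exists2 b,
  b != 0 & [/\ good_scalar (tofrac (map_poly intr d : {poly rat})) b,
    good_scalar (tofrac (map_poly intr n : {poly rat})) (a * b) &
    tofrac (map_poly intr d : {poly rat}) * f = tofrac (map_poly intr n : {poly rat})].
Proof.
move=> [n [d [ef d0 ea]]].
have [n' [m m0 en]] := rat_poly_scale n; have [d' [k k0 ed]] := rat_poly_scale d.
have m0' : (m%:~R : rat) != 0 by rewrite intr_eq0.
have k0' : (k%:~R : rat) != 0 by rewrite intr_eq0.
have e1 : map_poly intr (m *: d') = (m%:~R * k%:~R)%:P * d :> {poly rat}.
  by rewrite map_polyZ ed mul_polyC scalerA mulfK.
have e2 : map_poly intr (k *: n') = (m%:~R * k%:~R)%:P * n :> {poly rat}.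
  by rewrite map_polyZ en mul_polyC scalerA [m%:~R * _]mulrC mulfK.
exists (k *: n'), (m *: d'), (pev q (map_poly intr (m *: d'))).
  rewrite e1 pevM; apply: mulf_neq0 => //; rewrite /pev map_polyC hornerC /=.
  by rewrite fmorph_eq0 mulf_neq0.
split; first exact: good_poly.
  have -> : a * pev q (map_poly intr (m *: d')) = pev q (map_poly intr (k *: n')).
    by rewrite e1 e2 !pevM ea mulrCA divfK.
  exact: good_poly.
rewrite e1 e2 !tofracM ef -mulrA; congr (_ * _); rewrite mulrC.
have d0' : (tofrac d : Qt) != 0.
  by apply: contraNneq d0 => /eqP; rewrite tofrac_eq0 => /eqP ->; rewrite /pev rmorph0 horner0.
exact: (@divfK Qt _ d0').
Qed.

Lemma sprZ f a x y : vat q f a -> spr x y -> spr (f *: x) (a *: y).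
Proof.
move=> /spr_poly_ratio [n [d [b b0 [gd gn e]]]] [c [a' [gc a0 uc ->]]].
exists (tofrac (map_poly intr d : {poly rat}) * c), (b * a'); split.
- exact: good_scalarM.
- by rewrite mulf_neq0.
- by rewrite scalerA mulrAC e -scalerA; exact: (gn.2 _ uc).1.
- rewrite scalerA mulrAC e -scalerA (gn.2 _ uc).2 !scalerA; congr (_ *: _).
  by rewrite invfM mulrAC [b^-1 * _]mulrC mulfK // mulrC.
Qed.

Lemma spr_sum n (f : 'I_n -> Ut) (g : 'I_n -> U) : (forall i, spr (f i) (g i)) ->
  spr (\sum_(i < n) f i) (\sum_(i < n) g i).
Proof.
move=> h; elim/big_rec2: _ => [|i x y _ hx]; last exact: sprD.
by have := sprZ (vat0 q) (spr_of Ures_one); rewrite !scale0r.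
Qed.

Lemma spr_exp x y n : spr x y -> spr (x ^+ n) (y ^+ n).
Proof.
move=> h; elim: n => [|n ih]; last by rewrite !exprS; exact: sprM.
by rewrite !expr0 -LU_of1; exact: spr_of Ures_one.
Qed.

(** Induction along the derivation of membership in [Ures]; a Laurent coefficient becomes its value
    at q. *)
Lemma LU_ind (Q : U -> Prop) :
  (forall c : R[i], Q (c *: (1 : U))) -> Q (LK q) -> Q (LKi q) ->
  (forall n, Q (LE q n)) -> (forall n, Q (LF q n)) ->
  (forall x y, Q x -> Q y -> Q (x + y)) ->
  (forall x y, Q x -> Q y -> Q (x * y)) -> forall x, Q x.
Proof.
move=> h1 hK hKi hE hF hD hM; apply: pa_ind => // -[x hx]; rewrite -LU_of_gen.
elim: hx => {x} //; first by rewrite LU_of1 -[1](scale1r (1 : U)); exact: h1.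
- by move=> x y hx ih hy ih'; rewrite LU_ofD //; exact: hD.
- by move=> x y hx ih hy ih'; rewrite LU_ofM //; exact: hM.
move=> c x [p [n ->]] hx ih.
have g : exists a, good_scalar (tofrac (map_poly intr p : {poly rat}) * qt ^- n) a.
  rewrite -exprVn; elim: n => [|n [a ga]]; first by eexists; rewrite expr0 mulr1; exact: good_poly.
  by exists (a * q^-1); rewrite exprSr mulrA; apply: good_scalarM ga good_qtV.
have [a [_ /(_ x hx) [_ ->]]] := g.
have -> : a *: lu x = (a *: (1 : U)) * lu x by rewrite -pa_scalerAl mul1r.
exact: hM.
Qed.

End Specialize.

(** * Field identities, concave sequences and counting *)

Lemma div_div_cancel (F : fieldType) (u p : F) : p != 0 -> (u / p)^-1 / p = u^-1.
Proof. by move=> p0; rewrite invf_div mulrAC divff // mul1r. Qed.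

Lemma scale_shift (F : fieldType) (M : lmodType F) (a u : F) (Y X : M) :
  u *: (a *: Y - X) = a *: (u *: (Y - X)) + ((a - 1) * u) *: X.
Proof.
rewrite mulrBl mul1r scalerBl !scalerBr !scalerA [u * a]mulrC addrA; congr (_ - _).
by rewrite subrK.
Qed.

Lemma cop_EF1 (F : fieldType) (M : lmodType F) (t : F) (K Ki X Y : M) :
  K - Ki = (t - t^-1) *: (X - Y) ->
  t *: K + (-1 / t) *: Ki = (t - t^-1) *: (t *: X + Ki + (-1 * t) *: Y).
Proof.
move=> e; rewrite addrAC !mulN1r !scaleNr -scalerBr scalerDr scalerA mulrC -scalerA -e.
by rewrite scalerBr scalerBl addrA subrK.
Qed.

Lemma cop_EF2 (F : fieldType) (M : lmodType F) (t : F) (K Ki X Y : M) :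
  K - Ki = (t - t^-1) *: (X - Y) ->
  t^-1 *: K + (-1 * t) *: Ki = (t - t^-1) *: (t^-1 *: X + -1 *: (Ki + t^-1 *: Y)).
Proof.
move=> e; rewrite scaleN1r opprD addrCA -scalerBr scalerDr scalerA.
rewrite [(t - t^-1) * t^-1]mulrC -[(t^-1 * _) *: (X - Y)]scalerA -e scalerBr scalerN scalerBl mulN1r scaleNr opprB.
by rewrite [RHS]addrC addrA subrK.
Qed.

Lemma cross_cancel (F : fieldType) (a b d : F) : a != 0 -> b != 0 -> a ^+ 2 = b ^+ 2 ->
  b^-1 * ((a - a^-1) * d) = a^-1 * ((b - b^-1) * d).
Proof.
move=> a0 b0 e; apply/eqP; rewrite -subr_eq0; apply/eqP.
transitivity ((a ^+ 2 - b ^+ 2) * d / (a * b)); first by field; rewrite a0 b0.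
by rewrite e subrr !mul0r.
Qed.

Lemma steinberg_coef (F : fieldType) (a t : F) : a != 0 -> t != 0 -> a - a^-1 != 0 ->
  t - t^-1 != 0 -> a ^+ 2 * t ^+ 2 = 1 -> - (a^-1 / ((a - a^-1) / (t - t^-1))) = t.
Proof.
move=> a0 t0 n1 n2 e; rewrite invf_div mulrA -mulNr; apply: (canLR (mulfK n1)).
apply: (mulfI (mulf_neq0 a0 t0)); apply/eqP; rewrite -subr_eq0; apply/eqP.
transitivity (1 - a ^+ 2 * t ^+ 2); last by rewrite e subrr.
by field; rewrite a0.
Qed.

(** Concavity makes the increments nonincreasing. The last one is nonnegative, hence all are, and a
    monotone sequence with equal ends is constant. *)
Lemma concave_const (y : nat -> nat) n c : y 0 = c -> y n.+1 = c -> (y n <= c)%N ->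
  (forall k, (k < n)%N -> (y k + y k.+2 <= 2 * y k.+1)%N) ->
  forall k, (k <= n.+1)%N -> y k = c.
Proof.
move=> y0 yn yn' cc.
have mono k : (k <= n)%N -> (y (n - k) <= y (n - k).+1)%N.
  elim: k => [|k ih] kn; first by rewrite subn0 yn.
  have e : (n - k = (n - k.+1).+1)%N by move: kn; clear; lia.
  have := ih (ltnW kn); have := cc (n - k.+1)%N; rewrite e.
  move: (y _) (y _) (y _) => a b d; have : (n - k.+1 < n)%N by move: kn; clear; lia.
  by move=> -> /(_ isT); clear; lia.
have mono' k : (k <= n)%N -> (y k <= y k.+1)%N.
  by move=> kn; have := mono (n - k)%N (leq_subr _ _); rewrite subKn.
have lo k : (k <= n.+1)%N -> (c <= y k)%N.
  elim: k => [|k ih] kn; first by rewrite y0.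
  exact: leq_trans (ih (ltnW kn)) (mono' _ kn).
have hi k : (k <= n.+1)%N -> (y (n.+1 - k) <= c)%N.
  elim: k => [|k ih] kn; first by rewrite subn0 yn.
  have e : (n.+1 - k = (n.+1 - k.+1).+1)%N by move: kn; clear; lia.
  apply: leq_trans (ih (ltnW kn)); rewrite e; apply: mono'; move: kn; clear; lia.
move=> k kn; apply/eqP; rewrite eqn_leq lo // andbT.
by have := hi (n.+1 - k)%N (leq_subr _ _); rewrite subKn.
Qed.

(** Each of the r full periods and the final piece of length s + 1 contributes s + 1. The count is
    the dimension of L(rl + s). *)
Lemma count_mod l r s : (s < l)%N ->
  count (fun k => k %% l <= s)%N (iota 0 (r * l + s).+1) = (r.+1 * s.+1)%N.
Proof.
move=> sl.
have base n : (s < n)%N -> (n <= l)%N -> count (fun k => k %% l <= s)%N (iota 0 n) = s.+1.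
  move=> sn nl.
  have -> : n = (s.+1 + (n - s.+1))%N by rewrite subnKC.
  rewrite iotaD count_cat add0n.
  have -> : count (fun k => k %% l <= s)%N (iota 0 s.+1) = s.+1.
    rewrite -[RHS](size_iota 0) -count_predT; apply: eq_in_count => k.
    by rewrite mem_iota add0n ltnS /= => ks; rewrite modn_small // (leq_ltn_trans ks).
  rewrite [X in (_ + X)%N](_ : _ = 0%N) ?addn0 //; apply/eqP.
  rewrite -leqn0 leqNgt -has_count; apply/hasPn => k; rewrite mem_iota subnKC // => /andP [sk kn].
  by rewrite modn_small ?(leq_trans kn) // -ltnNge.
elim: r => [|r ih]; first by rewrite mul0n add0n mul1n base.
have -> : ((r.+1 * l + s).+1 = l + (r * l + s).+1)%N by rewrite mulSn; clear; lia.
rewrite iotaD count_cat add0n base // -[X in iota X _]addn0 iotaDl count_map.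
rewrite (eq_count (a2 := fun k => k %% l <= s)%N) ?ih ?mulSn // => k /=.
by rewrite modnDl.
Qed.

(** * The normalization of H *)

Section Cyclo.
Variables (R : realType) (q : R[i]) (l : nat).
Hypotheses (hl : (2 <= l)%N) (hq : l.-primitive_root (q ^+ 2)).

Definition evq2 (p : {poly int}) : R[i] := (map_poly intr p).[q ^+ 2].

Lemma pev_comp_X2 (p : {poly int}) : pev q (map_poly intr p \Po 'X^2) = evq2 p.
Proof.
rewrite /pev map_comp_poly map_polyXn horner_comp hornerXn -map_poly_comp /=.
by congr (_.[_]); apply: eq_map_poly => x /=; rewrite rmorph_int.
Qed.

Lemma evq2_Phi d : (d %| l)%N -> d != l -> evq2 'Phi_d != 0.
Proof.
move=> dl dnl; have l0 := ltnW hl.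
have d0 : (0 < d)%N by exact: dvdn_gt0 dl.
apply/eqP => e.
have : evq2 ('X^d - 1) = 0.
  rewrite -(prod_Cyclotomic d0) (big_rem d) /=; last by rewrite -dvdn_divisors.
  by rewrite /evq2 rmorphM hornerM -[X in X * _]/(evq2 _) e mul0r.
rewrite /evq2 rmorphB /= map_polyXn rmorph1 !hornerE => /eqP; rewrite subr_eq0.
rewrite -(prim_order_dvd hq) => ld; move: dnl.
by rewrite eqn_dvd dl ld.
Qed.

(** X^l - 1 is Phi_l times the other cyclotomic polynomials of order dividing l, and none of these
    vanishes at q^2, which has exact order l. *)
Lemma vat_eps : exists2 e, vat q (unif l / Phi_t2 l) e & e != 0.
Proof.
have l0 := ltnW hl.
pose Psi : {poly int} := \prod_(d <- rem l (divisors l)) 'Phi_d.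
have eP : 'Phi_l * Psi = 'X^l - 1.
  by rewrite -(prod_Cyclotomic l0) [RHS](big_rem l) // -dvdn_divisors.
have eu : unif l = Phi_t2 l * tofrac (map_poly intr Psi \Po 'X^2 : {poly rat}).
  rewrite /Phi_t2 -tofracM -rmorphM /= -rmorphM eP rmorphB /= map_polyXn rmorph1.
  rewrite comp_polyB comp_polyC comp_Xn_poly -exprM tofracB tofracXn tofrac1.
  by [].
have P0 : Phi_t2 l != 0 by apply: contraNneq (unif_neq0 hl) => p0; rewrite eu p0 mul0r.
exists (evq2 Psi); last first.
  rewrite /evq2 rmorph_prod horner_prod /=.
  rewrite prodf_seq_neq0; apply/allP => d; rewrite mem_rem_uniq ?divisors_uniq // inE.
  by rewrite -dvdn_divisors // => /andP[dl dd]; exact: evq2_Phi.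
rewrite eu mulrC mulKf //; rewrite -pev_comp_X2; exact: vat_poly.
Qed.
End Cyclo.

Section Action.
Variables (R : realType) (q : R[i]).
Local Notation "x ∙ v" := (LUact x v) (at level 40, v at next level).
Variable V : LUmod q.
Implicit Types (x y : LU q) (u v : V).

Lemma actD x u v : x ∙ (u + v) = x ∙ u + x ∙ v.
Proof. by have := LUact_linear x 1 u v; rewrite !scale1r. Qed.
Lemma act0 x : x ∙ 0 = 0 :> V.
Proof. by apply: (addrI (x ∙ 0)); rewrite -actD !addr0. Qed.
Lemma actZ x a u : x ∙ (a *: u) = a *: (x ∙ u).
Proof. by have := LUact_linear x a u 0; rewrite !addr0 act0 addr0. Qed.
Lemma actN x u : x ∙ (- u) = - (x ∙ u).
Proof. by rewrite -scaleN1r actZ scaleN1r. Qed.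
Lemma actB x u v : x ∙ (u - v) = x ∙ u - x ∙ v.
Proof. by rewrite actD actN. Qed.
Lemma act_sum x (I : Type) (r : seq I) (P : pred I) (f : I -> V) :
  x ∙ (\sum_(i <- r | P i) f i) = \sum_(i <- r | P i) (x ∙ f i).
Proof. by elim/big_rec2: _ => [|i y z _ <-]; rewrite ?act0 // actD. Qed.
Lemma actDl x y u : (x + y) ∙ u = x ∙ u + y ∙ u.
Proof. by have := LUact_linearl u 1 x y; rewrite !scale1r. Qed.
Lemma act0l u : 0 ∙ u = 0.
Proof. by apply: (addrI (0 ∙ u)); rewrite -actDl !addr0. Qed.
Lemma actZl a x u : (a *: x) ∙ u = a *: (x ∙ u).
Proof. by have := LUact_linearl u a x 0; rewrite !addr0 act0l addr0. Qed.
Lemma actNl x u : (- x) ∙ u = - (x ∙ u).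
Proof. by rewrite -scaleN1r actZl scaleN1r. Qed.
Lemma actBl x y u : (x - y) ∙ u = x ∙ u - y ∙ u.
Proof. by rewrite actDl actNl. Qed.
Lemma act_suml (I : Type) (r : seq I) (P : pred I) (f : I -> LU q) u :
  (\sum_(i <- r | P i) f i) ∙ u = \sum_(i <- r | P i) (f i ∙ u).
Proof. by elim/big_rec2: _ => [|i y z _ <-]; rewrite ?act0l // actDl. Qed.
Lemma act_scal a u : (a *: (1 : LU q)) ∙ u = a *: u.
Proof. by rewrite actZl LUact1. Qed.
End Action.

(** * Weights and primitive vectors *)

Section Weights.
Variables (R : realType) (q : R[i]) (l : nat).
Hypotheses (q0 : q != 0) (hl : (2 <= l)%N) (hq : l.-primitive_root (q ^+ 2)).
(** Outside [Ures] the function [LU_of] takes the default value 0; [Ures_H] supplies this membership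
    from the existence of P(1). *)
Hypothesis hU : Ures ((Phi_t2 l)^-1 *: (Ut_K ^+ (2 * l) - 1)).
Local Notation "x ∙ v" := (LUact x v) (at level 40, v at next level).
Local Notation LE := (LE q).
Local Notation LF := (LF q).
Local Notation LK := (LK q).
Local Notation LKi := (LKi q).
Local Notation LH := (LH q l).

Lemma spr_K : spr Ut_K LK. Proof. exact: spr_of Ures_K. Qed.
Lemma spr_Ki : spr Ut_Ki LKi. Proof. exact: spr_of Ures_Ki. Qed.
Lemma spr_E n : spr (Ut_Ediv n) (LE n). Proof. exact: spr_of (Ures_E n). Qed.
Lemma spr_F n : spr (Ut_Fdiv n) (LF n). Proof. exact: spr_of (Ures_F n). Qed.
Lemma spr_1 : spr 1 (1 : LU q). Proof. by have := spr_of q Ures_one; rewrite LU_of1. Qed.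

Lemma spr_H : spr (tH l Ut_torus) LH.
Proof.
have [e he e0] := vat_eps hl hq.
have ee : eps_q q l = e by apply: vat_lim; move: he; rewrite /unif.
have := sprZ (vatV he e0) (spr_of q hU).
rewrite /Defs.LH ee scalerA.
suff -> : (unif l / Phi_t2 l)^-1 / Phi_t2 l *: (Ut_K ^+ (2 * l) - 1) = tH l Ut_torus by [].
rewrite /tH Ut_torusE; congr (_ *: _).
apply: div_div_cancel; have := aunit_neq0 (ex_intro2 _ _ e he e0).
by apply: contraNneq => ->; rewrite invr0 mulr0.
Qed.

Lemma LKiK : LKi * LK = 1.
Proof.
by apply: (spr_uniq (x := 1)); [rewrite -Ut_rel_KiK; exact: sprM spr_Ki spr_K|exact: spr_1].
Qed.

Lemma LKKi : LK * LKi = 1.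
Proof.
by apply: (spr_uniq (x := 1)); [rewrite -Ut_rel_KKi; exact: sprM spr_K spr_Ki|exact: spr_1].
Qed.

Lemma Ut_K_dp (X : Ut) c n : Ut_K * X = qt ^ c *: (X * Ut_K) ->
  Ut_K * ((qfact n)^-1 *: X ^+ n) = qt ^ (c * n%:Z) *: ((qfact n)^-1 *: X ^+ n * Ut_K).
Proof.
move=> h; rewrite Ut_scalerAr Ut_scalerAl scalerA mulrC -scalerA; congr (_ *: _).
elim: n => [|n ih]; first by rewrite mulr0 expr0z scale1r mulr1 mul1r.
rewrite exprSr mulrA ih Ut_scalerAl -mulrA h Ut_scalerAr scalerA mulrA -qtzD.
by congr (qt ^ _ *: _); rewrite intS; ring.
Qed.

Definition wt (V : LUmod q) (n : int) (v : V) : Prop :=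
  LH ∙ v = n%:~R *: v /\ LK ∙ v = q ^ n *: v.

Section OneModule.
Variable V : LUmod q.
Implicit Types u v : V.

Lemma wt0 n : wt n (0 : V). Proof. by split; rewrite act0 scaler0. Qed.
Lemma wtD n u v : wt n u -> wt n v -> wt n (u + v).
Proof. by move=> [h1 k1] [h2 k2]; split; rewrite actD ?h1 ?h2 ?k1 ?k2 -scalerDr. Qed.
Lemma wtZ n a v : wt n v -> wt n (a *: v).
Proof. by move=> [h k]; split; rewrite actZ ?h ?k !scalerA mulrC. Qed.
Lemma wtB n u v : wt n u -> wt n v -> wt n (u - v).
Proof. by move=> hu hv; rewrite -scaleN1r; apply/wtD/wtZ. Qed.
Lemma wt_Ki n v : wt n v -> LKi ∙ v = q ^ (- n) *: v.
Proof.
move=> [_ k]; apply: (@scalerI _ _ (q ^ n)); first exact: expfz_neq0.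
by rewrite -actZ -k -LUactM LKiK LUact1 scalerA -expfzDr // subrr expr0z scale1r.
Qed.

(** Moving X across K^(2l) gives tH X = t^(2lc) X tH + ((t^(2lc) - 1)/(t^(2l) - 1)) X, which at q
    becomes H x = x H + c x. *)
Lemma wt_shift X x c n v : Ut_K * X = qt ^ c *: (X * Ut_K) -> spr X x ->
  wt n v -> wt (n + c) (x ∙ v).
Proof.
move=> h hx [hv kv]; split; last first.
  have e : LK * x = q ^ c *: (x * LK).
    apply: (spr_uniq (x := Ut_K * X)); first exact: sprM spr_K hx.
    by rewrite h; apply: sprZ (vat_qtz q0 c) (sprM hx spr_K).
  by rewrite -LUactM e actZl LUactM kv actZ scalerA expfzDr // mulrC.
have hX m : Ut_K ^+ m * X = qt ^ (c * m%:Z) *: (X * Ut_K ^+ m).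
  elim: m => [|m ih]; first by rewrite mulr0 expr0z scale1r mulr1 mul1r.
  rewrite exprS -mulrA ih Ut_scalerAr mulrA h Ut_scalerAl scalerA -mulrA -exprS -qtzD.
  by congr (qt ^ _ *: _); rewrite intS; ring.
have e : tH l Ut_torus * X = qt ^ (c * (2 * l)%N%:Z) *: (X * tH l Ut_torus) +
    ((qt ^ (c * (2 * l)%N%:Z) - 1) / unif l) *: X.
  rewrite /tH !Ut_torusE Ut_scalerAl Ut_scalerAr mulrBl hX mul1r mulrBr mulr1 /=.
  exact: scale_shift.
have vc := vat_geoz q0 hl hq c.
have qc : q ^ (c * (2 * l)%N%:Z) = 1 by rewrite mulrC -exprz_exp -exprnP (q2l hq) exp1rz.
have e' : LH * x = x * LH + c%:~R *: x.
  apply: (spr_uniq (x := tH l Ut_torus * X)); first exact: sprM spr_H hx.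
  rewrite e; apply: sprD; last exact: sprZ vc hx.
  have := sprZ (vat_qtz q0 (c * (2 * l)%N%:Z)) (sprM hx spr_H).
  by rewrite qc scale1r.
by rewrite -LUactM e' actDl LUactM hv actZ actZl -scalerDl intrD.
Qed.

Lemma wt_E m n v : wt n v -> wt (n + 2 * m%:Z) (LE m ∙ v).
Proof. apply: wt_shift (spr_E m); exact: Ut_K_dp Ut_rel_KE. Qed.

Lemma wt_F m n v : wt n v -> wt (n - 2 * m%:Z) (LF m ∙ v).
Proof.
rewrite -mulNr; apply: wt_shift (spr_F m); exact: Ut_K_dp Ut_rel_KF.
Qed.

End OneModule.

(** Clear for scalars, K and K^-1, true for [H] by [vat_geoz], and stable under sums and
    products. *)
Lemma tame_act x : tame q l x -> exists2 y, spr (x Ut Ut_torus) y &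
  forall n, exists2 a, vat q (x Qt (num_torus n)) a &
    forall (V : LUmod q) (v : V), wt n v -> y ∙ v = a *: v.
Proof.
elim=> {x}.
- move=> f a fa; exists (a *: (1 : LU q)); first exact: sprZ fa spr_1.
  by move=> n; exists a => // V v _; rewrite act_scal.
- exists LK; [exact: spr_K|move=> n; exists (q ^ n); first exact: vat_qtz].
  by move=> V v [].
- exists LKi; [exact: spr_Ki|move=> n; exists (q ^ (- n)); first exact: vat_qtz].
  by move=> V v; exact: wt_Ki.
- exists LH; [exact: spr_H|move=> n; exists n%:~R; last by move=> V v []].
  have := vat_geoz q0 hl hq n; rewrite /tH /= mulrC; congr (vat q (_ * (_ - 1)) _).
  by rewrite exprnP exprz_exp.
- move=> x y _ [x' sx hx] _ [y' sy hy]; exists (x' + y'); first exact: sprD.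
  move=> n; have [a va ha] := hx n; have [b vb hb] := hy n.
  by exists (a + b); [exact: vatD|move=> V v hv; rewrite actDl scalerDl ha // hb].
- move=> x y _ [x' sx hx] _ [y' sy hy]; exists (x' * y'); first exact: sprM.
  move=> n; have [a va ha] := hx n; have [b vb hb] := hy n.
  exists (a * b); first exact: vatM.
  by move=> V v hv; rewrite LUactM hb // actZ ha // scalerA mulrC.
- move=> x y _ [x' sx hx] e; exists x'; first by rewrite -e.
  move=> n; have [a va ha] := hx n; exists a => //; by rewrite -e.
Qed.

Definition gb (z : int) (j : nat) : R[i] := lim_at q (gbin z j).

Lemma tbin_act c j : exists2 y, spr (tbin Ut_torus c j) y &
  forall n, vat q (gbin (n + c) j) (gb (n + c) j) /\
    forall (V : LUmod q) (v : V), wt n v -> y ∙ v = gb (n + c) j *: v.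
Proof.
have [y sy hy] := tame_act (tame_tbin q0 hl hq c j); exists y => // n.
have [a] := hy n; rewrite tbin_num => va ha.
by have e : gb (n + c) j = a by [exact: vat_lim]; rewrite e.
Qed.

Lemma vat_gb z j : vat q (gbin z j) (gb z j).
Proof. by have [y _ /(_ z) []] := tbin_act 0 j; rewrite addr0. Qed.

Lemma gb_nat (m j : nat) : gb m%:Z j = qbinom_at q m j.
Proof. by rewrite /gb (gbin_nat q0 hl hq). Qed.

Lemma vat_qbinom m j : vat q (qbinom m j) (qbinom_at q m j).
Proof. by rewrite -gb_nat -(gbin_nat q0 hl hq); exact: vat_gb. Qed.

Lemma qbinom_at_neq0 n k : (k <= n)%N -> (k %% l <= n %% l)%N -> qbinom_at q n k != 0.
Proof.
move=> kn km; have [a va a0] := qbinom_unit q0 hl hq kn km.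
by rewrite (vat_uniq (vat_qbinom n k) va).
Qed.

Lemma qbinom_at_eq0 n k : (n %% l < k %% l)%N -> qbinom_at q n k = 0.
Proof. by move=> h; exact: vat_uniq (vat_qbinom n k) (qbinom_van q0 hl hq h). Qed.

Lemma qbinom_at_small n k : (n < k)%N -> qbinom_at q n k = 0.
Proof.
by move=> h; have := vat_qbinom n k; rewrite qbinom_small // => /(vat_uniq (vat0 q)) ->.
Qed.

(** Up to sign this is [p + al; al], and al has residue 0 modulo l. *)
Lemma gb_opp_neq0 (p a : nat) : gb (- p.+1%:Z) (a * l) != 0.
Proof.
have := vat_gb (- p.+1%:Z) (a * l); rewrite (gbin_opp q0 hl hq) => v.
have v' := vatM (vatX (a * l) (vatN (vat1 q))) (vat_qbinom (p + a * l) (a * l)).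
rewrite (vat_uniq v v') mulf_neq0 ?expf_neq0 ?oppr_eq0 ?oner_eq0 //.
by apply: qbinom_at_neq0; [exact: leq_addl|rewrite modnMl].
Qed.

Section Commutation.
Variable V : LUmod q.
Implicit Types u v : V.

Lemma LE0 v : LE 0 ∙ v = v.
Proof. by rewrite /Defs.LE /Ut_Ediv qfact0 invr1 scale1r expr0 LU_of1 LUact1. Qed.
Lemma LF0 v : LF 0 ∙ v = v.
Proof. by rewrite /Defs.LF /Ut_Fdiv qfact0 invr1 scale1r expr0 LU_of1 LUact1. Qed.

Lemma LEM m n v : LE m ∙ (LE n ∙ v) = qbinom_at q (m + n) m *: (LE (m + n) ∙ v).
Proof.
rewrite -LUactM -actZl; congr (_ ∙ _); apply: (spr_uniq (sprM (spr_E m) (spr_E n))).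
rewrite (Ut_dpM q0 hl hq (x := Ut_E)) //; exact: sprZ (vat_qbinom _ _) (spr_E _).
Qed.

Lemma LFM m n v : LF m ∙ (LF n ∙ v) = qbinom_at q (m + n) m *: (LF (m + n) ∙ v).
Proof.
rewrite -LUactM -actZl; congr (_ ∙ _); apply: (spr_uniq (sprM (spr_F m) (spr_F n))).
rewrite (Ut_dpM q0 hl hq (x := Ut_F)) //; exact: sprZ (vat_qbinom _ _) (spr_F _).
Qed.

End Commutation.

Lemma LEF_LU a b (y : nat -> LU q) :
  (forall j : nat, spr (tbin Ut_torus (2 * j%:Z - a%:Z - b%:Z) j) (y j)) ->
  LE a * LF b =
  \sum_(j < a.+1) (if (j <= b)%N then LF (b - j) else 0) * y j * LE (a - j).
Proof.
move=> sy; apply: (spr_uniq (sprM (spr_E a) (spr_F b))).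
rewrite (Ut_EF_comm q0 hl hq); apply: spr_sum => // j; apply: sprM (spr_E _).
apply: sprM (sy j); case: ifP => _; first exact: spr_F.
by have := sprZ (vat0 q) spr_1; rewrite !scale0r.
Qed.

Lemma LEF (V : LUmod q) (v : V) a b n : wt n v -> LE a ∙ (LF b ∙ v) =
  \sum_(j < a.+1) gb (n + a%:Z - b%:Z) j *:
    (if (j <= b)%N then LF (b - j) ∙ (LE (a - j) ∙ v) else 0).
Proof.
move=> hv.
have /all_sig2 [y sy hy] : forall j : nat, {y | spr (tbin Ut_torus (2 * j%:Z - a%:Z - b%:Z) j) y &
   forall n (V : LUmod q) (v : V), wt n v -> y ∙ v = gb (n + (2 * j%:Z - a%:Z - b%:Z)) j *: v}.
  move=> j; apply: cid2; have [z sz hz] := tbin_act (2 * j%:Z - a%:Z - b%:Z) j.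
  by exists z => // m W w hw; apply: (hz m).2.
rewrite -LUactM (LEF_LU sy).
rewrite act_suml; apply: eq_bigr => j _; rewrite !LUactM (hy _ _ _ _ (wt_E (a - j) hv)) actZ.
have ja : (j <= a)%N by rewrite -ltnS.
congr (gb _ _ *: _); first by rewrite -subzn //; ring.
by case: ifP => //; rewrite act0l.
Qed.

(** Lagrange interpolation in [H]: on a module with weights in [ws] this is the projection onto
    weight n. *)
Definition prj (ws : seq int) (n : int) : LU q :=
  \prod_(k <- ws | k != n) ((n - k)%:~R^-1 *: (LH - k%:~R *: (1 : LU q))).

Lemma prj_act ws n m (V : LUmod q) (v : V) : wt m v ->
  prj ws n ∙ v = (\prod_(k <- ws | k != n) ((n - k)%:~R^-1 * (m - k)%:~R)) *: v.
Proof.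
move=> [hv _]; rewrite /prj; elim: ws => [|k ws ih]; first by rewrite !big_nil LUact1 scale1r.
rewrite !big_cons; case: ifP => // _.
rewrite LUactM ih actZ actZl actBl hv act_scal -scalerBl -intrB !scalerA.
by congr (_ *: _); rewrite [RHS]mulrC mulrA.
Qed.

Lemma prj_id ws n (V : LUmod q) (v : V) : wt n v -> prj ws n ∙ v = v.
Proof.
move=> hv; rewrite (prj_act _ _ hv) big1 ?scale1r // => k kn.
by rewrite mulVf // intr_eq0 subr_eq0 eq_sym.
Qed.

Lemma prj_kill ws n m (V : LUmod q) (v : V) : m != n -> m \in ws -> wt m v -> prj ws n ∙ v = 0.
Proof.
move=> mn mw hv; rewrite (prj_act _ _ hv) (big_rem m) //= mn subrr mulr0 mul0r scale0r.
by [].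
Qed.

Definition wsum (ws : seq int) (V : LUmod q) (v : V) :=
  exists2 f : int -> V, forall n, wt n (f n) & v = \sum_(n <- ws) f n.

Lemma wsum0 ws (V : LUmod q) : wsum ws (0 : V).
Proof. by exists (fun=> 0) => [n|]; [exact: wt0|rewrite big1]. Qed.

Lemma wsum_lin ws (V : LUmod q) a (u v : V) : wsum ws u -> wsum ws v -> wsum ws (a *: u + v).
Proof.
move=> [f hf ->] [g hg ->]; exists (fun n => a *: f n + g n) => [n|].
  by apply: wtD => //; exact: wtZ.
by rewrite big_split /= scaler_sumr.
Qed.

Lemma wsumD ws (V : LUmod q) (u v : V) : wsum ws u -> wsum ws v -> wsum ws (u + v).
Proof. by move=> hu hv; rewrite -(scale1r u); exact: wsum_lin. Qed.

Lemma wsum_wt ws (V : LUmod q) n (v : V) : uniq ws -> n \in ws -> wt n v -> wsum ws v.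
Proof.
move=> uw nw hn; exists (fun k => if k == n then v else 0) => [k|].
  by case: eqP => [->|_] //; exact: wt0.
by rewrite (bigD1_seq n) //= eqxx big1 ?addr0 // => k /negPf ->.
Qed.

(** A form of [type_I] that is easier to verify: the sum of the weight spaces is automatically
    direct, as [prj] separates them ([weighted_type_I]). *)
Definition weighted (ws : seq int) (V : LUmod q) := uniq ws /\ forall v : V, wsum ws v.

Section Weighted.
Variables (ws : seq int) (V : LUmod q).
Hypothesis hV : weighted ws V.

Lemma prjE v f n : (forall n, wt n (f n)) -> v = \sum_(n <- ws) f n ->
  prj ws n ∙ v = if n \in ws then f n else (0 : V).
Proof.
move=> hf ->; have [uw _] := hV; rewrite act_sum; case: ifP => nw.
  rewrite (bigD1_seq n) //= prj_id // big1_seq ?addr0 // => k /andP[kn kw].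
  exact: prj_kill (hf k).
by rewrite big1_seq // => k /andP[_ kw]; apply: prj_kill (hf k) => //; apply: contraFneq nw => <-.
Qed.

Lemma wt_prj n (v : V) : wt n (prj ws n ∙ v).
Proof.
have [_ /(_ v) [f hf ev]] := hV; rewrite (prjE _ hf ev).
by case: ifP => _ //; exact: wt0.
Qed.

Lemma sum_prj (v : V) : v = \sum_(n <- ws) prj ws n ∙ v.
Proof.
have [_ /(_ v) [f hf ev]] := hV; rewrite {1}ev; apply: eq_big_seq => n nw.
by rewrite (prjE _ hf ev) nw.
Qed.

Lemma wt_supp n (v : V) : wt n v -> n \notin ws -> v = 0.
Proof.
move=> hv nw; rewrite -(prj_id ws hv).
by have [_ /(_ v) [f hf ev]] := hV; rewrite (prjE _ hf ev) (negPf nw).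
Qed.

End Weighted.

Lemma type_I_weighted (V : LUmod q) : type_I l V -> exists ws, weighted ws V.
Proof.
move=> [p [w [W [wi _ Wf hW]]]]; exists (codom w); split; first by apply/injectiveP.
move=> v; have : v \in (\sum_j W j)%VS by rewrite Wf memvf.
move=> /memv_sumP [vs hvs ->].
exists (fun n => \sum_(j | w j == n) vs j) => [n|].
  by apply: big_ind => [|x y|j /eqP <-]; [exact: wt0|exact: wtD|exact: hW (hvs j _)].
rewrite /codom /image_mem big_map big_enum /=; apply: eq_bigr => j _; rewrite (big_pred1 j) // => k.
exact: inj_eq.
Qed.

(** Among the subspaces contained in [S], one of maximal dimension is all of [S], since a missing
    vector could be adjoined. *)
Lemma vspace_of_pred (W : vectType R[i]) (S : W -> Prop) : S 0 ->
  (forall a u v, S u -> S v -> S (a *: u + v)) ->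
  exists N : {vspace W}, forall v, v \in N <-> S v.
Proof.
move=> S0 SD.
pose P d := `[< exists2 N : {vspace W}, \dim N = d & forall v, v \in N -> S v >].
have P0 : exists d, P d.
  exists 0%N; apply/asboolP; exists 0%VS; first exact: dimv0.
  by move=> v; rewrite memv0 => /eqP ->.
have Pb d : P d -> (d <= \dim {:W})%N by move=> /asboolP [N <- _]; rewrite dimvS ?subvf.
have [d /asboolP [N dN NS] dmax] := ex_maxnP P0 Pb.
exists N => v; split; first exact: NS.
move=> Sv; apply: contraT => vN.
have /dmax : P (\dim (N + <[v]>)).
  apply/asboolP; exists (N + <[v]>)%VS => // x /memv_addP [y /NS Sy [z /vlineP [k ->] ->]].
  by rewrite addrC; exact: SD.
have v0 : v != 0 by apply: contraNneq vN => ->; exact: mem0v.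
rewrite dimv_disjoint_sum ?dN ?dim_vline ?v0 ?addn1 ?ltnn //.
apply/eqP; rewrite -subv0; apply/subvP => x /memv_capP [xN /vlineP [k xk]].
rewrite memv0 xk scaler_eq0 (negPf v0) orbF; apply: contraNT vN => k0.
by rewrite -(scale1r v) -(mulVf k0) -scalerA -xk memvZ.
Qed.

Lemma weighted_type_I ws (V : LUmod q) : weighted ws V -> type_I l V.
Proof.
move=> hV; have [uw _] := hV.
have wv n : exists N : {vspace V}, forall v, v \in N <-> wt n v.
  apply: vspace_of_pred; first exact: wt0.
  by move=> a u v hu hv; apply: wtD hv; exact: wtZ.
have [W hW] := choice wv.
exists (size ws), (fun j => nth 0 ws j), (fun j => W (nth 0 ws j)); split.
- by move=> i j /eqP; rewrite nth_uniq // => /eqP /val_inj.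
- apply/directv_sum_independent => us hus s0 i _.
  have := act0 V (prj ws (nth 0 ws i)); rewrite -{1}s0 act_sum (bigD1 i) //= prj_id; last first.
    exact/hW/hus.
  rewrite big1 ?addr0 // => j ji; apply: (prj_kill (m := nth 0 ws j)); last exact/hW/hus.
    by rewrite nth_uniq.
  by rewrite mem_nth.
- apply/vspaceP => v; rewrite memvf (sum_prj hV v) (big_nth 0) big_mkord; apply/memv_sumP.
  by exists (fun j : 'I_(size ws) => prj ws (nth 0 ws j) ∙ v) => // j _; exact/hW/wt_prj.
- by move=> j v /hW.
Qed.

Lemma basis_ind (W : vectType R[i]) (b : seq W) (Q : W -> Prop) : basis_of fullv b ->
  Q 0 -> (forall a u v, Q u -> Q v -> Q (a *: u + v)) ->
  (forall x, x \in b -> Q x) -> forall v, Q v.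
Proof.
move=> hb Q0 QD Qb v; rewrite (coord_basis (X := in_tuple b) hb (memvf v)).
apply: big_ind => // [x y hx hy|i _]; first by rewrite -(scale1r x); exact: QD.
by rewrite -[_ *: _]addr0; apply: QD => //; apply: Qb; rewrite mem_nth.
Qed.

Lemma weighted_basis ws (V : LUmod q) (b : seq V) : basis_of fullv b -> uniq ws ->
  (forall x, x \in b -> exists2 n, n \in ws & wt n x) -> weighted ws V.
Proof.
move=> hb uw hx; split=> //; apply: (basis_ind hb); first exact: wsum0.
- by move=> a u v; exact: wsum_lin.
- by move=> x /hx [n nw hn]; exact: wsum_wt hn.
Qed.

Lemma mk_lfun (V W : vectType R[i]) (f : V -> W) : linear f -> exists g : 'Hom(V, W), g =1 f.
Proof.
move=> hf; pose F : {linear V -> W} := HB.pack f (GRing.isLinear.Build _ _ _ _ f hf).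
by exists (linfun F) => v; rewrite lfunE.
Qed.

Lemma LU_stable (V : LUmod q) (S : V -> Prop) : S 0 ->
  (forall a u v, S u -> S v -> S (a *: u + v)) ->
  (forall v, S v -> S (LK ∙ v)) -> (forall v, S v -> S (LKi ∙ v)) ->
  (forall n v, S v -> S (LE n ∙ v)) -> (forall n v, S v -> S (LF n ∙ v)) ->
  forall x v, S v -> S (x ∙ v).
Proof.
move=> S0 SD SK SKi SE SF; apply: LU_ind => //.
- by move=> c v hv; rewrite act_scal -[_ *: _]addr0; exact: SD.
- by move=> x y hx hy v hv; rewrite actDl -(scale1r (x ∙ v)); apply: SD; [exact: hx|exact: hy].
- by move=> x y hx hy v hv; rewrite LUactM; exact/hx/hy.
Qed.

Lemma hom_gen (V W : LUmod q) (f : 'Hom(V, W)) : (forall v, f (LK ∙ v) = LK ∙ f v) ->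
  (forall n v, f (LE n ∙ v) = LE n ∙ f v) -> (forall n v, f (LF n ∙ v) = LF n ∙ f v) -> LUhom f.
Proof.
move=> fK fE fF; apply: LU_ind => //.
- by move=> c v; rewrite !act_scal linearZ.
- move=> v; have e := fK (LKi ∙ v); rewrite -LUactM LKKi LUact1 in e.
  by rewrite e -LUactM LKiK LUact1.
- by move=> x y hx hy v; rewrite (actDl x y v) linearD /= hx hy actDl.
- by move=> x y hx hy v; rewrite !LUactM hx hy.
Qed.

(** * Primitive vectors and the modules they generate *)

Definition prim (V : LUmod q) (n : int) (v : V) := wt n v /\ forall k, LE k.+1 ∙ v = 0.

Lemma LEF_prim (V : LUmod q) n (v : V) a b : prim n v ->
  LE a ∙ (LF b ∙ v) = if (a <= b)%N then gb (n + a%:Z - b%:Z) a *: (LF (b - a) ∙ v) else 0.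
Proof.
move=> [hv pv]; rewrite (LEF _ _ hv) big_ord_recr /= subnn LE0 big1 => [|j _].
  by rewrite add0r; case: ifP => // _; rewrite scaler0.
have -> : (a - j = (a - j.+1).+1)%N by have := ltn_ord j; lia.
by rewrite pv act0 if_same scaler0.
Qed.

(** Weights are bounded, so F^(al) v = 0 for large a, while E^(al) F^(al) v is a nonzero multiple of
    v by [gb_opp_neq0]. *)
Lemma prim_neg (V : LUmod q) (p : nat) (v : V) : type_I l V -> prim (- p.+1%:Z) v -> v = 0.
Proof.
move=> /type_I_weighted [ws hV] pv.
pose M := (\sum_(k <- ws) `|k|%N)%N.
have wM k : k \in ws -> (`|k| <= M)%N by move=> kw; rewrite /M (big_rem k) //= leq_addr.
have l0 := ltnW hl.
have := LEF_prim (M.+1 * l) (M.+1 * l) pv.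
rewrite leqnn addrK subnn LF0 (wt_supp hV (wt_F (M.+1 * l) pv.1)).
  rewrite act0 => /esym/eqP; rewrite scaler_eq0 (negPf (gb_opp_neq0 p M.+1)) /=.
  by move/eqP.
apply/negP => /wM; have : (M.+1 <= M.+1 * l)%N by rewrite leq_pmulr.
by lia.
Qed.

(** F^(k) v is again primitive, of negative weight n - 2k: E^(a) sends it to a multiple of F^(k-a)
    v, which is zero by induction if k - a > n and otherwise has the coefficient [n+a-k; a] = 0. *)
Lemma prim_int (V : LUmod q) (n : nat) (v : V) k : type_I l V -> prim n%:Z v -> (n < k)%N ->
  LF k ∙ v = 0.
Proof.
move=> tV pv; elim/ltn_ind: k => k ih nk.
apply: (@prim_neg V (2 * k - n).-1 _ tV); split=> [|a].
  by have := wt_F k pv.1; congr wt; lia.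
rewrite (LEF_prim _ _ pv); case: leqP => // ak.
have [h|h] := leqP (k - a.+1) n; last by rewrite ih ?scaler0 //; lia.
have -> : n%:Z + a.+1%:Z - k%:Z = (n + a.+1 - k)%N%:Z by lia.
by rewrite gb_nat qbinom_at_small ?scale0r //; lia.
Qed.

(* [V] is generated by a primitive vector [v0] of weight [i], with basis the *)
(* [F^(k) v0], [I k]. *)
Record hw (i : nat) (I : pred nat) (V : LUmod q) (v0 : V) : Prop := Hw {
  hw_prim : prim i%:Z v0;
  hw_le : forall k, I k -> (k <= i)%N;
  hw_van : forall k, ~~ I k -> LF k ∙ v0 = 0;
  hw_basis : basis_of fullv [seq LF k ∙ v0 | k <- iota 0 i.+1 & I k] }.

Section HighestWeight.
Variables (i : nat) (I : pred nat) (V : LUmod q) (v0 : V).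
Hypothesis hV : hw i I v0.

Lemma hw_neq0 k : I k -> LF k ∙ v0 != 0.
Proof.
move=> Ik; have /basis_free := hw_basis hV; apply: contraTneq => e.
apply/negP => fr; have := free_not0 (v := 0) fr; rewrite eqxx => /(_ _) h.
have : 0 \in [seq LF k ∙ v0 | k <- iota 0 i.+1 & I k]; last by move/h.
rewrite -{1}e; apply/mapP; exists k => //.
by rewrite mem_filter Ik mem_iota add0n ltnS (hw_le hV).
Qed.

Lemma hw_ind (Q : V -> Prop) : Q 0 -> (forall a u v, Q u -> Q v -> Q (a *: u + v)) ->
  (forall k, I k -> Q (LF k ∙ v0)) -> forall v, Q v.
Proof.
move=> Q0 QD h; apply: (basis_ind (hw_basis hV)) => // x /mapP [k].
by rewrite mem_filter => /andP[Ik _] ->; exact: h.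
Qed.

Lemma hw_full (N : {vspace V}) : submodule N -> v0 \in N -> N = fullv.
Proof.
move=> sN h; apply/vspaceP => v; rewrite memvf; apply/idP.
move: v; apply: hw_ind; [exact: mem0v| |by move=> k _; exact: sN].
by move=> a u v hu hv; rewrite memvD // memvZ.
Qed.

Lemma hw_weighted : weighted [seq i%:Z - 2 * k%:Z | k <- iota 0 i.+1 & I k] V.
Proof.
apply: weighted_basis (hw_basis hV) _ _.
  by rewrite map_inj_uniq ?filter_uniq ?iota_uniq // => a b; lia.
move=> x /mapP [k ki ->]; exists (i%:Z - 2 * k%:Z); first by apply/mapP; exists k.
exact: wt_F (hw_prim hV).1.
Qed.

Lemma hw_wtv n v : wt n v -> v != 0 ->
  exists k, exists2 c, I k & n = i%:Z - 2 * k%:Z /\ v = c *: (LF k ∙ v0).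
Proof.
move=> hv v_0; have hW := hw_weighted; set ws := map _ _ in hW.
have : n \in ws by apply: contraNT v_0 => nw; rewrite (wt_supp hW hv nw).
move=> /mapP [k]; rewrite mem_filter => /andP[Ik _] en; exists k.
suff H u : exists c, prj ws n ∙ u = c *: (LF k ∙ v0).
  by have [c] := H v; rewrite prj_id // => ev; exists c.
elim/hw_ind: u.
- by exists 0; rewrite act0 scale0r.
- by move=> a x y [c ex] [d ey]; exists (a * c + d); rewrite actD actZ ex ey scalerDl scalerA.
move=> j Ij; have hj := wt_F j (hw_prim hV).1.
have [ji|ji] := eqVneq (i%:Z - 2 * j%:Z) n.
  have -> : k = j by lia.
  by exists 1; rewrite scale1r prj_id // -ji.
exists 0; rewrite scale0r; apply: prj_kill hj => //; apply/mapP; exists j => //.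
by rewrite mem_filter Ij mem_iota add0n ltnS (hw_le hV).
Qed.

Lemma hw_type_I : type_I l V. Proof. exact: weighted_type_I hw_weighted. Qed.

Lemma hw_dim : \dim {:V} = count I (iota 0 i.+1).
Proof.
by rewrite (size_basis (X := in_tuple _) (hw_basis hV)) size_map size_filter.
Qed.

(** On the vectors F^(k) v0 the generators act by scalars that depend only on the weight of the
    primitive vector, so F^(k) v0 |-> F^(k) w commutes with them. *)
Lemma hw_hom (W : LUmod q) (w : W) : prim i%:Z w -> (forall k, ~~ I k -> LF k ∙ w = 0) ->
  exists2 f : 'Hom(V, W), LUhom f & forall k, f (LF k ∙ v0) = LF k ∙ w.
Proof.
move=> pw hw0.
have [f hf] := linear_of_free [seq LF k ∙ v0 | k <- iota 0 i.+1 & I k]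
  [seq LF k ∙ w | k <- iota 0 i.+1 & I k].
have {}hf := hf (basis_free (hw_basis hV)); rewrite !size_map in hf; have {}hf := hf erefl.
have fk k : f (LF k ∙ v0) = LF k ∙ w.
  have [Ik|nIk] := boolP (I k); last by rewrite (hw_van hV nIk) hw0 // linear0.
  move: hf; rewrite -map_comp => /eq_in_map; apply.
  by rewrite mem_filter Ik mem_iota add0n ltnS (hw_le hV).
exists (linfun f); last by move=> k; rewrite lfunE.
apply: hom_gen => [v|n v|n v]; rewrite !lfunE /=; elim/hw_ind: v.
- by rewrite !(act0, linear0).
- by move=> a u v hu hv; rewrite !(actD, actZ, linearP) /= hu hv.
- move=> k _; rewrite fk (wt_F k (hw_prim hV).1).2 linearZ /= fk.
  by rewrite (wt_F k pw.1).2.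
- by rewrite !(act0, linear0).
- by move=> a u v hu hv; rewrite !(actD, actZ, linearP) /= hu hv.
- move=> k _; rewrite fk (LEF_prim _ _ (hw_prim hV)) (LEF_prim _ _ pw).
  by case: ifP => _; rewrite ?linear0 // linearZ /= fk.
- by rewrite !(act0, linear0).
- by move=> a u v hu hv; rewrite !(actD, actZ, linearP) /= hu hv.
- by move=> k _; rewrite fk !LFM linearZ /= fk.
Qed.

End HighestWeight.

Lemma LKX_act (V : LUmod q) (v : V) (n : int) m : LK ∙ v = q ^ n *: v ->
  (LK ^+ m) ∙ v = (q ^ n) ^+ m *: v.
Proof.
move=> h; elim: m => [|m ih]; first by rewrite !expr0 LUact1 scale1r.
by rewrite exprS LUactM ih actZ h scalerA -exprSr.
Qed.

Lemma LKX_Ki m : LK ^+ m * LKi ^+ m = 1.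
Proof.
elim: m => [|m ih]; first by rewrite !expr0 mulr1.
by rewrite exprSr exprS mulrA -(mulrA _ LK) LKKi mulr1 ih.
Qed.

(* The relation between [H] and the q-binomial of K recovers the [H]-weight. *)
Lemma H_of_tbin (V : LUmod q) (v : V) n y : spr (tbin Ut_torus 0 l) y ->
  LK ∙ v = q ^ n *: v -> y ∙ v = gb n l *: v -> LH ∙ v = n%:~R *: v.
Proof.
move=> sy hK hy; have [b [e [[b' vb b0] he Hrel]]] := tbin_tH q0 hl hq 0.
have [e' ve] := choice he.
have Kv m : (LK ^+ m) ∙ v = (q ^ n) ^+ m *: v by exact: LKX_act.
have eU : b' *: y = LKi ^+ l * (LH + \sum_(j < l) e' j *: LK ^+ (2 * j)).
  apply: (spr_uniq (x := tS Ut_torus b * tbin Ut_torus 0 l)).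
    by rewrite Ut_torusE; exact: sprZ vb sy.
  rewrite Hrel; apply: sprM; first exact: spr_exp spr_Ki.
  apply: sprD; first exact: spr_H.
  by apply: spr_sum => // j; rewrite Ut_torusE; apply: sprZ (ve j) _; exact: spr_exp spr_K.
have eN : b' * gb n l = (q ^ (- n)) ^+ l * (n%:~R + \sum_(j < l) e' j * (q ^ n) ^+ (2 * j)).
  apply: (vat_uniq (q := q) (f := tS (num_torus n) b * tbin (num_torus n) 0 l)).
    by rewrite tbin_num addr0; apply: vatM vb (vat_gb _ _).
  rewrite Hrel; apply: vatM; first exact/vatX/vat_qtz.
  apply: vatD; last by apply: vat_sum => j _; apply: vatM (ve j) _; exact/vatX/vat_qtz.
  have := vat_geoz q0 hl hq n; rewrite /tH /= mulrC; congr (vat q (_ * (_ - 1)) _).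
  by rewrite exprnP exprz_exp.
have := congr1 (fun z => z ∙ v) eU; rewrite /= actZl hy scalerA eN LUactM.
move/(congr1 (fun u => (LK ^+ l) ∙ u)); rewrite -[in RHS]LUactM LKX_Ki LUact1 actZ Kv.
rewrite actDl act_suml (eq_bigr (fun j : 'I_l => (e' j * (q ^ n) ^+ (2 * j)) *: v)); last first.
  by move=> j _; rewrite actZl Kv scalerA.
rewrite -scaler_suml scalerA mulrAC -exprMn -expfzDr // addNr expr0z expr1n mul1r scalerDl.
by move/addIr.
Qed.

Lemma qbinom_at_nn n : qbinom_at q n n = 1.
Proof.
by have := vat_qbinom n n; rewrite (qbinomnn q0 hl hq) => /(vat_uniq (vat1 q)).
Qed.

(** The defining formulas prescribe K, E^(n) and F^(n) but not [H]. Its eigenvalue on m_0 is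
    recovered by [H_of_tbin] from [K; 0; l] m_0 = E^(l) F^(l) m_0 = [i; l] m_0. *)
Lemma weyl_hw i (D : LUmod q) : is_weyl i D -> exists v0 : D, hw i (fun k => k <= i)%N v0.
Proof.
move=> [m [mb m0 mK mE mF]]; exists (m 0).
have Fm k : LF k ∙ m 0 = m k%:Z.
  by have := mF k 0%N isT; rewrite add0n qbinom_at_nn scale1r add0r.
have Em k : LE k.+1 ∙ m 0 = 0.
  by have := mE k.+1 0%N isT; rewrite [m (_ - _)]m0 ?scaler0 //; apply/orP; left; lia.
split=> //; last 1 first.
- rewrite (eq_map (g := fun k => m k%:Z)) // (_ : filter _ _ = iota 0 i.+1) //.
  by apply/all_filterP/allP => k; rewrite mem_iota add0n ltnS.
- have hK : LK ∙ m 0 = q ^ i%:Z *: m 0 by have := mK 0%N isT; rewrite mulr0 subr0.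
  split=> //; split=> //; have [y sy _] := tbin_act 0 l.
  apply: (H_of_tbin sy hK).
  have -> : gb i%:Z l *: m 0 = LE l ∙ (LF l ∙ m 0).
    rewrite Fm gb_nat; have [li|il] := leqP l i.
      by rewrite mE // subnK // subrr.
    by rewrite qbinom_at_small // scale0r m0 ?act0 //; apply/orP; right; lia.
  have zE (j : nat) : exists z : LU q, spr (tbin Ut_torus (2 * j%:Z - l%:Z - l%:Z) j) z.
    by have [z sz _] := tbin_act (2 * j%:Z - l%:Z - l%:Z) j; exists z.
  have [z sz] := choice zE.
  rewrite -LUactM (LEF_LU sz) act_suml big_ord_recr /= leqnn !subnn !LUactM LF0 LE0.
  rewrite big1 => [|j _].
    rewrite add0r; congr (_ ∙ _); apply: (spr_uniq sy); have := sz l; congr (spr (tbin _ _ _) _).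
    by ring.
  rewrite !LUactM; have -> : (l - j = (l - j.+1).+1)%N by have := ltn_ord j; lia.
  by rewrite Em !act0.
- by move=> k; rewrite -ltnNge => ik; rewrite Fm m0 //; apply/orP; right; lia.
Qed.

(** * Simple modules as heads of Weyl modules *)

Lemma modSl n : (n %% l)%N <> l.-1 -> (n.+1 %% l = (n %% l).+1)%N.
Proof.
move=> hn; rewrite -addn1 -modnDml addn1 modn_small //.
have := ltn_pmod n (ltnW hl); move: hn hl; clear; lia.
Qed.

Lemma modSl0 n : (n %% l)%N = l.-1 -> (n.+1 %% l = 0)%N.
Proof. by move=> hn; rewrite -addn1 -modnDml hn addn1 prednK ?modnn // ltnW. Qed.

(** The indices k for which [i; k] does not vanish at q. *)
Definition good (i k : nat) := (k <= i)%N && (k %% l <= i %% l)%N.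

Lemma good0 i : good i 0. Proof. by rewrite /good mod0n. Qed.

Lemma good_steinberg n k : (n %% l)%N = l.-1 -> good n k = (k <= n)%N.
Proof.
move=> hn; have l0 := ltnW hl.
have kl : (k %% l <= l.-1)%N by rewrite -ltnS prednK // ltn_mod.
by rewrite /good hn kl andbT.
Qed.

Lemma gen_neq0 i (V : LUmod q) (v0 : V) : hw i (good i) v0 -> v0 != 0.
Proof. by move=> hV; have := hw_neq0 hV (good0 i); rewrite LF0. Qed.

Lemma gb_good i k : good i k -> gb i%:Z k != 0.
Proof. by move=> /andP[ki km]; rewrite gb_nat qbinom_at_neq0. Qed.

Lemma span_ind (W : vectType R[i]) (b : seq W) (Q : W -> Prop) :
  Q 0 -> (forall a u v, Q u -> Q v -> Q (a *: u + v)) ->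
  (forall x, x \in b -> Q x) -> forall v, v \in <<b>>%VS -> Q v.
Proof.
move=> Q0 QD Qb v /(coord_span (X := in_tuple b)) ->.
apply: big_ind => // [x y hx hy|i _]; first by rewrite -(scale1r x); exact: QD.
by rewrite -[_ *: _]addr0; apply: QD => //; apply: Qb; rewrite mem_nth.
Qed.

Lemma free_wt (V : LUmod q) (s : seq nat) (n : nat -> int) (g : nat -> V) :
  uniq s -> injective n -> (forall k, wt (n k) (g k)) -> {in s, forall k, g k != 0} ->
  free (map g s).
Proof.
move=> us ni hg; elim: s us => [|k s ih] /= us g0; first by rewrite nil_free.
move: us => /andP[ks us]; rewrite free_cons ih ?andbT // => [|j js]; last first.
  by apply: g0; rewrite inE js orbT.
apply/negP => h; have /negP := g0 k (mem_head _ _); apply; apply/eqP.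
rewrite -(prj_id (map n (k :: s)) (hg k)); move: (g k) h.
apply: span_ind; first exact: act0.
- by move=> a u v hu hv; rewrite actD actZ hu hv scaler0 addr0.
move=> x /mapP [j js ->]; apply: prj_kill (hg j).
  by rewrite (inj_eq ni); apply: contraNneq ks => <-.
by apply/mapP; exists j; rewrite // inE js orbT.
Qed.

Section WeylHead.
Variables (i : nat) (D : LUmod q) (d0 : D).
Hypothesis hD : hw i (fun k => k <= i)%N d0.

Let bad := <<[seq LF k ∙ d0 | k <- iota 0 i.+1 & ~~ good i k]>>%VS.

Let badF k : ~~ good i k -> LF k ∙ d0 \in bad.
Proof.
move=> bk; have [ki|ik] := leqP k i; last by rewrite (hw_van hD) ?mem0v // -ltnNge.
by apply: memv_span; apply/mapP; exists k => //; rewrite mem_filter bk mem_iota add0n ltnS.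
Qed.

(** Wherever E^(n) or F^(n) would lead from a bad index to a good one, the structure constant is a
    Gaussian binomial that vanishes at q. *)
Let bad_sub : submodule bad.
Proof.
have l0 := ltnW hl.
have B0 : 0 \in bad by exact: mem0v.
have BD a u v : u \in bad -> v \in bad -> a *: u + v \in bad.
  by move=> hu hv; rewrite memvD // memvZ.
have step x : (forall k, (k <= i)%N -> (i %% l < k %% l)%N -> ~~ good i k ->
    x ∙ (LF k ∙ d0) \in bad) -> forall v, v \in bad -> x ∙ v \in bad.
  move=> hx; apply: span_ind; first by rewrite act0.
    by move=> a u w hu hw; rewrite actD actZ BD.
  move=> y /mapP [k]; rewrite mem_filter mem_iota add0n ltnS => /andP[bk /= ki] ->.
  by apply: hx => //; rewrite ltnNge; apply: contra bk; rewrite /good ki.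
move=> x v; move: x v; apply: (LU_stable (S := fun v => v \in bad)) => // [||n|n];
  apply: step => k ki bk' bk.
- by rewrite (wt_F k (hw_prim hD).1).2 memvZ // badF.
- by rewrite (wt_Ki (wt_F k (hw_prim hD).1)) memvZ // badF.
- rewrite (LEF_prim _ _ (hw_prim hD)); case: ifP => // nk.
  have [gk|] := boolP (good i (k - n)); last by move=> /badF h; rewrite memvZ.
  have -> : i%:Z + n%:Z - k%:Z = (i - (k - n))%N%:Z by lia.
  move: gk => /andP[kni knm]; rewrite gb_nat qbinom_at_eq0 ?scale0r //.
  have := modnB l0 (leq_subr n k); rewrite subKn // ltnNge (leq_trans knm (ltnW bk')) /= => ->.
  rewrite (modnB l0 kni) [(i %% l < _)%N]ltnNge knm /= !mul0n !add0n.
  by apply: ltn_sub2r => //; exact: leq_ltn_trans knm bk'.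
- rewrite LFM; have [gk|] := boolP (good i (n + k)); last by move=> /badF h; rewrite memvZ.
  move: gk => /andP[kni knm]; rewrite qbinom_at_eq0 ?scale0r //.
  have kl : (k %% l < l)%N by rewrite ltn_mod.
  have := modnB l0 (leq_addl n k); rewrite addnK (leq_ltn_trans knm bk') mul1n => ->.
  by move: ((n + k) %% l)%N (k %% l)%N kl => a b; clear; lia.
Qed.

Let d0b : d0 \notin bad.
Proof.
have hW := hw_weighted hD; set ws := map _ _ in hW.
have prjb v' : v' \in bad -> prj ws i%:Z ∙ v' = 0.
  move: v'; apply: span_ind; first exact: act0.
    by move=> a u w hu hw; rewrite actD actZ hu hw scaler0 addr0.
  move=> x /mapP [k]; rewrite mem_filter => /andP[bk ki] ->.
  apply: prj_kill (wt_F k (hw_prim hD).1); last first.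
    apply/mapP; exists k => //; rewrite mem_filter ki andbT.
    by move: ki; rewrite mem_iota add0n ltnS.
  by apply: contraNneq bk => e; have -> : k = 0%N by [lia]; exact: good0.
apply/negP => /prjb; rewrite (prj_id _ (hw_prim hD).1) => e.
by have := hw_neq0 hD (leq0n i); rewrite LF0 e eqxx.
Qed.

(** A weight vector with good index k is sent by E^(k) to a nonzero multiple of d0. So every
    submodule without d0 lies in [bad], which is the unique maximal submodule. *)
Lemma weyl_rad v : in_rad v <-> v \in bad.
Proof.
have hW := hw_weighted hD; set ws := map _ _ in hW.
have sub_bad N : submodule N -> d0 \notin N -> (N <= bad)%VS.
  move=> sN nN; apply/subvP => x xN; rewrite (sum_prj hW x); apply: memv_suml => n _.
  have := sN (prj ws n) x xN; have := wt_prj hW n x; set y := _ ∙ x => hy yN.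
  have [->|y0] := eqVneq y 0; first exact: mem0v.
  have [k [c _ [_ ey]]] := hw_wtv hD hy y0.
  have [gk|/badF] := boolP (good i k); last by rewrite ey => h; rewrite memvZ.
  have := sN (LE k) y yN; rewrite ey actZ (LEF_prim _ _ (hw_prim hD)) leqnn addrK subnn LF0 scalerA.
  move=> h; case/negP: nN; rewrite -(scale1r d0).
  have c0 : c * gb i%:Z k != 0.
    by rewrite mulf_neq0 ?gb_good //; apply: contraNneq y0 => c0; rewrite ey c0 scale0r.
  by rewrite -(mulVf c0) -scalerA memvZ.
have bmax : maximal_submodule bad.
  split; [exact: bad_sub|by move=> e; move: d0b; rewrite e memvf|move=> N sN bN].
  have [dN|dN] := boolP (d0 \in N); first by right; exact: (hw_full hD).
  by left; apply/eqP; rewrite eqEsubv bN sub_bad.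
split=> [|vb N [sN nN mN]]; first exact.
have dN : d0 \notin N by apply/negP => dN; apply: nN; exact: (hw_full hD).
have [e|e] := mN bad bad_sub (sub_bad _ sN dN); first by rewrite -e.
by move: d0b; rewrite e memvf.
Qed.

Lemma weyl_rad_F k : in_rad (LF k ∙ d0) <-> ~~ good i k.
Proof.
split=> [h|/badF /weyl_rad //]; apply/negP => gk.
have := bad_sub (LE k) (iffLR (weyl_rad _) h).
rewrite (LEF_prim _ _ (hw_prim hD)) leqnn addrK subnn LF0 => h1.
by case/negP: d0b; rewrite -(scale1r d0) -(mulVf (gb_good gk)) -scalerA memvZ.
Qed.

End WeylHead.

Lemma is_Lq_hw i (V : LUmod q) : is_Lq i V -> exists v0 : V, hw i (good i) v0.
Proof.
move=> [D /weyl_hw [d0 hD] [f [hf sf kf]]].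
exists (f d0); have F k : f (LF k ∙ d0) = LF k ∙ f d0 by rewrite hf.
have F0 k : LF k ∙ f d0 = 0 <-> ~~ good i k.
  by rewrite -F; split=> [/kf /(weyl_rad_F hD)|/(weyl_rad_F hD) /kf].
have [[wH wK] pE] := hw_prim hD.
have wf : wt i%:Z (f d0) by split; rewrite -hf ?wH ?wK linearZ.
split.
- by split=> // k; rewrite -hf pE linear0.
- by move=> k /andP[].
- by move=> k /F0.
apply/andP; split; last first.
  apply: (free_wt (n := fun k => i%:Z - 2 * k%:Z)); first by rewrite filter_uniq ?iota_uniq.
  - by move=> a b; lia.
  - by move=> k; exact: wt_F.
  - by move=> k; rewrite mem_filter => /andP[gk _]; apply/eqP => /F0; rewrite gk.
apply/eqP/vspaceP => v; rewrite memvf; have [u <-] := sf v; elim/(hw_ind hD): u.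
- by rewrite linear0 mem0v.
- by move=> a u w hu hw; rewrite linearP memvD // memvZ.
move=> k ki; rewrite F; have [gk|/F0 ->] := boolP (good i k); last exact: mem0v.
by apply: memv_span; apply/mapP; exists k => //; rewrite mem_filter gk mem_iota add0n ltnS.
Qed.

Lemma prj_wt ws (V : LUmod q) n m (v : V) : weighted ws V -> wt m v ->
  prj ws n ∙ v = if m == n then v else 0.
Proof.
move=> hV hv; have [e|mn] := eqVneq m n; first by rewrite prj_id // -e.
have [mw|mw] := boolP (m \in ws); first exact: prj_kill hv.
by rewrite (wt_supp hV hv mw) act0.
Qed.

Inductive FE_span (V : LUmod q) (y : V) : V -> Prop :=
| FE_span0 : FE_span y 0
| FE_spanD a b c z : FE_span y z -> FE_span y (c *: (LF b ∙ (LE a ∙ y)) + z).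

Lemma FE_span_lin (V : LUmod q) (y : V) c u v :
  FE_span y u -> FE_span y v -> FE_span y (c *: u + v).
Proof.
move=> hu hv; elim: hu => [|a b d z _ ih]; first by rewrite scaler0 add0r.
by rewrite scalerDr scalerA -addrA; exact: FE_spanD.
Qed.

Lemma FE_span_term (V : LUmod q) (y : V) a b c : FE_span y (c *: (LF b ∙ (LE a ∙ y))).
Proof. by rewrite -[_ *: _]addr0; apply: FE_spanD; exact: FE_span0. Qed.

(** The commutation formula moves every E to the right of the F, and the torus contributes only
    scalars since y is a weight vector. *)
Lemma FE_span_act (V : LUmod q) n (y : V) x : wt n y -> FE_span y (x ∙ y).
Proof.
move=> hy.
have key x' : (forall a b, FE_span y (x' ∙ (LF b ∙ (LE a ∙ y)))) ->
    forall v, FE_span y v -> FE_span y (x' ∙ v).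
  move=> h v; elim=> [|a b c z _ ih]; first by rewrite act0; exact: FE_span0.
  by rewrite actD actZ; exact: FE_span_lin.
have FE0 := FE_span0 y.
have wy a b : wt (n + 2 * a%:Z - 2 * b%:Z) (LF b ∙ (LE a ∙ y)) by exact/wt_F/wt_E.
apply: (LU_stable (S := FE_span y)) => //.
- by move=> a u v; exact: FE_span_lin.
- by apply: key => a b; rewrite (wy a b).2; exact: FE_span_term.
- by apply: key => a b; rewrite (wt_Ki (wy a b)); exact: FE_span_term.
- move=> c; apply: key => a b; rewrite (LEF _ _ (wt_E a hy)).
  apply: big_ind => // [u v hu hv|j _]; first by rewrite -(scale1r u); exact: FE_span_lin.
  case: ifP => _; last by rewrite scaler0.
  by rewrite LEM actZ scalerA; exact: FE_span_term.
- by move=> c; apply: key => a b; rewrite LFM; exact: FE_span_term.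
- by have := FE_span_term y 0 0 1; rewrite scale1r LF0 LE0.
Qed.

Lemma seq_int_max (s : seq int) : s != [::] -> exists2 m, m \in s & {in s, forall k, (k <= m)%R}.
Proof.
elim: s => [|a s ih] // _; have [->|/ih [m ms hm]] := eqVneq s [::].
  by exists a; rewrite ?mem_head // => k; rewrite inE => /eqP ->.
have [am|ma] : (a <= m)%R \/ (m < a)%R by lia.
  by exists m; rewrite ?inE ?ms ?orbT // => k; rewrite inE => /orP[/eqP ->|/hm].
exists a; rewrite ?mem_head // => k; rewrite inE => /orP[/eqP -> //|/hm].
by move=> km; lia.
Qed.

Lemma max_proper_submodule (V : LUmod q) (N : {vspace V}) : submodule N -> N != 0%VS ->
  exists N' : {vspace V}, [/\ submodule N', (N' <= N)%VS, N' != N &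
    forall M : {vspace V}, submodule M -> (N' <= M)%VS -> (M <= N)%VS -> M = N' \/ M = N].
Proof.
move=> sN N0.
pose P d := `[< exists M : {vspace V}, [/\ submodule M, (M <= N)%VS, M != N & \dim M = d] >].
have P0 : exists d, P d.
  exists 0%N; apply/asboolP; exists 0%VS; split; rewrite ?sub0v ?dimv0 1?eq_sym //.
  by move=> x v; rewrite !memv0 => /eqP ->; rewrite act0.
have Pb d : P d -> (d <= \dim N)%N by move=> /asboolP [M [_ MN _ <-]]; exact: dimvS.
have [d /asboolP [N' [sN' N'N nN' dN']] dmax] := ex_maxnP P0 Pb.
exists N'; split=> // M sM N'M MN; have [->|nM] := eqVneq M N; first by right.
left; apply/eqP; rewrite eq_sym eqEdim N'M dN' /=; apply: dmax; apply/asboolP; by exists M.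
Qed.

(** * Lifting primitive vectors of Steinberg weight *)

Section Steinberg.
Variables (ws : seq int) (V : LUmod q).
Hypothesis hV : weighted ws V.

Section SimpleLayer.
Variables (N N' : {vspace V}).
Hypotheses (sN : submodule N) (sN' : submodule N') (N'N : (N' <= N)%VS).
Hypothesis N'max : forall M : {vspace V}, submodule M -> (N' <= M)%VS -> (M <= N)%VS ->
  M = N' \/ M = N.
Variables (mu : int) (ym : V).
Hypotheses (wym : wt mu ym) (ymN : ym \in N) (ymN' : ym \notin N').
Hypothesis high : forall n (z : V), (mu < n)%R -> wt n z -> z \in N -> z \in N'.

(** The vectors congruent to an element of U y modulo [N'] form a submodule of [N] larger than [N'];
    by maximality it is [N]. *)
Lemma layer_gen (y z : V) : y \in N -> y \notin N' -> z \in N ->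
  exists2 x, z - x ∙ y \in N' & True.
Proof.
move=> yN yN' zN.
have [M hM] : exists M : {vspace V}, forall v, v \in M <-> exists x, v - x ∙ y \in N'.
  apply: vspace_of_pred; first by exists 0; rewrite act0l subr0 mem0v.
  move=> a u v [x hx] [x' hx']; exists (a *: x + x').
  by rewrite actDl actZl opprD addrACA -scalerBr memvD // memvZ.
have [|||eM|eM] := N'max (M := M).
- move=> x v /hM [x' h]; apply/hM; exists (x * x'); rewrite LUactM -actB; exact: sN'.
- by apply/subvP => v vN'; apply/hM; exists 0; rewrite act0l subr0.
- apply/subvP => v /hM [x h]; rewrite -(subrK (x ∙ y) v) memvD ?sN //.
  exact: (subvP N'N).
- have : y \in M by apply/hM; exists 1; rewrite LUact1 subrr mem0v.
  by rewrite eM (negPf yN').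
- by move: zN; rewrite -eM => /hM [x h]; exists x.
Qed.

(** As y generates N/N', some F^(b) E^(a) y of weight [mu] lies outside [N']. If b > 0, then E^(a) y
    would have weight above [mu] and hence lie in [N']. *)
Lemma layer_raise n (y : V) : wt n y -> y \in N -> y \notin N' ->
  exists2 a : nat, n + 2 * a%:Z = mu & LE a ∙ y \notin N'.
Proof.
move=> hy yN yN'; apply: contrapT => H.
have {}H a : n + 2 * a%:Z = mu -> LE a ∙ y \in N'.
  by move=> e; apply: contraT => h; case: H; exists a.
have [x hx _] := layer_gen yN yN' ymN; case/negP: ymN'.
rewrite -(prj_id ws wym) -(subrK (x ∙ y) ym) actD memvD //; first exact: sN'.
elim: (FE_span_act x hy) => [|a b c z _ ih]; first by rewrite act0 mem0v.
rewrite actD actZ memvD // memvZ // (prj_wt _ hV (wt_F b (wt_E a hy))).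
case: eqP => [e|_]; last exact: mem0v.
case: b e => [|b] e; first by rewrite LF0; apply: H; move: e; clear; lia.
by apply/sN'/high; [|exact: wt_E hy|exact: sN]; move: e; clear; lia.
Qed.

(** The weight [mu] part of U ym is spanned by the F^(a) E^(a) ym, and for a > 0 the vector E^(a) ym
    lies above [mu], hence in [N']. *)
Lemma layer_top (z : V) : wt mu z -> z \in N -> exists c, z - c *: ym \in N'.
Proof.
move=> hz zN; have [x hx _] := layer_gen ymN ymN' zN.
have [c hc] : exists c, prj ws mu ∙ (x ∙ ym) - c *: ym \in N'.
  elim: (FE_span_act x wym) => [|a b c w _ [d hd]].
    by exists 0; rewrite act0 scale0r subr0 mem0v.
  rewrite actD actZ (prj_wt _ hV (wt_F b (wt_E a wym))); case: eqP => [e|_]; last first.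
    by exists d; rewrite scaler0 add0r.
  have -> : b = a by lia.
  case: a e => [|a] _.
    by exists (c + d); rewrite LE0 LF0 scalerDl opprD addrACA subrr add0r.
  exists d; rewrite -addrA memvD // memvZ // sN' //.
  by apply: (high (n := mu + 2 * a.+1%:Z)); [lia|exact: wt_E|exact: sN].
exists c; rewrite -(prj_id ws hz) -{1}(subrK (x ∙ ym) z) actD -addrA.
by rewrite memvD // sN'.
Qed.

(* With [mu = n + 2m] and [k < l] such that [l] divides [m + k], a multiple of *)
(* [F^(m+k) ym] corrects [F^(k) u] to a vector that [E^(m+k)] sends into [N']; *)
(* [E^(k)] brings it back to weight [n], as the q-binomial [[n; k]] is not 0. *)
Lemma layer_lift (n : nat) (u : V) : (n %% l)%N = l.-1 -> wt n%:Z u ->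
  (forall k, LE k.+1 ∙ u \in N) ->
  exists v, [/\ wt n%:Z v, v - u \in N & forall k, LE k.+1 ∙ v \in N'].
Proof.
move=> nl hu huN; have l0 := ltnW hl.
have [[m em m0]|nomu] := pselect (exists2 m, mu = n%:Z + 2 * m%:Z & (0 < m)%N); last first.
  exists u; split=> //; first by rewrite subrr mem0v.
  move=> k; apply: contraT => h.
  have [a ea _] := layer_raise (wt_E k.+1 hu) (huN k) h.
  by case: nomu; exists (k.+1 + a)%N; lia.
(* The least k with l dividing m + k; k <= l - 1 <= n because n has residue l - 1. *)
pose k := ((l - m %% l) %% l)%N.
have kl : (k < l)%N by rewrite ltn_mod.
have kn : (k <= n)%N.
  have := leq_mod n l; rewrite nl; lia.
have mk : ((m + k) %% l = 0)%N.
  rewrite /k modnDmr -modnDml addnC subnK ?modnn //; exact/ltnW/ltn_pmod.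
clearbody k; have EFu j : (k < j)%N -> LE j ∙ (LF k ∙ u) \in N.
  move=> kj; rewrite (LEF _ _ hu); apply: memv_suml => b _; apply: memvZ.
  case: ifP => bk; last exact: mem0v.
  have -> : (j - b = (j - b.+1).+1)%N by move: kj bk; clear; lia.
  exact/sN/huN.
have [c hc] : exists c, LE (m + k) ∙ (LF k ∙ u) - c *: ym \in N'.
  apply: layer_top; last by apply: EFu; lia.
  by have := wt_E (m + k) (wt_F k hu); congr wt; lia.
pose g := gb mu (m + k).
have g0 : g != 0.
  have -> : g = gb (n + 2 * m)%N%:Z (m + k) by rewrite /g em; congr gb; lia.
  by rewrite gb_nat qbinom_at_neq0 ?mk //; lia.
have EFy : LE (m + k) ∙ (LF (m + k) ∙ ym) - g *: ym \in N'.
  rewrite (LEF _ _ wym) big_ord_recr /= leqnn !subnn LE0 LF0 addrK -/g addrK.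
  apply: memv_suml => b _; apply: memvZ; case: ifP => _; last exact: mem0v.
  by apply/sN'/high; [|exact: wt_E wym|exact: sN]; have := ltn_ord b; clear; lia.
pose x := LF k ∙ u - (c / g) *: (LF (m + k) ∙ ym).
have wx : wt (n%:Z - 2 * k%:Z) x.
  apply: wtB; first exact: wt_F.
  by apply: wtZ; have := wt_F (m + k) wym; congr wt; rewrite em; clear; lia.
have Ex : LE (m + k) ∙ x \in N'.
  rewrite /x actB actZ.
  have -> : LE (m + k) ∙ (LF k ∙ u) - (c / g) *: (LE (m + k) ∙ (LF (m + k) ∙ ym)) =
    (LE (m + k) ∙ (LF k ∙ u) - c *: ym) - (c / g) *: (LE (m + k) ∙ (LF (m + k) ∙ ym) - g *: ym).
    by rewrite scalerBr scalerA divfK // opprB addrA subrK.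
  by rewrite memvB // memvZ.
have gn0 : gb n%:Z k != 0.
  rewrite gb_nat qbinom_at_neq0 // nl -ltnS prednK //; exact: ltn_pmod.
exists ((gb n%:Z k)^-1 *: (LE k ∙ x)); split.
- by apply: wtZ; have := wt_E k wx; congr wt; clear; lia.
- rewrite /x actB actZ scalerBr scalerA -addrA addrC -addrA.
  rewrite memvD //; first by rewrite -scaleNr memvZ // sN // sN.
  rewrite addrC (LEF _ _ hu) big_ord_recr /= leqnn !subnn LE0 LF0 addrK scalerDr scalerA mulVf //.
  rewrite scale1r addrK memvZ //; apply: memv_suml => b _; apply: memvZ.
  case: ifP => bk; last exact: mem0v.
  have -> : (k - b = (k - b.+1).+1)%N by rewrite subnSK.
  exact/sN/huN.
move=> j; rewrite actZ memvZ // LEM memvZ //.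
have wz := wt_E (j.+1 + k) wx.
have zN : LE (j.+1 + k) ∙ x \in N.
  rewrite /x actB memvB ?EFu //; first by rewrite addSn ltnS leq_addl.
  by rewrite actZ memvZ // sN // sN.
apply: contraT => /(layer_raise wz zN) [a ea].
rewrite LEM; have -> : (a + (j.+1 + k) = m + k)%N by move: ea; rewrite em; clear; lia.
by rewrite memvZ.
Qed.

End SimpleLayer.

(** Induction on dim N: [layer_lift] changes u by an element of [N] so that all E^(k+1) u fall into
    a maximal proper submodule of [N]. *)
Lemma steinberg_lift (n : nat) (N : {vspace V}) (u : V) : (n %% l)%N = l.-1 -> submodule N ->
  wt n%:Z u -> (forall k, LE k.+1 ∙ u \in N) ->
  exists2 v, prim n%:Z v & v - u \in N.
Proof.
move=> nl; have [d dN] := ubnP (\dim N); elim: d N dN u => // d ih N dN u sN hu huN.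
have [N0|N0] := eqVneq N 0%VS.
  exists u; last by rewrite subrr mem0v.
  by split=> // k; apply/eqP; rewrite -memv0 -N0.
have [N' [sN' N'N nN' N'max]] := max_proper_submodule sN N0.
have dN' : (\dim N' < \dim N)%N.
  by rewrite ltnNge; apply: contra nN' => h; rewrite eqEdim N'N.
pose P n := `[< exists z : V, [/\ wt n z, z \in N & z \notin N'] >].
(* [mu] is the highest weight of N/N'; if no weight occurred, all weight components of vectors of
   [N] would lie in [N']. *)
have [mu muw hmu] : exists2 mu, mu \in filter P ws & {in filter P ws, forall k, (k <= mu)%R}.
  apply: seq_int_max; apply: contra nN' => /eqP e; rewrite eqEsubv N'N /=.
  apply/subvP => z zN; rewrite (sum_prj hV z) big_seq; apply: memv_suml => k kw.
  apply: contraT => h; have : k \in filter P ws; last by rewrite e.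
  rewrite mem_filter kw andbT; apply/asboolP; exists (prj ws k ∙ z); split=> //.
  - exact: wt_prj.
  - exact: sN.
move: (muw); rewrite mem_filter => /andP[/asboolP [ym [wym ymN ymN']] _].
have high k z : (mu < k)%R -> wt k z -> z \in N -> z \in N'.
  move=> mk hz zN; apply: contraT => zN'.
  have kw : k \in ws by apply: contraNT zN' => kw; rewrite (wt_supp hV hz kw) mem0v.
  have : k \in filter P ws by rewrite mem_filter kw andbT; apply/asboolP; exists z.
  by move/hmu; move: mk; clear; lia.
have [v1 [wv1 v1u hv1]] := layer_lift sN sN' N'N N'max wym ymN ymN' high nl hu huN.
have [|v pv vv1] := ih N' _ v1 sN' wv1 hv1; first by exact: leq_trans dN' _.
exists v => //; rewrite -(subrK v1 v) -addrA memvD //; exact: (subvP N'N).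
Qed.

End Steinberg.

(** * Tensoring with L(1) *)

Section Mx2.
Variable B : pzRingType.
Implicit Types a b c d : B.

Definition mx2 a b c d : 'M[B]_2 :=
  \matrix_(i, j) if i == 0 then (if j == 0 then a else b) else (if j == 0 then c else d).

Lemma mx2P (A A' : 'M[B]_2) : A 0 0 = A' 0 0 -> A 0 1 = A' 0 1 -> A 1 0 = A' 1 0 ->
  A 1 1 = A' 1 1 -> A = A'.
Proof.
move=> h00 h01 h10 h11; apply/matrixP => i j.
have o (k : 'I_2) : k = 0 \/ k = 1.
  by case: k => [[|[|k]] hk] //; [left|right]; exact/val_inj.
by case: (o i) => ->; case: (o j) => ->.
Qed.

Lemma mx2M a b c d a' b' c' d' : mx2 a b c d * mx2 a' b' c' d' =
  mx2 (a * a' + b * c') (a * b' + b * d') (c * a' + d * c') (c * b' + d * d').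
Proof. by apply: mx2P; rewrite !mxE !big_ord_recl big_ord0 !mxE /= addr0. Qed.

Lemma mx2D a b c d a' b' c' d' : mx2 a b c d + mx2 a' b' c' d' =
  mx2 (a + a') (b + b') (c + c') (d + d').
Proof. by apply: mx2P; rewrite !mxE. Qed.

Lemma mx2_1 : mx2 1 0 0 1 = 1.
Proof. by apply: mx2P; rewrite !mxE. Qed.
End Mx2.

Definition cop_gen (x : Ut_generator) : 'M[Ut]_2 :=
  match x with
  | GenE => mx2 Ut_E Ut_Ki 0 Ut_E
  | GenF => mx2 (qt *: Ut_F) 0 1 (qt^-1 *: Ut_F)
  | GenK => mx2 (qt *: Ut_K) 0 0 (qt^-1 *: Ut_K)
  | GenKi => mx2 (qt^-1 *: Ut_Ki) 0 0 (qt *: Ut_Ki)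
  end.

Definition cop_scal (c : Qt) : 'M[Ut]_2 := mx2 (c *: (1 : Ut)) 0 0 (c *: (1 : Ut)).

(* The coproduct followed by the two-dimensional representation of [U_t] in *)
(* the second factor. *)
Definition cop : Ut -> 'M[Ut]_2 := pa_lift cop_scal cop_gen.

Let UtZ := (Ut_scalerAl, Ut_scalerAr).

Lemma cop_scalC c x : cop_scal c * x = x * cop_scal c.
Proof.
have -> : x = mx2 (x 0 0) (x 0 1) (x 1 0) (x 1 1) by apply: mx2P; rewrite !mxE.
by rewrite !mx2M !(mul0r, mulr0, addr0, add0r) !UtZ !(mul1r, mulr1).
Qed.

Lemma cop_scal1 : cop_scal 1 = 1. Proof. by rewrite /cop_scal scale1r mx2_1. Qed.
Lemma cop_scalD : {morph cop_scal : x y / x + y}.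
Proof. by move=> x y; rewrite /cop_scal mx2D !addr0 !scalerDl. Qed.
Lemma cop_scalM : {morph cop_scal : x y / x * y}.
Proof. by move=> x y; rewrite /cop_scal mx2M !(mul0r, mulr0, addr0, add0r) UtZ mul1r scalerA. Qed.

Lemma Ut_rel_KiF : Ut_Ki * Ut_F = qt ^ 2 *: (Ut_F * Ut_Ki).
Proof.
have e : Ut_F * Ut_Ki = qt ^ (-2) *: (Ut_Ki * Ut_F).
  have := congr1 (fun y => Ut_Ki * y * Ut_Ki) Ut_rel_KF; rewrite /= !UtZ.
  by rewrite -!mulrA Ut_rel_KKi mulr1 !mulrA Ut_rel_KiK mul1r.
by rewrite e scalerA -qtzD expr0z scale1r.
Qed.

Lemma Ut_rel_KiE : Ut_Ki * Ut_E = qt ^ (-2) *: (Ut_E * Ut_Ki).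
Proof.
have e : Ut_E * Ut_Ki = qt ^ 2 *: (Ut_Ki * Ut_E).
  have := congr1 (fun y => Ut_Ki * y * Ut_Ki) Ut_rel_KE; rewrite /= !UtZ.
  by rewrite -!mulrA Ut_rel_KKi mulr1 !mulrA Ut_rel_KiK mul1r.
by rewrite e scalerA -qtzD expr0z scale1r.
Qed.

Lemma cop_rels a b : Ut_rel a b -> pa_eval cop_scal cop_gen a = pa_eval cop_scal cop_gen b.
Proof.
have qq : qt * qt^-1 = 1 by exact: divff qt_neq0.
have qq' : qt^-1 * qt = 1 by exact: mulVf qt_neq0.
have KE : Ut_K * Ut_E * Ut_Ki = qt ^ 2 *: Ut_E by rewrite Ut_rel_KE UtZ -mulrA Ut_rel_KKi mulr1.
have KF : Ut_K * Ut_F * Ut_Ki = qt ^ (-2) *: Ut_F by rewrite Ut_rel_KF UtZ -mulrA Ut_rel_KKi mulr1.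
case=> /=; rewrite ?mx2_1; rewrite /cop_scal !(mx2M, mx2D) !(mul0r, mulr0, addr0, add0r).
- rewrite !UtZ !scalerA qq qq' !scale1r !mul1r KE Ut_rel_KKi mul1r.
  by rewrite -expr2.
- rewrite !mulr1 !UtZ !scalerA KF Ut_rel_KKi !mul1r !scalerA.
  by rewrite qq qq' !mul1r -invfM -expr2 ![_ * qt ^ (-2)]mulrC.
- by rewrite !UtZ !scalerA qq qq' !scale1r Ut_rel_KKi.
- by rewrite !UtZ !scalerA qq qq' !scale1r Ut_rel_KiK.
- rewrite !UtZ !mul1r !mulr1 !scalerA; congr (mx2 _ _ _ _).
  + exact: cop_EF1 Ut_rel_EF.
  + rewrite Ut_rel_KiF scalerA -scalerDl.
    have -> : qt^-1 * qt ^ 2 + -1 * qt = 0 :> Qt.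
      by rewrite [qt ^ 2]expr2 mulrA qq' mul1r mulN1r subrr.
    by rewrite scale0r scaler0.
  + by rewrite scaleN1r subrr scaler0.
  + exact: cop_EF2 Ut_rel_EF.
Qed.

Lemma cop1 : cop 1 = 1. Proof. exact: pa_lift1 cop_scal1 cop_scalD cop_scalM cop_scalC cop_rels. Qed.
Lemma copD : {morph cop : x y / x + y}.
Proof. exact: pa_liftD cop_scal1 cop_scalD cop_scalM cop_scalC cop_rels. Qed.
Lemma copM : {morph cop : x y / x * y}.
Proof. exact: pa_liftM cop_scal1 cop_scalD cop_scalM cop_scalC cop_rels. Qed.
Lemma copZ c x : cop (c *: x) = cop_scal c * cop x.
Proof. exact: (pa_liftZ cop_scal1 cop_scalD cop_scalM cop_scalC cop_rels). Qed.
Lemma cop_g x : cop (pa_gen Ut_rel x) = cop_gen x.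
Proof. exact: (pa_lift_gen cop_scal1 cop_scalD cop_scalM cop_scalC cop_rels). Qed.

Lemma cop_scal_mx2 k a b c d : cop_scal k * mx2 a b c d = mx2 (k *: a) (k *: b) (k *: c) (k *: d).
Proof. by rewrite mx2M !(mul0r, addr0, add0r) !UtZ !mul1r. Qed.

Lemma cop_K : cop Ut_K = mx2 (qt *: Ut_K) 0 0 (qt^-1 *: Ut_K). Proof. exact: cop_g. Qed.
Lemma cop_Ki : cop Ut_Ki = mx2 (qt^-1 *: Ut_Ki) 0 0 (qt *: Ut_Ki). Proof. exact: cop_g. Qed.

Lemma qint1 : qint 1 = 1.
Proof. by rewrite qintE; exact: divff (qden_neq0 q0 hl hq). Qed.

Lemma cop_En n : cop (Ut_E ^+ n) =
  mx2 (Ut_E ^+ n) ((qt ^ (1 - n%:Z) * qint n%:Z) *: (Ut_E ^+ n.-1 * Ut_Ki)) 0 (Ut_E ^+ n).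
Proof.
elim: n => [|n ih]; first by rewrite qint0 mulr0 scale0r mx2_1 cop1.
rewrite exprSr copM ih [cop Ut_E]cop_g /= mx2M !(mul0r, mulr0, addr0, add0r) -!exprSr.
congr (mx2 _ _ _ _); rewrite UtZ -[_ * Ut_Ki * Ut_E]mulrA Ut_rel_KiE UtZ scalerA mulrA.
case: n {ih} => [|n].
  by rewrite qint0 mulr0 mul0r scale0r addr0 subrr expr0z mul1r qint1 scale1r.
rewrite -exprSr -{1}[Ut_E ^+ n.+1 * _]scale1r -scalerDl; congr (_ *: _).
rewrite (intS n.+1) (qint_add q0 hl hq) qint1 mulr1 mulrDr mulrA -!qtzD mulrAC -qtzD addrC.
by congr (qt ^ _ * _ + _); [rewrite intS; ring|rewrite -[1](expr0z qt); congr (qt ^ _); ring].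
Qed.

Lemma cop_Fn n : cop (Ut_F ^+ n) =
  mx2 (qt ^ n%:Z *: Ut_F ^+ n) 0 (qint n%:Z *: Ut_F ^+ n.-1) (qt ^ (- n%:Z) *: Ut_F ^+ n).
Proof.
elim: n => [|n ih]; first by rewrite qint0 scale0r oppr0 expr0z scale1r mx2_1 cop1.
rewrite exprSr copM ih [cop Ut_F]cop_g /= mx2M !(mul0r, mulr0, addr0, add0r).
rewrite !UtZ !scalerA -!exprSr mulr1; congr mx2.
- rewrite (intS n) [1 + n%:Z]addrC (qint_add q0 hl hq) qint1 mulr1 scalerDl addrC.
  congr (_ + _); case: n {ih} => [|n] /=; last by rewrite mulrC.
  by rewrite qint0 mulr0 mul0r !scale0r.
- by congr (_ *: _); rewrite -[qt^-1]/(qt ^ (-1)) -qtzD; congr (qt ^ _); rewrite intS; ring.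
Qed.

Lemma cop_E n : cop (Ut_Ediv n.+1) =
  mx2 (Ut_Ediv n.+1) (qt ^ (- n%:Z) *: (Ut_Ediv n * Ut_Ki)) 0 (Ut_Ediv n.+1).
Proof.
rewrite copZ cop_En cop_scal_mx2 scaler0; congr (mx2 _ _ _ _).
rewrite /Ut_Ediv UtZ !scalerA; congr (_ *: _).
have -> : (1 - n.+1%:Z) = - n%:Z by rewrite intS; ring.
rewrite mulrCA qfactS qnumE inv_cancel // -qnumE; exact: qnum_neq0 q0 hl hq n.
Qed.

Lemma cop_F n : cop (Ut_Fdiv n.+1) =
  mx2 (qt ^ n.+1%:Z *: Ut_Fdiv n.+1) 0 (Ut_Fdiv n) (qt ^ (- n.+1%:Z) *: Ut_Fdiv n.+1).
Proof.
rewrite copZ cop_Fn cop_scal_mx2 scaler0 /Ut_Fdiv !scalerA.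
congr mx2; [by rewrite mulrC| |by rewrite mulrC]; congr (_ *: _).
rewrite qfactS qnumE inv_cancel // -qnumE; exact: qnum_neq0 q0 hl hq n.
Qed.

Definition mxUres (A : 'M[Ut]_2) := forall i j, Ures (A i j).

Lemma mxUres2 a b c d : Ures a -> Ures b -> Ures c -> Ures d -> mxUres (mx2 a b c d).
Proof. by move=> *; move=> i j; rewrite mxE; do 2 case: ifP => _. Qed.

Lemma Ures0 : Ures 0.
Proof. by have [_ /(_ _ Ures_one) []] := good_scalar0 q; rewrite scale0r. Qed.

Lemma laurentZ_qtz (n : int) x : Ures x -> Ures (qt ^ n *: x).
Proof.
have h (m : nat) (c : Qt) y : laurentZ c -> Ures y -> Ures (c ^+ m *: y).
  move=> hc; elim: m y => [|m ih] y hy; first by rewrite scale1r.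
  by rewrite exprS -scalerA; apply: Ures_scale hc (ih _ hy).
case: n => n; first exact: h laurentZ_qt.
by rewrite NegzE -exprnN -exprVn; exact: h laurentZ_qtV.
Qed.

(** By the explicit matrices [cop_E] and [cop_F] of the divided powers. It allows the entries to be
    specialized, giving [lcop]. *)
Lemma cop_Ures x : Ures x -> mxUres (cop x).
Proof.
have U0 := Ures0; have U1 := Ures_one.
elim=> {x}.
- by rewrite cop1 -mx2_1; exact: mxUres2.
- by rewrite cop_K; apply: mxUres2 => //; apply: Ures_scale Ures_K;
    [exact: laurentZ_qt|exact: laurentZ_qtV].
- by rewrite cop_Ki; apply: mxUres2 => //; apply: Ures_scale Ures_Ki;
    [exact: laurentZ_qtV|exact: laurentZ_qt].
- case=> [|n].
    by rewrite /Ut_Ediv qfact0 invr1 scale1r expr0 cop1 -mx2_1; exact: mxUres2.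
  rewrite cop_E; apply: mxUres2 => //; [exact: Ures_E| |exact: Ures_E].
  by apply/laurentZ_qtz/Ures_mul; [exact: Ures_E|exact: Ures_Ki].
- case=> [|n].
    by rewrite /Ut_Fdiv qfact0 invr1 scale1r expr0 cop1 -mx2_1; exact: mxUres2.
  by rewrite cop_F; apply: mxUres2 => //; [|exact: Ures_F|]; apply/laurentZ_qtz/Ures_F.
- by move=> x y _ hx _ hy i j; rewrite copD mxE; exact: Ures_add.
- move=> x y _ hx _ hy i j; rewrite copM mxE !big_ord_recl big_ord0 addr0.
  by apply: Ures_add; exact: Ures_mul.
- move=> c x hc _ hx i j; rewrite copZ.
  have -> : cop x = mx2 (cop x 0 0) (cop x 0 1) (cop x 1 0) (cop x 1 1) by apply: mx2P; rewrite !mxE.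
  by rewrite cop_scal_mx2; move: i j; apply: mxUres2; exact: Ures_scale hc _.
Qed.

Local Notation lu := (LU_of q).

Definition lcop_gen (x : Ures_type) : 'M[LU q]_2 := map_mx lu (cop (sval x)).
Definition lcop_scal (c : R[i]) : 'M[LU q]_2 := mx2 (c *: (1 : LU q)) 0 0 (c *: (1 : LU q)).
Definition lcop : LU q -> 'M[LU q]_2 := pa_lift lcop_scal lcop_gen.

Let LUZl (c : R[i]) (x y : LU q) : (c *: x) * y = c *: (x * y).
Proof. exact/esym/pa_scalerAl. Qed.
Let LUZr (c : R[i]) (x y : LU q) : x * (c *: y) = c *: (x * y).
Proof. exact/esym/pa_scalerAr. Qed.
Let LUZ := (LUZl, LUZr).

Lemma lcop_scal_mx2 k a b c d : lcop_scal k * mx2 a b c d = mx2 (k *: a) (k *: b) (k *: c) (k *: d).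
Proof. by rewrite mx2M !(mul0r, addr0, add0r) !LUZ !mul1r. Qed.

Lemma mx2_eta (B : pzRingType) (A : 'M[B]_2) : A = mx2 (A 0 0) (A 0 1) (A 1 0) (A 1 1).
Proof. by apply: mx2P; rewrite !mxE. Qed.

Lemma lcop_scalC c x : lcop_scal c * x = x * lcop_scal c.
Proof.
rewrite (mx2_eta x) lcop_scal_mx2 mx2M !(mulr0, addr0, add0r) !LUZ !mulr1.
by [].
Qed.
Lemma lcop_scal1 : lcop_scal 1 = 1. Proof. by rewrite /lcop_scal scale1r mx2_1. Qed.
Lemma lcop_scalD : {morph lcop_scal : x y / x + y}.
Proof. by move=> x y; rewrite /lcop_scal mx2D !addr0 !scalerDl. Qed.
Lemma lcop_scalM : {morph lcop_scal : x y / x * y}.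
Proof. by move=> x y; rewrite {2}/lcop_scal lcop_scal_mx2 !scaler0 !scalerA. Qed.

Lemma lcop_rels a b : LU_rel q a b -> pa_eval lcop_scal lcop_gen a = pa_eval lcop_scal lcop_gen b.
Proof.
have l0 : lu 0 = 0 by have [_ /(_ _ Ures_one) []] := good_scalar0 q; rewrite !scale0r.
case=> {a b} /=.
- move=> x ex; rewrite /lcop_gen ex cop1 -mx2_1 lcop_scal1 -mx2_1.
  by apply: mx2P; rewrite !mxE /= ?l0 ?LU_of1.
- move=> x y z ez; rewrite /lcop_gen ez copD; apply/matrixP => i j; rewrite !mxE.
  by apply: LU_ofD; apply: cop_Ures; exact: (svalP).
- move=> x y z ez; rewrite /lcop_gen ez copM; apply/matrixP => i j; rewrite !mxE.
  have hx := cop_Ures (svalP x); have hy := cop_Ures (svalP y).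
  rewrite !big_ord_recl !big_ord0 !addr0 LU_ofD; try exact: Ures_mul.
  by rewrite !LU_ofM // !mxE.
- move=> x z ez; rewrite /lcop_gen ez copZ.
  have hx := cop_Ures (svalP x).
  rewrite (mx2_eta (cop (sval x))) cop_scal_mx2 (mx2_eta (map_mx _ (mx2 _ _ _ _))).
  rewrite [X in _ = _ * X]mx2_eta lcop_scal_mx2; congr (mx2 _ _ _ _); rewrite !mxE /=; exact: LU_of_qt.
Qed.

Lemma lcop1 : lcop 1 = 1. Proof. exact: pa_lift1 lcop_scal1 lcop_scalD lcop_scalM lcop_scalC lcop_rels. Qed.
Lemma lcopD : {morph lcop : x y / x + y}.
Proof. exact: pa_liftD lcop_scal1 lcop_scalD lcop_scalM lcop_scalC lcop_rels. Qed.
Lemma lcopM : {morph lcop : x y / x * y}.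
Proof. exact: pa_liftM lcop_scal1 lcop_scalD lcop_scalM lcop_scalC lcop_rels. Qed.
Lemma lcopZ c x : lcop (c *: x) = lcop_scal c * lcop x.
Proof. exact: (pa_liftZ lcop_scal1 lcop_scalD lcop_scalM lcop_scalC lcop_rels). Qed.
Lemma lcop_of x : Ures x -> lcop (lu x) = map_mx lu (cop x).
Proof.
move=> hx; rewrite (LU_of_gen q hx).
exact: (pa_lift_gen lcop_scal1 lcop_scalD lcop_scalM lcop_scalC lcop_rels).
Qed.

Section TensorL1.
Variable V : LUmod q.

Definition TL_act (x : LU q) (u : V * V) : V * V :=
  (lcop x 0 0 ∙ u.1 + lcop x 0 1 ∙ u.2, lcop x 1 0 ∙ u.1 + lcop x 1 1 ∙ u.2).

Fact TL_act_linear x : linear (TL_act x).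
Proof.
move=> a u v; rewrite /TL_act /= !actD !actZ; congr pair;
  by rewrite /= scalerDr; exact: addrACA.
Qed.

Fact TL_act_linearl u (a : R[i]) (x y : LU q) :
  TL_act (a *: x + y) u = a *: TL_act x u + TL_act y u.
Proof.
rewrite /TL_act lcopD lcopZ (mx2_eta (lcop x)) lcop_scal_mx2 !mxE /=.
by congr pair; rewrite /= !actDl !actZl scalerDr; exact: addrACA.
Qed.

Fact TL_act1 u : TL_act 1 u = u.
Proof.
by rewrite /TL_act lcop1 !mxE /= !LUact1 !act0l addr0 add0r; case: u.
Qed.

Fact TL_actM x y u : TL_act (x * y) u = TL_act x (TL_act y u).
Proof.
rewrite /TL_act lcopM !mxE !big_ord_recl !big_ord0 !addr0 /=.
have -> : lift ord0 ord0 = 1 :> 'I_2 by exact/val_inj.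
by congr pair; rewrite !actDl !actD !LUactM; exact: addrACA.
Qed.

(* [V (x) L(1)]: the pair [(u, v)] stands for [u (x) m_0 + v (x) m_1]. *)
Definition TL : LUmod q := @LUMod R q (V * V)%type TL_act
  TL_act_linear TL_act_linearl TL_act1 TL_actM.

Lemma TL_of x a b c d (u v : V) : Ures x -> cop x = mx2 a b c d ->
  LUact (l := TL) (lu x) (u, v) = (lu a ∙ u + lu b ∙ v, lu c ∙ u + lu d ∙ v).
Proof. by move=> hx e; rewrite /= /TL_act lcop_of // e !mxE. Qed.

Let lu0 : lu 0 = 0.
Proof. by have [_ /(_ _ Ures_one) []] := good_scalar0 q; rewrite !scale0r. Qed.

Lemma lu_qtz n x : Ures x -> lu (qt ^ n *: x) = q ^ n *: lu x.
Proof.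
move=> hx; apply: (spr_uniq (spr_of q (laurentZ_qtz n hx))).
exact: sprZ (vat_qtz q0 n) (spr_of q hx).
Qed.

Lemma TL_K (u v : V) : LK ∙ ((u, v) : TL) = (q *: (LK ∙ u), q^-1 *: (LK ∙ v)).
Proof.
rewrite (TL_of _ _ Ures_K cop_K) lu0 !act0l addr0 add0r.
rewrite -[qt in X in LUact X u]expr1z -[qt^-1 in X in LUact X v]/(qt ^ (-1)).
by rewrite !(lu_qtz _ Ures_K) !actZl expr1z.
Qed.

Lemma TL_Ki (u v : V) : LKi ∙ ((u, v) : TL) = (q^-1 *: (LKi ∙ u), q *: (LKi ∙ v)).
Proof.
rewrite (TL_of _ _ Ures_Ki cop_Ki) lu0 !act0l addr0 add0r.
rewrite -[qt in X in LUact X v]expr1z -[qt^-1 in X in LUact X u]/(qt ^ (-1)).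
by rewrite !(lu_qtz _ Ures_Ki) !actZl expr1z.
Qed.

Lemma TL_E n (u v : V) : LE n.+1 ∙ ((u, v) : TL) =
  (LE n.+1 ∙ u + q ^ (- n%:Z) *: (LE n ∙ (LKi ∙ v)), LE n.+1 ∙ v).
Proof.
rewrite (TL_of _ _ (Ures_E n.+1) (cop_E n)) lu0 !act0l add0r.
rewrite lu_qtz; last by apply: Ures_mul; [exact: Ures_E|exact: Ures_Ki].
by rewrite LU_ofM ?actZl ?LUactM //; [exact: Ures_E|exact: Ures_Ki].
Qed.

Lemma TL_F n (u v : V) : LF n.+1 ∙ ((u, v) : TL) =
  (q ^ n.+1%:Z *: (LF n.+1 ∙ u), LF n ∙ u + q ^ (- n.+1%:Z) *: (LF n.+1 ∙ v)).
Proof.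
rewrite (TL_of _ _ (Ures_F n.+1) (cop_F n)) lu0 !act0l addr0.
by rewrite !(lu_qtz _ (Ures_F n.+1)) !actZl.
Qed.

(** The coproduct replaces K by t K on the first coordinate and by t^-1 K on the second; through
    [scale_shift] and [vat_geoz] this turns [H] into H + 1 and H - 1. *)
Lemma TL_H (u v : V) : LH ∙ ((u, v) : TL) = (LH ∙ u + u, LH ∙ v - v).
Proof.
have [e ve e0] := vat_eps hl hq.
have ee : eps_q q l = e by apply: vat_lim; move: ve; rewrite /unif.
have qz m : q ^ (m * (2 * l)%N%:Z) = 1 by rewrite mulrC -exprz_exp -exprnP (q2l hq) exp1rz.
have P0 : Phi_t2 l != 0.
  have := aunit_neq0 (ex_intro2 _ _ e ve e0).
  by apply: contraNneq => ->; rewrite invr0 mulr0.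
have cK : cop ((Phi_t2 l)^-1 *: (Ut_K ^+ (2 * l) - 1)) =
  mx2 ((Phi_t2 l)^-1 *: (qt ^ (1 * (2 * l)%N%:Z) *: Ut_K ^+ (2 * l) - 1)) 0 0
      ((Phi_t2 l)^-1 *: (qt ^ (-1 * (2 * l)%N%:Z) *: Ut_K ^+ (2 * l) - 1)).
  have KX m : cop (Ut_K ^+ m) = mx2 (qt ^ (1 * m%:Z) *: Ut_K ^+ m) 0 0 (qt ^ (-1 * m%:Z) *: Ut_K ^+ m).
    elim: m => [|m ih]; first by rewrite cop1 !mulr0 !expr0z !scale1r mx2_1.
    rewrite exprSr copM ih cop_K mx2M !(mul0r, mulr0, addr0, add0r) !UtZ !scalerA.
    by congr mx2; congr (_ *: _); [rewrite -{2}[qt]expr1z|rewrite -[qt^-1]/(qt ^ (-1))];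
      rewrite -qtzD; congr (qt ^ _); rewrite intS; ring.
  rewrite copZ copD KX -scaleN1r copZ cop1 -mx2_1 cop_scal_mx2 !scaler0 mx2D !addr0.
  by rewrite cop_scal_mx2 !scaler0 !scaleN1r.
have sH m : spr ((Phi_t2 l)^-1 *: (qt ^ (m * (2 * l)%N%:Z) *: Ut_K ^+ (2 * l) - 1))
   (e *: (LH + m%:~R *: (1 : LU q))).
  have -> : (Phi_t2 l)^-1 *: (qt ^ (m * (2 * l)%N%:Z) *: Ut_K ^+ (2 * l) - 1) =
     (unif l / Phi_t2 l) *: (qt ^ (m * (2 * l)%N%:Z) *: tH l Ut_torus +
       ((qt ^ (m * (2 * l)%N%:Z) - 1) / unif l) *: (1 : Ut)).
    rewrite /tH Ut_torusE; have := scale_shift (qt ^ (m * (2 * l)%N%:Z)) (unif l)^-1 (Ut_K ^+ (2 * l)) 1.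
    move=> <-; rewrite scalerA; congr (_ *: _).
    by rewrite mulrAC (divff (unif_neq0 hl)) mul1r.
  apply: sprZ ve _; apply: sprD; last exact: sprZ (vat_geoz q0 hl hq m) spr_1.
  by have := sprZ (vat_qtz q0 (m * (2 * l)%N%:Z)) spr_H; rewrite qz scale1r.
have U := cop_Ures hU; rewrite cK in U.
rewrite /Defs.LH actZl (TL_of _ _ hU cK) lu0 !act0l addr0 add0r ee.
have U00 := U 0 0; have U11 := U 1 1; rewrite !mxE /= in U00 U11.
rewrite (spr_uniq (spr_of q U00) (sH 1)) (spr_uniq (spr_of q U11) (sH (-1))).
congr pair; rewrite /= !actZl scalerA mulVf // scale1r actDl actZl LUact1 /Defs.LH ee actZl.
  by rewrite scale1r.
by rewrite scaleN1r.
Qed.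

Lemma TL_wt1 n (u : V) : wt n u -> wt (n + 1) ((u, 0) : TL).
Proof.
have e c : c *: ((u, 0) : TL) = (c *: u, 0) by congr pair; exact: scaler0.
move=> [hH hK]; split; rewrite e.
  by rewrite TL_H hH act0 subr0 intrD scalerDl scale1r.
by rewrite TL_K hK act0 scaler0 scalerA mulrC -{1}[q in _ * q]expr1z -expfzDr.
Qed.

Lemma TL_wt2 n (v : V) : wt n v -> wt (n - 1) ((0, v) : TL).
Proof.
have e c : c *: ((0, v) : TL) = (0, c *: v) by congr pair; exact: scaler0.
move=> [hH hK]; split; rewrite e.
  by rewrite TL_H hH act0 addr0 intrB scalerBl scale1r.
by rewrite TL_K hK act0 scaler0 scalerA mulrC -[q^-1]/(q ^ (-1)) -expfzDr.
Qed.

Lemma TL_wt n (u v : V) : wt (n - 1) u -> wt (n + 1) v -> wt n ((u, v) : TL).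
Proof.
move=> hu hv; have -> : (u, v) = ((u, 0) : TL) + ((0, v) : TL) :> TL.
  by congr pair; rewrite ?addr0 ?add0r.
apply: wtD; first by have := TL_wt1 hu; rewrite subrK.
by have := TL_wt2 hv; rewrite addrK.
Qed.

Lemma TL_type_I : type_I l V -> type_I l TL.
Proof.
move=> /type_I_weighted [ws [uw hV]].
pose ws' := undup ([seq n + 1 | n <- ws] ++ [seq n - 1 | n <- ws]).
apply: (@weighted_type_I ws'); split; first exact: undup_uniq.
move=> [u v]; have [f hf eu] := hV u; have [g hg ev] := hV v.
have -> : (u, v) = \sum_(n <- ws) ((f n, 0) : TL) + \sum_(n <- ws) ((0, g n) : TL).
  rewrite -big_split /= eu ev; clear; elim: ws => [|n ws ih]; first by rewrite !big_nil.
  by rewrite !big_cons -ih; congr pair; rewrite /= ?addr0 ?add0r.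
apply: wsumD; rewrite big_seq; (apply: big_ind => [||n nw]; [exact: wsum0|exact: wsumD|]).
- apply: wsum_wt (TL_wt1 (hf n)); first exact: undup_uniq.
  by rewrite mem_undup mem_cat (map_f (fun n => n + 1) nw).
- apply: wsum_wt (TL_wt2 (hg n)); first exact: undup_uniq.
  by rewrite mem_undup mem_cat orbC (map_f (fun n => n - 1) nw).
Qed.

Lemma TL_E0 (u : V) n : LE n ∙ ((u, 0) : TL) = (LE n ∙ u, 0).
Proof. by case: n => [|n]; rewrite ?LE0 // TL_E !act0 scaler0 addr0. Qed.

Lemma TL_F0 (v : V) n : LF n ∙ ((0, v) : TL) = (0, q ^ (- n%:Z) *: (LF n ∙ v)).
Proof.
by case: n => [|n]; rewrite ?LF0 ?scale1r // TL_F !act0 scaler0 add0r.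
Qed.

Lemma TL_E2 n (w : TL) : (LE n ∙ w).2 = LE n ∙ w.2.
Proof. by case: n w => [|n] [u v]; rewrite ?LE0 // TL_E. Qed.

Lemma TL_F1 n (w : TL) : (LF n ∙ w).1 = q ^ n%:Z *: (LF n ∙ w.1).
Proof. by case: n w => [|n] [u v]; rewrite ?LF0 ?scale1r // TL_F. Qed.

Lemma TL_pD (a b c d : V) : ((a, b) : TL) + ((c, d) : TL) = (a + c, b + d).
Proof. by []. Qed.

Lemma TL_pZ k (a b : V) : k *: ((a, b) : TL) = (k *: a, k *: b).
Proof. by []. Qed.

End TensorL1.

Lemma TL_gen_hom (V W : LUmod q) (f : 'Hom(TL V, W)) :
  (forall u v, f (LK ∙ ((u, v) : TL V)) = LK ∙ f (u, v)) ->
  (forall n u v, f (LE n.+1 ∙ ((u, v) : TL V)) = LE n.+1 ∙ f (u, v)) ->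
  (forall n u v, f (LF n.+1 ∙ ((u, v) : TL V)) = LF n.+1 ∙ f (u, v)) -> LUhom f.
Proof.
move=> hK hE hF; apply: hom_gen => [[u v]|[|n] [u v]|[|n] [u v]]; by rewrite ?LE0 ?LF0.
Qed.

Lemma TL_map (V W : LUmod q) (g : 'Hom(V, W)) : LUhom g ->
  exists2 h : 'Hom(TL V, TL W), LUhom h & forall u v, h (u, v) = (g u, g v).
Proof.
move=> hg.
have lin : linear (fun u : TL V => ((g u.1, g u.2) : TL W)).
  by move=> a [u1 u2] [v1 v2]; congr pair; rewrite linearP.
have [h eh] := mk_lfun lin.
have ehp u v : h (u, v) = (g u, g v) by rewrite eh.
exists h => //; apply: TL_gen_hom => [u v|n u v|n u v].
- by rewrite !(ehp, TL_K) !linearZ /= !hg.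
- by rewrite !(ehp, TL_E) !linearD !linearZ /= !hg.
- by rewrite !(ehp, TL_F) !linearD !linearZ /= !hg.
Qed.

(** The formula is f applied after inserting the invariant vector m_0 (x) m_1 - q^-1 m_1 (x) m_0 of
    L(1) (x) L(1). *)
Lemma adj_left (V W : LUmod q) (f : 'Hom(TL V, W)) : LUhom f ->
  exists2 h : 'Hom(V, TL W), LUhom h & forall v, h v = (- q^-1 *: f (0, v), f (v, 0)).
Proof.
move=> hf.
have lin : linear (fun v : V => ((- q^-1 *: f (0, v), f (v, 0)) : TL W)).
  move=> a u v; congr pair.
    rewrite /= scalerA mulrC -scalerA -scalerDr -linearP; congr (_ *: f _).
    by rewrite TL_pZ TL_pD scaler0 addr0.
  by rewrite /= -linearP TL_pZ TL_pD scaler0 addr0.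
have [h eh] := mk_lfun lin.
have Z1 c v : c *: f (v, 0) = f (c *: v, 0).
  by rewrite -linearZ TL_pZ scaler0.
have Z2 c v : c *: f (0, v) = f (0, c *: v).
  by rewrite -linearZ TL_pZ scaler0.
have D12 u v : f (u, v) = f (u, 0) + f (0, v).
  by rewrite -linearD TL_pD addr0 add0r.
exists h => //; apply: hom_gen => [v|[|n] v|[|n] v]; rewrite ?LE0 ?LF0 // !eh.
- rewrite TL_K actZ -!hf !TL_K !act0 !scaler0 !Z2 !Z1 !scalerA.
  congr pair; [congr (f (0, _)); congr (_ *: _)|congr (f (_, 0))].
    by rewrite mulrAC divff // mul1r.
  by rewrite mulVf // scale1r.
- have eE : LE n.+1 ∙ f (0, v) = q ^ (- n%:Z) *: f (LE n ∙ (LKi ∙ v), 0) + f (0, LE n.+1 ∙ v).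
    by rewrite -hf TL_E act0 add0r D12 Z1.
  have eK : LE n ∙ (LKi ∙ f (v, 0)) = q^-1 *: f (LE n ∙ (LKi ∙ v), 0).
    by rewrite -!hf TL_Ki act0 scaler0 TL_E0 actZ Z1.
  rewrite TL_E actZ eE eK -hf TL_E0; congr pair.
  rewrite scalerDr !scalerA addrAC mulNr -[q^-1 * _]mulrC scaleNr.
  by rewrite scaleNr addNr add0r.
- have eF : LF n.+1 ∙ f (v, 0) = q ^ n.+1%:Z *: f (LF n.+1 ∙ v, 0) + f (0, LF n ∙ v).
    by rewrite -hf TL_F act0 scaler0 addr0 D12 Z1.
  have eG m : LF m ∙ f (0, v) = q ^ (- m%:Z) *: f (0, LF m ∙ v).
    by rewrite -hf TL_F0 Z2.
  rewrite TL_F !actZ eF !eG !scalerA; congr pair.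
    by congr (_ *: _); rewrite mulrAC -expfzDr // subrr mul1r.
  rewrite scalerDr scalerA -expfzDr // addNr scale1r addrC -addrA -scalerDl.
  have -> : q ^ (- n.+1%:Z) = q^-1 * q ^ (- n%:Z).
    by rewrite -[q^-1]/(q ^ (-1)) -expfzDr // intS opprD.
  by rewrite mulNr subrr scale0r addr0.
Qed.

(** The formula contracts with the invariant form on L(1) that takes m_1 (x) m_0 to 1, m_0 (x) m_1
    to -q and the other two basis tensors to 0. *)
Lemma adj_right (V W : LUmod q) (h : 'Hom(V, TL W)) : LUhom h ->
  exists2 f : 'Hom(TL V, W), LUhom f & forall u v, f (u, v) = (h u).2 - q *: (h v).1.
Proof.
move=> hh.
have h1 a u v : (h (a *: u + v)).1 = a *: (h u).1 + (h v).1 by rewrite linearP.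
have h2 a u v : (h (a *: u + v)).2 = a *: (h u).2 + (h v).2 by rewrite linearP.
have lin : linear (fun u : TL V => ((h u.1).2 - q *: (h u.2).1 : W)).
  move=> a [u1 u2] [v1 v2]; rewrite /= h1 h2 scalerDr opprD scalerBr !scalerA.
  by rewrite [q * a]mulrC; exact: addrACA.
have [f ef] := mk_lfun lin.
have efp u v : f (u, v) = (h u).2 - q *: (h v).1 by rewrite ef.
have Z1 a u : (h (a *: u)).1 = a *: (h u).1 by rewrite linearZ.
have Z2 a u : (h (a *: u)).2 = a *: (h u).2 by rewrite linearZ.
have pE (w : TL W) : w = (w.1, w.2) by case: w.
exists f => //; apply: TL_gen_hom => [u v|n u v|n u v].
- rewrite TL_K !efp Z1 Z2 !hh (pE (h u)) (pE (h v)) !TL_K /= !scalerA.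
  by rewrite divff // mul1r scale1r actB actZ.
- rewrite TL_E !efp [LE n.+1 ∙ u + _]addrC h2 !hh !TL_E2 (pE (h u)) (pE (h v)) TL_Ki TL_E /=.
  rewrite actB !actZ scalerDr !scalerA [q ^ _ * q]mulrC opprD [- _ - _]addrC addrA.
  by rewrite [X in X - _ - _]addrC addrK.
- rewrite TL_F !efp [LF n ∙ u + _]addrC h1 Z2 !hh !TL_F1 (pE (h u)) TL_F /=.
  rewrite actB !actZ !scalerDr !scalerA.
  have -> : q * q ^ (- n.+1%:Z) * q ^ n.+1%:Z = q by rewrite -mulrA -expfzDr // addNr mulr1.
  have -> : q ^ n.+1%:Z * q ^ (- n.+1%:Z) = 1 by rewrite -expfzDr // subrr.
  rewrite scale1r -exprSz opprD [- _ - _]addrC addrA; congr (_ - _).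
  by rewrite addrAC subrr add0r.
Qed.

(* [L(1)] is self-dual, so [V |-> V (x) L(1)] is its own adjoint and exact. *)
Lemma TL_projective (P : LUmod q) : projective_type_I l P -> projective_type_I l (TL P).
Proof.
move=> [tP hP]; split; first exact: TL_type_I.
move=> V W g f tV tW hg sg hf.
have [f' hf' ef'] := adj_left hf; have [Tg hTg eTg] := TL_map hg.
have sTg : LUsurj Tg.
  by move=> [w1 w2]; have [v1 e1] := sg w1; have [v2 e2] := sg w2; exists (v1, v2); rewrite eTg e1 e2.
have [h hh eh] := hP _ _ Tg f' (TL_type_I tV) (TL_type_I tW) hTg sTg hf'.
have [k hk ek] := adj_right hh; exists k => // -[u v]; rewrite ek.
have pE (w : TL V) : w = (w.1, w.2) by case: w.
have e x : (g (h x).1, g (h x).2) = (- q^-1 *: f (0, x), f (x, 0)).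
  by rewrite -ef' -eh [X in Tg X]pE eTg.
have [_ e2] := e u; have [e1 _] := e v.
rewrite linearB linearZ /= e1 e2 scalerA mulrN divff // scaleN1r opprK.
by rewrite -linearD TL_pD addr0 add0r.
Qed.

Lemma good1 k : good 1 k = (k <= 1)%N.
Proof.
rewrite /good; case: k => [|[|k]] //=; first by rewrite mod0n.
by rewrite leqnn.
Qed.

(** A bilinear map is determined by its values on m0 and F m0 in the second argument. On L(1) all
    E^(k) and F^(k) with k > 1 vanish, so at most two terms of each coproduct survive, those of
    [TL_E] and [TL_F]. *)
Lemma TL_tensor (V L : LUmod q) (m0 : L) : hw 1 (good 1) m0 -> is_tensor V L (TL V).
Proof.
move=> hL.
have [[wt0 pr0] _ van bas] := hL.
have sE : [seq LF k ∙ m0 | k <- iota 0 2 & good 1 k] = [tuple m0; LF 1 ∙ m0].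
  by rewrite /= !good1 /= LF0.
rewrite sE in bas; set X := [tuple m0; LF 1 ∙ m0] in bas.
pose c0 w := coord X 0 w; pose c1 w := coord X 1 w.
have cE w : w = c0 w *: m0 + c1 w *: (LF 1 ∙ m0).
  have := coord_basis bas (memvf w); rewrite !big_ord_recl big_ord0 addr0.
  by rewrite (_ : lift ord0 ord0 = 1) //; exact/val_inj.
have fX := basis_free bas.
have c00 : c0 m0 = 1 by have := coord_free 0 0 fX.
have c10 : c1 m0 = 0 by have := coord_free 0 1 fX.
have c01 : c0 (LF 1 ∙ m0) = 0 by have := coord_free 1 0 fX.
have c11 : c1 (LF 1 ∙ m0) = 1 by have := coord_free 1 1 fX.
pose b (v : V) (w : L) : TL V := (c0 w *: v, c1 w *: v).
have c0P a u v : c0 (a *: u + v) = a * c0 u + c0 v by rewrite /c0 linearP.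
have c1P a u v : c1 (a *: u + v) = a * c1 u + c1 v by rewrite /c1 linearP.
have c0Z a u : c0 (a *: u) = a * c0 u by rewrite /c0 linearZ.
have c1Z a u : c1 (a *: u) = a * c1 u by rewrite /c1 linearZ.
have bil : bilinear_map b.
  split=> [v|w].
    by move=> a u w; rewrite /b c0P c1P TL_pZ TL_pD !scalerDl !scalerA.
  move=> a u v; rewrite /b TL_pZ TL_pD !scalerDr !scalerA.
  by congr pair; congr (_ *: _ + _); rewrite mulrC.
have b0 v : b v m0 = (v, 0) by rewrite /b c00 c10 scale1r scale0r.
have b1 v : b v (LF 1 ∙ m0) = (0, v) by rewrite /b c01 c11 scale1r scale0r.
have bE v w : b v w = c0 w *: b v m0 + c1 w *: b v (LF 1 ∙ m0).
  by rewrite b0 b1 !TL_pZ TL_pD !scaler0 add0r addr0.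
have bv0 v : b v 0 = 0.
  by have := bil.1 v 1 0 0; rewrite !scale1r !addr0 -{1}[b v 0]addr0 => /addrI.
exists b; split => //.
- move=> Z f [fl fr].
  have lin : linear (fun u : TL V => f u.1 m0 + f u.2 (LF 1 ∙ m0)).
    by move=> a [u1 u2] [v1 v2] /=; rewrite !fr scalerDr; exact: addrACA.
  have [g eg] := mk_lfun lin.
  have f0 w : f 0 w = 0.
    by have := fr w 1 0 0; rewrite !scale1r !addr0 -{1}[f 0 w]addr0 => /addrI.
  have fv0 v : f v 0 = 0.
    by have := fl v 1 0 0; rewrite !scale1r !addr0 -{1}[f v 0]addr0 => /addrI.
  exists g; split => [v w|g' eg'].
    rewrite bE linearD !linearZ /= b0 b1 !eg /= !f0 addr0 add0r.
    by rewrite {3}(cE w) fl -[c1 w *: (LF _ ∙ _)]addr0 fl fv0 addr0.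
  apply/lfunP => -[u v]; rewrite eg /=.
  have -> : (u, v) = b u m0 + b v (LF 1 ∙ m0) by rewrite b0 b1 TL_pD addr0 add0r.
  by rewrite linearD /= !eg'.
- have Kw w : LK ∙ w = (q * c0 w) *: m0 + (q^-1 * c1 w) *: (LF 1 ∙ m0).
    have [_ w1] := wt_F 1 wt0.
    rewrite {1}(cE w) actD !actZ wt0.2 w1 !scalerA; congr (_ *: _ + _ *: _).
      by rewrite mulrC.
    by rewrite mulrC.
  move=> v w; rewrite bE actD !actZ b0 b1 !TL_K !act0 !scaler0 Kw.
  rewrite (bil.1 (LK ∙ v) (q * c0 w) m0) -[(q^-1 * _) *: (LF _ ∙ _)]addr0 (bil.1 (LK ∙ v)) bv0 addr0 b0 b1.
  by rewrite !TL_pZ !TL_pD !scaler0 !scalerA mulrC [_ * q^-1]mulrC.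
- have Ew k w : LE k.+1 ∙ w = if k == 0%N then c1 w *: m0 else 0.
    rewrite {1}(cE w) actD !actZ pr0 scaler0 add0r (LEF_prim _ _ hL.(hw_prim)).
    by case: k => [|k] /=; rewrite ?scaler0 // LF0 addrK gb_nat qbinom_at_nn scale1r.
  case=> [|n] v w.
    by rewrite big_ord_recl big_ord0 addr0 mul0n expr0 invr1 scale1r LE0 LUactM LE0 expr0 LUact1 LE0.
  rewrite {1}/b TL_E.
  rewrite big_ord_recl big_ord_recl big1 ?addr0 => [|k _]; last by rewrite Ew /= bv0 scaler0.
  rewrite mul0n mul1n /bump /= expr0 invr1 scale1r subn0 expr0 mulr1 LE0 Ew /= subSS subn0 expr1.
  rewrite {1}/b LUactM -[c1 w *: m0]addr0 (bil.1 _ (c1 w)) bv0 addr0 b0 !TL_pZ TL_pD.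
  by rewrite /= !actZ !scaler0 addr0 -exprnN.
- have Fw k w : LF k.+1 ∙ w = if k == 0%N then c0 w *: (LF 1 ∙ m0) else 0.
    have vk j : LF j.+2 ∙ m0 = 0 by apply: van; rewrite good1.
    rewrite {1}(cE w) actD !actZ LFM addn1 vk !scaler0 addr0.
    by case: k => [|k] //=; rewrite vk scaler0.
  have KX k w : (LK ^+ k) ∙ w = (q ^ k%:Z * c0 w) *: m0 + (q ^ (- k%:Z) * c1 w) *: (LF 1 ∙ m0).
    have [_ w1] := wt_F 1 wt0.
    rewrite {1}(cE w) actD !actZ (LKX_act _ wt0.2) (LKX_act _ w1) !scalerA; congr (_ *: _ + _ *: _).
      by rewrite mulrC.
    by rewrite mulrC exprnP exprz_exp; congr (q ^ _ * _); ring.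
  case=> [|n] v w.
    by rewrite big_ord_recl big_ord0 addr0 mul0n expr0 scale1r LF0 LUactM LF0 expr0 LUact1 LF0.
  rewrite {1}/b TL_F.
  rewrite big_ord_recr big_ord_recr big1 ?add0r => [|k _]; last first.
    rewrite /= LUactM.
    have -> : (n.+1 - k = (n - k.+1).+2)%N by have := ltn_ord k; lia.
    by rewrite Fw act0 bv0 scaler0.
  rewrite /= subnn muln0 expr0 scale1r subSn // subnn muln1 !LUactM Fw /= LF0 !KX.
  rewrite c0Z c01 c1Z c11 !mulr0 scale0r add0r mulr1 /b c0P c0Z c01 c1P c1Z c10 c11.
  rewrite !c00 !(add0r, mulr0, addr0, mulr1) c0Z c1Z c01 c11 !mulr0 !mulr1 scale0r.
  rewrite TL_pZ TL_pD scaler0 add0r !actZ !scalerA mulrA.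
  have -> : q ^+ n * q ^ (- n%:Z) = 1 by rewrite exprnP -expfzDr // subrr.
  by rewrite mul1r.
Qed.

Lemma tensor_isoP (V L N : LUmod q) : is_Lq 1 L -> LUiso (TL V) N -> tensor_iso V L N.
Proof. by move=> /is_Lq_hw [m0 h] iso; exists (TL V) => //; exact: TL_tensor h. Qed.

Lemma lker_sub (V W : LUmod q) (f : 'Hom(V, W)) : LUhom f -> submodule (lker f).
Proof. by move=> hf x v; rewrite !memv_ker hf => /eqP ->; rewrite act0. Qed.

Lemma img_sub (V W : LUmod q) (f : 'Hom(V, W)) (N : {vspace V}) :
  LUhom f -> submodule N -> submodule (f @: N)%VS.
Proof. by move=> hf sN x _ /memv_imgP [u uN ->]; rewrite -hf memv_img ?sN. Qed.

Lemma limg_sub (V W : LUmod q) (f : 'Hom(V, W)) : LUhom f -> submodule (limg f).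
Proof. by move=> hf; apply: img_sub hf _ => x v _; exact: memvf. Qed.

Lemma surj_limg (V W : LUmod q) (f : 'Hom(V, W)) : LUsurj f <-> limg f = fullv.
Proof.
split=> [sf|e w]; last by have := memvf w; rewrite -e => /memv_imgP [u _ ->]; exists u.
by apply/vspaceP => w; rewrite memvf; have [v <-] := sf w; rewrite memv_img ?memvf.
Qed.

(** A map out of L(n) amounts to a primitive vector of weight n: by [good_steinberg] every k <= n is
    good, and beyond n [prim_int] gives the vanishing that [hw_hom] asks for. Such vectors lift by
    [steinberg_lift]. *)
Lemma steinberg_projective (n : nat) (L : LUmod q) (v0 : L) : (n %% l)%N = l.-1 ->
  hw n (good n) v0 -> projective_type_I l L.
Proof.
move=> hn hL; split; first exact: hw_type_I hL.
move=> V W g f tV tW hg sg hf.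
have [ws hV] := type_I_weighted tV.
have [u0 eu0] := sg (f v0).
have [wv0 pv0] := hw_prim hL.
have wf : wt n%:Z (f v0) by split; rewrite -hf ?wv0.1 ?wv0.2 linearZ.
pose u := prj ws n%:Z ∙ u0.
have gu : g u = f v0 by rewrite hg eu0 prj_id.
have uN k : LE k.+1 ∙ u \in lker g by rewrite memv_ker hg gu -hf pv0 linear0.
have [v pv vu] := steinberg_lift hV hn (lker_sub hg) (wt_prj hV _ _) uN.
have bad k : ~~ good n k -> LF k ∙ v = 0.
  by rewrite good_steinberg // -ltnNge; exact: prim_int.
have [h hh eh] := hw_hom hL pv bad; exists h => // x.
move: x; apply: (hw_ind hL); rewrite ?linear0 //.
- by move=> a x y ex ey; rewrite !linearP /= ex ey.
- move=> k _; rewrite eh hg hf; congr (_ ∙ _).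
  by rewrite -gu; apply/eqP; rewrite -subr_eq0 -linearB -memv_ker.
Qed.

(** * Simple modules and projective covers *)

Section Simple.
Variables (i : nat) (L : LUmod q) (v0 : L).
Hypothesis hL : hw i (good i) v0.

Lemma simple_sub (N : {vspace L}) : submodule N -> N != 0%VS -> v0 \in N.
Proof.
move=> sN N0; have hW := hw_weighted hL.
have := vpick0 N; rewrite (negPf N0) => /negbT; set y := vpick N => y0.
have yN : y \in N := memv_pick N.
set ws := [seq _ | k <- _] in hW.
have [n nw pn0] : exists2 n, n \in ws & prj ws n ∙ y != 0.
  apply: contrapT => h; case/negP: y0; apply/eqP; rewrite (sum_prj hW y) big_seq.
  by apply: big1 => n nw; apply: contrapT => /eqP ?; apply: h; exists n.
have [k [c gk [en e]]] := hw_wtv hL (wt_prj hW n y) pn0.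
have c0 : c != 0 by apply: contraNneq pn0 => c0; rewrite e c0 scale0r.
have : LE k ∙ (prj ws n ∙ y) \in N by exact: sN (sN _ _ yN).
rewrite e actZ (LEF_prim _ _ (hw_prim hL)) leqnn addrK subnn LF0 scalerA.
by rewrite rpredZeq; case/orP => //; rewrite mulf_eq0 (negPf c0) (negPf (gb_good gk)).
Qed.

Lemma simple_full (N : {vspace L}) : submodule N -> N != 0%VS -> N = fullv.
Proof. by move=> sN N0; apply: (hw_full hL) => //; exact: simple_sub. Qed.

Lemma simple_surj (V : LUmod q) (f : 'Hom(V, L)) v : LUhom f -> f v != 0 -> LUsurj f.
Proof.
move=> hf fv; apply/surj_limg/simple_full; first exact: limg_sub.
by apply: contraNneq fv => e; rewrite -memv0 -e memv_img ?memvf.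
Qed.

(** A nonzero multiple of F^(k) v0 with k > 0 and good is not primitive, since E^(k) returns it to a
    nonzero multiple of v0. *)
Lemma simple_prim n (v : L) : prim n v -> v != 0 -> exists c, v = c *: v0.
Proof.
move=> [wv pv] v_0; have [k [c gk [en e]]] := hw_wtv hL wv v_0.
case: k gk en e => [|k] gk en e; first by exists c; rewrite e LF0.
have := pv k; rewrite e actZ (LEF_prim _ _ (hw_prim hL)) leqnn addrK subnn LF0 => /eqP.
rewrite !scaler_eq0 (negPf (gb_good gk)) /= => /orP [/eqP c0|/eqP h0].
  by move: v_0; rewrite e c0 scale0r eqxx.
by have := gen_neq0 hL; rewrite h0 eqxx.
Qed.

End Simple.

Lemma wt_neq (V : LUmod q) n m (v : V) : wt n v -> wt m v -> v != 0 -> n = m.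
Proof.
move=> [h _] [h' _] v0; have /eqP := h; rewrite h' -subr_eq0 -scalerBl scaler_eq0 (negPf v0) orbF.
by rewrite -intrB intr_eq0 subr_eq0 => /eqP ->.
Qed.

Lemma hom_wt (V W : LUmod q) (f : 'Hom(V, W)) n v : LUhom f -> wt n v -> wt n (f v).
Proof. by move=> hf [h k]; split; rewrite -hf ?h ?k linearZ. Qed.

Lemma hom_prim (V W : LUmod q) (f : 'Hom(V, W)) n v : LUhom f -> prim n v -> prim n (f v).
Proof. by move=> hf [h k]; split; [exact: hom_wt|move=> j; rewrite -hf k linear0]. Qed.

Lemma simple_hom0 i j (V W : LUmod q) (v0 : V) (w0 : W) (f : 'Hom(V, W)) :
  hw i (good i) v0 -> hw j (good j) w0 -> LUhom f -> i <> j -> forall v, f v = 0.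
Proof.
move=> hV hW hf ij.
have fv0 : f v0 = 0.
  apply: contrapT => /eqP f0; have pf := hom_prim hf (hw_prim hV).
  have [c e] := simple_prim hW pf f0; apply: ij.
  have [wf _] := pf; have [ww _] := hw_prim hW.
  have ww' : wt j%:Z (f v0) by rewrite e; exact: wtZ.
  by have [] := wt_neq wf ww' f0.
apply: (hw_ind hV) => [|a u v eu ev|k _]; first exact: linear0.
  by rewrite linearP /= eu ev scaler0 addr0.
by rewrite hf fv0 act0.
Qed.

Lemma simple_iso i (V W : LUmod q) (v0 : V) (w0 : W) :
  hw i (good i) v0 -> hw i (good i) w0 -> LUiso V W.
Proof.
move=> hV hW.
have [f hf ef] := hw_hom hV (hw_prim hW) (hw_van hW).
have [g hg eg] := hw_hom hW (hw_prim hV) (hw_van hV).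
exists f => //; exists g.
  apply: (hw_ind hV) => [|a u v eu ev|k _]; first by rewrite !linear0.
    by rewrite !linearP /= eu ev.
  by rewrite ef eg.
apply: (hw_ind hW) => [|a u v eu ev|k _]; first by rewrite !linear0.
  by rewrite !linearP /= eu ev.
by rewrite eg ef.
Qed.

Lemma hom_factor (V W X : LUmod q) (f : 'Hom(V, W)) (g : 'Hom(V, X)) :
  LUhom f -> LUsurj f -> LUhom g -> (forall v, f v = 0 -> g v = 0) ->
  exists2 h : 'Hom(W, X), LUhom h & forall v, h (f v) = g v.
Proof.
move=> hf sf hg fg.
have e v : g (f^-1%VF (f v)) = g v.
  apply/eqP; rewrite -subr_eq0 -linearB; apply/eqP/fg.
  by rewrite linearB /= limg_lfunVK ?subrr // memv_img ?memvf.
exists (g \o f^-1)%VF => [x w|v]; last by rewrite comp_lfunE e.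
by have [v <-] := sf w; rewrite !comp_lfunE -hf !e hg.
Qed.

Lemma LUhom_comp (V W X : LUmod q) (g : 'Hom(W, X)) (f : 'Hom(V, W)) :
  LUhom g -> LUhom f -> LUhom (g \o f)%VF.
Proof. by move=> hg hf x v; rewrite !comp_lfunE hf hg. Qed.

Lemma LUhom0 (V W : LUmod q) : LUhom (0 : 'Hom(V, W)).
Proof. by move=> x v; rewrite !lfunE /= act0. Qed.

Lemma iso_of_surj (V W : LUmod q) (f : 'Hom(V, W)) : LUhom f -> LUsurj f ->
  (\dim {:V} <= \dim {:W})%N -> LUiso V W.
Proof.
move=> hf sf d; exists f => //.
have im := proj1 (surj_limg f) sf.
have k0 : lker f == 0%VS.
  rewrite -dimv_eq0; have := limg_ker_dim f {:V}; rewrite im capfv; move: d; clear; lia.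
exists f^-1%VF; first exact: lker0_lfunK.
by move=> w; apply: limg_lfunVK; rewrite im memvf.
Qed.

Lemma LUiso_sym (V W : LUmod q) : LUiso V W -> LUiso W V.
Proof.
move=> [f hf [g fg gf]].
have k0 : lker f == 0%VS by apply/lker0P; exact: can_inj fg.
have e : f^-1%VF =1 g by move=> w; rewrite -{1}(gf w) lker0_lfunK.
exists f^-1%VF; last by exists f => w; rewrite e.
by move=> x w; rewrite !e -{1}(gf w) -hf fg.
Qed.

Definition head (P L : LUmod q) (p : 'Hom(P, L)) : Prop := [/\ LUhom p, LUsurj p &
  forall N : {vspace P}, submodule N -> (N + lker p)%VS = fullv -> N = fullv].

Lemma head_full b (P L : LUmod q) (v0 : L) (p : 'Hom(P, L)) (N : {vspace P}) x :
  hw b (good b) v0 -> head p -> submodule N -> x \in N -> p x != 0 -> N = fullv.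
Proof.
move=> hL [hp sp sup] sN xN px; apply: (sup _ sN).
have e : (p @: N)%VS = fullv.
  apply: (simple_full hL); first exact: img_sub.
  by apply: contraNneq px => e; rewrite -memv0 -e memv_img.
apply/vspaceP => v; rewrite memvf; apply/idP.
have := memvf (p v); rewrite -e => /memv_imgP [u uN pu].
rewrite -[v](subrKC u); apply: memv_add => //.
by rewrite memv_ker linearB /= pu subrr.
Qed.

Lemma head_surj b (V P L : LUmod q) (v0 : L) (p : 'Hom(P, L)) (f : 'Hom(V, P)) x :
  hw b (good b) v0 -> head p -> LUhom f -> p (f x) != 0 -> LUsurj f.
Proof.
move=> hL hp hf pf; apply/surj_limg.
exact: head_full hL hp (limg_sub hf) (memv_img f (memvf x)) pf.
Qed.

Lemma head_hom0 a b (P L M : LUmod q) (v0 : L) (w0 : M) (p : 'Hom(P, L)) (f : 'Hom(P, M)) :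
  hw a (good a) v0 -> hw b (good b) w0 -> head p -> LUhom f -> a <> b -> forall x, f x = 0.
Proof.
move=> hL hM hp hf ab x; apply: contrapT => /eqP fx; have [hph sp _] := hp.
have kf u : f u = 0 -> p u = 0.
  move=> fu; apply: contrapT => /eqP pu.
  have e := head_full hL hp (lker_sub hf) (_ : u \in lker f) pu.
  by case/negP: fx; rewrite -memv_ker e ?memvf // memv_ker fu.
have [h hh eh] := hom_factor hf (simple_surj hM hf fx) hph kf.
have [u pu] := sp v0.
have := gen_neq0 hL; rewrite -pu -eh.
by rewrite (simple_hom0 hM hL hh (nesym ab)) eqxx.
Qed.

Lemma dsum_hom (Q A B : LUmod q) (h : 'Hom(Q, A)) (g : 'Hom(Q, B)) : LUhom h -> LUhom g ->
  exists2 f : 'Hom(Q, dsum A B), LUhom f & forall x, f x = (h x, g x).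
Proof.
move=> hh hg; have lin : linear (fun x : Q => ((h x, g x) : dsum A B)).
  by move=> a u v; rewrite !linearP.
have [f ef] := mk_lfun lin; exists f => // x v.
by rewrite !ef hh hg.
Qed.

(** If p g vanished on ker h it would factor through h. Hence g maps ker h onto [B] by [head_full],
    and the second coordinate can be corrected without touching the first. *)
Lemma joint_surj b (Q A B L : LUmod q) (v0 : L) (p : 'Hom(B, L))
    (h : 'Hom(Q, A)) (g : 'Hom(Q, B)) (f : 'Hom(Q, dsum A B)) :
  hw b (good b) v0 -> head p -> LUhom h -> LUsurj h -> LUhom g ->
  (forall phi : 'Hom(A, L), LUhom phi -> (forall x, phi (h x) = p (g x)) -> False) ->
  (forall x, f x = (h x, g x)) -> LUsurj f.
Proof.
move=> hL hp hh sh hg nophi ef [a y]; have [hph _ _] := hp.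
have [e|] := pselect (forall x, h x = 0 -> p (g x) = 0).
  have hc := LUhom_comp hph hg.
  have [phi hphi ephi] := hom_factor hh sh hc (fun x hx => etrans (comp_lfunE _ _ _) (e x hx)).
  by case: (nophi phi hphi) => x; rewrite ephi comp_lfunE.
move=> /existsNP [x0 /not_implyP [hx0 /eqP px0]].
have [x hx] := sh a.
have e : (g @: lker h)%VS = fullv.
  apply: (head_full hL hp (img_sub hg (lker_sub hh)) (memv_img g _) px0).
  by rewrite memv_ker hx0.
have := memvf (y - g x); rewrite -e => /memv_imgP [u ku eu].
exists (u + x); rewrite ef !linearD /= hx -eu subrK.
by move: ku; rewrite memv_ker => /eqP ->; rewrite add0r.
Qed.

Lemma Pq_head b (P L : LUmod q) (v0 : L) : is_Pq l b P -> hw b (good b) v0 ->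
  projective_type_I l P /\ exists p : 'Hom(P, L), head p.
Proof.
move=> [V hV [prP [p [hp sp sup]]]] hL; split=> //.
have [w0 hw0] := is_Lq_hw hV; have [f hf bf] := simple_iso hw0 hL.
exists (f \o p)%VF; split; first exact: LUhom_comp.
  case: bf => f' ff' f'f w; have [x ex] := sp (f' w); exists x.
  by rewrite comp_lfunE ex f'f.
have -> : lker (f \o p)%VF = lker p; last exact: sup.
apply/vspaceP => x; rewrite [LHS]memv_ker [RHS]memv_ker comp_lfunE.
apply/eqP/eqP => [e|->]; last exact: linear0.
by apply: (bij_inj bf); rewrite e linear0.
Qed.

Lemma id_head (L : LUmod q) : head (\1%VF : 'Hom(L, L)).
Proof.
split=> [x v|w|N _]; [by rewrite !id_lfunE|by exists w; rewrite id_lfunE|].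
have -> : lker (\1%VF : 'Hom(L, L)) = 0%VS.
  by apply/vspaceP => v; rewrite memv_ker id_lfunE memv0.
by rewrite addv0.
Qed.

Lemma head_lift (Q P L : LUmod q) (p : 'Hom(P, L)) (g : 'Hom(Q, L)) :
  projective_type_I l Q -> type_I l P -> type_I l L -> head p -> LUhom g ->
  exists2 h : 'Hom(Q, P), LUhom h & forall x, p (h x) = g x.
Proof. by move=> [_ prQ] tP tL [hp sp _] hg; exact: prQ. Qed.

(** Projectivity of L gives a section of P -> L, and the section is onto because P has simple
    head. *)
Lemma steinberg_Pq n (P L : LUmod q) (v0 : L) : (n %% l)%N = l.-1 -> is_Pq l n P ->
  hw n (good n) v0 -> LUiso P L.
Proof.
move=> hn hP hL; have [[tP _] [p hp]] := Pq_head hP hL.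
have [hph sp _] := hp.
have pL := steinberg_projective hn hL.
have [h hh eh] := pL.2 _ _ p \1%VF tP (hw_type_I hL) hph sp (fun x v => etrans (id_lfunE _) (congr1 _ (esym (id_lfunE v)))).
have v0n := gen_neq0 hL.
have sh : LUsurj h.
  by apply: (head_surj (x := v0) hL hp hh); rewrite eh id_lfunE.
exists p => //; exists h => x; last by rewrite eh id_lfunE.
by have [y <-] := sh x; rewrite eh id_lfunE.
Qed.

Lemma weyl_onto i (L D : LUmod q) (v0 : L) (d0 : D) : hw i (good i) v0 ->
  hw i (fun k => k <= i)%N d0 ->
  exists f : 'Hom(D, L), [/\ LUhom f, LUsurj f & f d0 = v0].
Proof.
move=> hL hD; have pv := hw_prim hL.
have [f hf ef] := hw_hom hD pv (fun k hk => hw_van hL (contraNN (fun g => proj1 (andP g)) hk)).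
have fd : f d0 = v0 by have := ef 0%N; rewrite !LF0.
exists f; split=> //; apply: (simple_surj (v := d0) hL hf).
by rewrite fd; exact: gen_neq0 hL.
Qed.

(* A primitive vector of weight [i] is the image of the generator of the Weyl *)
(* module, onto which the projective cover of [L(i)] maps. *)
Lemma prim_Pq_hom i (P L D X : LUmod q) (v0 : L) (d0 : D) (x0 : X) : is_Pq l i P ->
  hw i (good i) v0 -> hw i (fun k => k <= i)%N d0 -> type_I l X ->
  prim i%:Z x0 -> x0 != 0 ->
  exists2 f : 'Hom(P, X), LUhom f & exists x, f x != 0.
Proof.
move=> hP hL hD tX px x00.
have [[tP prP] [p hp]] := Pq_head hP hL; have [hph sp _] := hp.
have [c [hc sc cd]] := weyl_onto hL hD.
have [h hh eh] := prP _ _ c p (hw_type_I hD) (hw_type_I hL) hc sc hph.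
have van k : ~~ (k <= i)%N -> LF k ∙ x0 = 0 by rewrite -ltnNge; exact: prim_int.
have [f hf ef] := hw_hom hD px van.
have fd : f d0 = x0 by have := ef 0%N; rewrite !LF0.
exists (f \o h)%VF; first exact: LUhom_comp.
have [x pxv] := sp v0; have hW := hw_weighted hD; set ws := [seq _ | k <- _] in hW.
have v0n := gen_neq0 hL.
pose y := prj ws i%:Z ∙ x.
have cy : c (h y) = v0 by rewrite eh hph pxv prj_id //; case: (hw_prim hL).
have hy0 : h y != 0 by apply: contraNneq v0n => e; rewrite -cy e linear0.
have wy : wt i%:Z (h y) by rewrite hh; exact: wt_prj.
have [k [a _ [ek e]]] := hw_wtv hD wy hy0.
have k0 : k = 0%N by move: ek; clear; lia.
rewrite k0 LF0 in e; exists y; rewrite comp_lfunE e linearZ /= fd scaler_eq0 (negPf x00) orbF.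
by apply: contraNneq hy0 => a0; rewrite e a0 scale0r.
Qed.

Lemma TL_prim1 n (V : LUmod q) (v : V) : prim n v -> prim (n + 1) ((v, 0) : TL V).
Proof.
by move=> [wv pv]; split=> [|k]; [exact: TL_wt1|rewrite TL_E0 pv].
Qed.

Lemma qbinom_at1 n : qbinom_at q n 1 = qintv q n%:Z.
Proof.
case: n => [|n]; first by rewrite qbinom_at_small // /qintv oppr0 subrr mul0r.
apply: (vat_uniq (vat_qbinom n.+1 1)).
have -> : qbinom n.+1 1 = qint n.+1%:Z; last exact: (vat_qint q0 hl hq).
rewrite qbinomE // subn1 !qfactS qfact0 !qnumE qint1 !mul1r mulrC.
by rewrite mulKf // (qfact_neq0 q0 hl hq).
Qed.

(** The coefficient is forced by E^(1): in the first coordinate the multiple of E F v = [n+1] v must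
    cancel K^-1 v = q^-(n+1) v. *)
Lemma TL_prim2 (n : nat) (V : LUmod q) (v : V) : prim n.+1%:Z v -> qbinom_at q n.+1 1 != 0 ->
  prim n%:Z ((- (q ^ (- n.+1%:Z) / qbinom_at q n.+1 1) *: (LF 1 ∙ v), v) : TL V).
Proof.
move=> pv qn; have [wv Ev] := pv; split=> [|k].
  apply: TL_wt; last by rewrite -addn1 PoszD in wv *.
  apply: wtZ; have := wt_F 1 wv; congr wt; rewrite intS; ring.
rewrite TL_E Ev actZ (LEF_prim _ _ pv) (wt_Ki wv) actZ; congr pair.
case: k => [|k] /=; last by rewrite Ev !scaler0 addr0.
rewrite addrK gb_nat subnn oppr0 expr0z scale1r LE0 scalerA mulNr divfK //.
by rewrite scaleNr addNr.
Qed.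

Lemma qbinom_at1_cross a b : (a %% l = b %% l)%N ->
  q ^ (- b%:Z) * qbinom_at q a 1 = q ^ (- a%:Z) * qbinom_at q b 1.
Proof.
move=> ab; rewrite !qbinom_at1 /qintv -!exprnN -!exprnP.
apply: cross_cancel; rewrite ?expf_neq0 // -!exprM ![(_ * 2)%N]mulnC !exprM.
by rewrite -(prim_expr_mod hq a) ab prim_expr_mod.
Qed.

Lemma qbinom_at_sym n k : (k <= n)%N -> qbinom_at q n (n - k) = qbinom_at q n k.
Proof.
move=> kn; rewrite /qbinom_at !qbinomE ?leq_subr // subKn //.
by rewrite [qfact k * _]mulrC.
Qed.

Section L_TL.
Variables (n : nat) (M L : LUmod q) (w0 : M) (v0 : L).
Hypotheses (hM : hw n (good n) w0) (hL : hw n.+1 (good n.+1) v0).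
Hypothesis hn : (n %% l)%N <> l.-1.

Let modS : (n.+1 %% l = (n %% l).+1)%N := modSl hn.

(** w0 (x) m_0 is primitive of weight n + 1. If k > 0 is not good for n + 1, neither k nor k - 1 is
    good for n, so F^(k) kills it. *)
Lemma L_up : exists2 h : 'Hom(L, TL M), LUhom h & h v0 = (w0, 0).
Proof.
have pw := TL_prim1 (hw_prim hM); rewrite -PoszD addn1 in pw.
have van k : ~~ good n.+1 k -> LF k ∙ ((w0, 0) : TL M) = 0.
  case: k => [|k]; first by rewrite good0.
  move=> ng; rewrite TL_F act0 scaler0 addr0.
  have ng1 : ~~ good n k.
    apply: contra ng; rewrite /good modS => /andP [h1 h2]; rewrite ltnS h1 /=.
    by rewrite -addn1 -modnDml (leq_trans (leq_mod _ _)) // addn1.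
  have ng2 : ~~ good n k.+1.
    apply: contra ng; rewrite /good modS => /andP [h1 h2].
    by rewrite (leqW h1) (leqW h2).
  by rewrite !(hw_van hM) // scaler0.
by have [h hh eh] := hw_hom hL pw van; exists h => //; have := eh 0%N; rewrite !LF0.
Qed.

Definition down_coef := - (q ^ (- n.+1%:Z) / qbinom_at q n.+1 1).

Let qn : qbinom_at q n.+1 1 != 0.
Proof. by apply: qbinom_at_neq0 => //; rewrite modS modn_small. Qed.

(** It remains to kill the primitive vector of [TL_prim2] by F^(k) for k not good for n. The first
    coordinate has the factor [k+1; k] F^(k+1) v0 = 0. In the second, F^(k) v0 = 0 unless k = n + 1
    mod l, when the two terms cancel by [qbinom_at1_cross]. *)
Lemma L_down : exists2 h : 'Hom(M, TL L), LUhom h & h w0 = (down_coef *: (LF 1 ∙ v0), v0).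
Proof.
have pv := TL_prim2 (hw_prim hL) qn; rewrite -/down_coef in pv.
pose x0 : TL L := (down_coef *: (LF 1 ∙ v0), v0); rewrite -/x0 in pv.
have van k : ~~ good n k -> LF k ∙ x0 = 0.
  have [nk _|kn] := ltnP n k; first exact: prim_int (TL_type_I (hw_type_I hL)) pv nk.
  case: k kn => [|k] kn; first by rewrite good0.
  rewrite /good kn andTb -ltnNge => nk; rewrite /x0 TL_F !actZ !LFM addn1.
  have z1 : qbinom_at q k.+2 k.+1 *: (LF k.+2 ∙ v0) = 0.
    have [e|/eqP ne] := eqVneq (k.+1 %% l)%N l.-1.
      by rewrite qbinom_at_eq0 ?scale0r // (modSl0 e) e -ltnS prednK // ltnW.
    have e := modSl ne; by rewrite (hw_van hL) ?scaler0 // /good e modS; apply/nandP; right; rewrite -ltnNge ltnS.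
  rewrite addn1 z1 !scaler0; congr pair.
  have [g|/(hw_van hL) ->] := boolP (good n.+1 k.+1); last by rewrite !scaler0 addr0.
  have e : (k.+1 %% l = n.+1 %% l)%N.
    by move: g; rewrite /good modS => /andP [_ g]; apply/eqP; rewrite eqn_leq g nk.
  rewrite scalerA -scalerDl -(qbinom_at_sym (leqnSn k)) subSn // subnn.
  rewrite /down_coef mulNr mulrAC qbinom_at1_cross // mulfK //.
  by rewrite addNr scale0r.
by have [h hh eh] := hw_hom hM pv van; exists h => //; have := eh 0%N; rewrite !LF0.
Qed.

End L_TL.

Lemma adj_right_inj (V W : LUmod q) (h : 'Hom(V, TL W)) (f : 'Hom(TL V, W)) :
  (forall u v, f (u, v) = (h u).2 - q *: (h v).1) -> (forall y, f y = 0) -> forall x, h x = 0.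
Proof.
move=> ef f0 x.
have e2 : (h x).2 = 0 by have := f0 (x, 0); rewrite ef linear0 scaler0 subr0.
have e1 : (h x).1 = 0.
  have := f0 (0, x); rewrite ef linear0 sub0r => /eqP.
  by rewrite oppr_eq0 scaler_eq0 (negPf q0) => /eqP.
by case: (h x) e1 e2 => a b /= -> ->.
Qed.

Lemma adj_right_neq0 (V W : LUmod q) (h : 'Hom(V, TL W)) x : LUhom h -> h x != 0 ->
  exists f : 'Hom(TL V, W), [/\ LUhom f,
    forall u v, f (u, v) = (h u).2 - q *: (h v).1 & exists y, f y != 0].
Proof.
move=> hh hx; have [f hf ef] := adj_right hh; exists f; split=> //.
apply: contrapT => nf; case/negP: hx; apply/eqP.
by apply: (adj_right_inj ef) => y; apply: contrapT => /eqP ?; apply: nf; exists y.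
Qed.

(** * Decomposition of the tensor products *)

Section Fusion.
Variables Lq Pq : nat -> LUmod q.
Hypotheses (hLq : forall j, is_Lq j (Lq j)) (hPq : forall j, is_Pq l j (Pq j)).

Let projP j : projective_type_I l (Pq j).
Proof. by have [v0 h] := is_Lq_hw (hLq j); have [] := Pq_head (hPq j) h. Qed.

Definition nohom (A : LUmod q) b := forall f : 'Hom(A, Lq b), LUhom f -> forall x, f x = 0.

Lemma nohom_P a b : a <> b -> nohom (Pq a) b.
Proof.
move=> ab f hf; have [v0 h] := is_Lq_hw (hLq a); have [w0 h'] := is_Lq_hw (hLq b).
have [_ [p hp]] := Pq_head (hPq a) h; exact: head_hom0 h h' hp hf ab.
Qed.

Lemma nohom_L a b : a <> b -> nohom (Lq a) b.
Proof.
move=> ab f hf; have [v0 h] := is_Lq_hw (hLq a); have [w0 h'] := is_Lq_hw (hLq b).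
exact: simple_hom0 h h' hf ab.
Qed.

Lemma nohom_copies n A b : nohom A b -> nohom (copies n A) b.
Proof.
move=> nA f hf x.
have lin (j : 'I_n) : linear (fun a : A => ([ffun k => if k == j then a else 0] : copies n A)).
  by move=> c u v; apply/ffunP => k; rewrite !ffunE; case: eqP; rewrite ?scaler0 ?addr0.
have fj j (a : A) : f [ffun k => if k == j then a else 0] = 0.
  have [g eg] := mk_lfun (lin j); rewrite -eg -comp_lfunE; apply: nA => y u.
  rewrite !comp_lfunE !eg -hf; congr (f _); apply/ffunP => k; rewrite !ffunE.
  by case: eqP => //; rewrite act0.
have -> : x = \sum_(j < n) [ffun k => if k == j then x j else 0].
  apply/ffunP => k; rewrite sum_ffunE (bigD1 k) //= ffunE eqxx big1 ?addr0 // => j jk.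
  by rewrite ffunE eq_sym (negPf jk).
by rewrite linear_sum /= big1.
Qed.

Lemma nohom_dsum A B b : nohom A b -> nohom B b -> nohom (dsum A B) b.
Proof.
move=> nA nB f hf [x y].
have linA : linear (fun a : A => ((a, 0) : dsum A B)).
  by move=> c u v; congr pair; rewrite /= scaler0 addr0.
have linB : linear (fun a : B => ((0, a) : dsum A B)).
  by move=> c u v; congr pair; rewrite /= scaler0 addr0.
have [ga ega] := mk_lfun linA; have [gb egb] := mk_lfun linB.
have -> : (x, y) = ga x + gb y by rewrite ega egb; congr pair; rewrite /= ?addr0 ?add0r.
rewrite linearD /= -!comp_lfunE nA ?nB ?addr0 // => z u; rewrite !comp_lfunE ?ega ?egb -hf.
  by congr (f _); congr pair; rewrite act0.
by congr (f _); congr pair; rewrite act0.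
Qed.

Lemma copies_hom n (Q B : LUmod q) (g : 'I_n -> 'Hom(Q, B)) : (forall j, LUhom (g j)) ->
  exists2 G : 'Hom(Q, copies n B), LUhom G & forall x, G x = [ffun j => g j x].
Proof.
move=> hg; have lin : linear (fun x : Q => ([ffun j => g j x] : copies n B)).
  by move=> c u v; apply/ffunP => j; rewrite !ffunE linearP.
have [G eG] := mk_lfun lin; exists G => // x v; rewrite !eG.
by apply/ffunP => j; rewrite !ffunE hg.
Qed.

(** For n = 1 this is [joint_surj]: every map A -> L(b) is zero, while p g is not. *)
Lemma onto_copies n b (Q A B : LUmod q) (p : 'Hom(B, Lq b)) (h : 'Hom(Q, A)) (g : 'Hom(Q, B)) :
  (n <= 1)%N -> head p -> LUhom h -> LUsurj h -> nohom A b -> LUhom g ->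
  (n = 1%N -> exists x, p (g x) != 0) ->
  exists2 h' : 'Hom(Q, dsum A (copies n B)), LUhom h' & LUsurj h'.
Proof.
move=> n1 hp hh sh nA hg gx; have [v0 hL] := is_Lq_hw (hLq b).
have [G hG eG] := copies_hom (fun _ : 'I_n => hg).
have [h' hh' eh'] := dsum_hom hh hG; exists h' => //.
case: n n1 gx G hG eG h' hh' eh' => [|[|//]] _ gx G hG eG h' hh' eh' [a y].
  by have [x <-] := sh a; exists x; rewrite eh'; congr pair; apply/ffunP => -[].
have [f hf ef] := dsum_hom hh hg.
have sf : LUsurj f.
  apply: (joint_surj hL hp hh sh hg _ ef) => phi hphi e.
  have [//|x /negP []] := gx; by rewrite -e nA.
have [x ex] := sf (a, y 0); exists x; rewrite eh' eG; move: ex; rewrite ef => -[-> ex].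
by congr pair; apply/ffunP => j; rewrite ffunE ex ord1.
Qed.

Lemma P_up i : (i %% l)%N <> l.-1 ->
  exists2 f : 'Hom(Pq i, TL (Lq i.+1)), LUhom f & exists x, f x != 0.
Proof.
move=> hi; have [w0 hM] := is_Lq_hw (hLq i); have [v0 hL] := is_Lq_hw (hLq i.+1).
have [_ [p [hp sp _]]] := Pq_head (hPq i) hM.
have [h hh eh] := L_down hM hL hi; exists (h \o p)%VF; first exact: LUhom_comp.
have [x ex] := sp w0; exists x; rewrite comp_lfunE ex eh.
by apply/eqP => -[_ v00]; have := gen_neq0 hL; rewrite v00 eqxx.
Qed.

(** w0 (x) m_0 is primitive of weight i + 1, so [prim_Pq_hom] applies even where [L_up] does not,
    that is for i = -1 mod l. *)
Lemma P_down i : exists2 f : 'Hom(Pq i.+1, TL (Lq i)), LUhom f & exists x, f x != 0.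
Proof.
have [w0 hM] := is_Lq_hw (hLq i); have [v0 hL] := is_Lq_hw (hLq i.+1).
have [D /weyl_hw [d0 hD] _] := hLq i.+1.
have pw := TL_prim1 (hw_prim hM); rewrite -PoszD addn1 in pw.
apply: (prim_Pq_hom (hPq i.+1) hL hD _ pw); first exact/TL_type_I/hw_type_I/hM.
by apply/eqP => -[w00]; have := gen_neq0 hM; rewrite w00 eqxx.
Qed.

(* [F^(l-1)] of the generator is a primitive vector of weight [i] in the Weyl module *)
(* of highest weight [i + 2l - 2], a quotient of [L(i+2l-1) (x) L(1)]. *)
Lemma P_far i : (i %% l)%N = 0%N ->
  exists2 f : 'Hom(Pq i, TL (Lq (i + 2 * l - 1))), LUhom f & exists x, f x != 0.
Proof.
move=> hi; set j := (i + 2 * l - 1)%N; pose m := j.-1.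
have em : j = m.+1 by rewrite /m prednK // /j; move: hl; clear; lia.
have [w0 hM] := is_Lq_hw (hLq i); have [v0 hL] := is_Lq_hw (hLq j).
have [E /weyl_hw [e0 hE] _] := hLq i; have [D /weyl_hw [d0 hD] _] := hLq m.
have jl : (j %% l = l.-1)%N.
  have -> : (j = l.-1 + l + i)%N by rewrite /j; move: hl; clear; lia.
  rewrite -modnDmr hi addn0 modnDr modn_small //; move: hl; clear; lia.
have pd := TL_prim1 (hw_prim hD); rewrite -PoszD addn1 -em in pd.
have van k : ~~ good j k -> LF k ∙ ((d0, 0) : TL D) = 0.
  by rewrite good_steinberg // -ltnNge; exact: prim_int (TL_type_I (hw_type_I hD)) pd.
(* The adjoint [kap] of [h] maps L(j) (x) L(1) to the Weyl module [D] and hits its generator, so it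
   is onto. *)
have [h hh eh] := hw_hom hL pd van; have [kap hkap ekap] := adj_right hh.
have skap : LUsurj kap.
  apply/surj_limg/(hw_full hD); first exact: limg_sub.
  have -> : d0 = kap (LF 1 ∙ v0, 0).
    by rewrite ekap eh linear0 scaler0 subr0 TL_F act0 scaler0 addr0 LF0.
  by rewrite memv_img ?memvf.
have px : prim i%:Z (LF l.-1 ∙ d0).
  split=> [|k]; first by have := wt_F l.-1 (hw_prim hD).1; congr wt; rewrite /m /j; move: hl; clear; lia.
  rewrite (LEF_prim _ _ (hw_prim hD)); case: ifP => // kl.
  have -> : m%:Z + k.+1%:Z - l.-1%:Z = (k + (i + l))%N%:Z by rewrite /m /j; move: hl kl; clear; lia.
  rewrite gb_nat qbinom_at_eq0 ?scale0r //.
  rewrite addnA modnDr -modnDmr hi addn0 !modn_small //; move: hl kl; clear; lia.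
have lm : (l.-1 <= m)%N by rewrite /m /j; move: hl; clear; lia.
have [f hf [x fx]] := prim_Pq_hom (hPq i) hM hE (hw_type_I hD) px (hw_neq0 hD lm).
have [g hg eg] := (projP i).2 _ _ kap f (TL_type_I (hw_type_I hL)) (hw_type_I hD) hkap skap hf.
by exists g => //; exists x; apply: contraNneq fx => e; rewrite -eg e linear0.
Qed.

(** Here q^(2(n+2)) = 1. With this value the composite L(n) -> L(n+1) (x) L(1) -> L(n) is zero, as
    [P_up2] requires. *)
Lemma steinberg_down_coef n : (n.+1 %% l = l.-1)%N -> down_coef n = q.
Proof.
move=> hn; rewrite /down_coef qbinom_at1 /qintv -exprnN -exprnP.
have d0 := q_neq_V q0 hl hq.
have nn : qbinom_at q n.+1 1 != 0.
  apply: qbinom_at_neq0 => //; rewrite hn modn_small // -ltnS prednK //; exact: ltnW.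
apply: steinberg_coef => //; first exact: expf_neq0.
  move: nn; rewrite qbinom_at1 /qintv -exprnN -exprnP.
  by apply: contraNneq => ->; rewrite mul0r.
rewrite -exprM mulnC exprM -exprSr; apply/eqP; rewrite -(prim_order_dvd hq).
by rewrite /dvdn (modSl0 hn).
Qed.

Section NextSteinberg.
Variable i : nat.
Hypothesis hi : (i %% l)%N = (l - 2)%N.

Let hi1 : (i %% l)%N <> l.-1. Proof. rewrite hi; move: hl; clear; lia. Qed.
Let hn : (i.+1 %% l)%N = l.-1.
Proof.
by rewrite (modSl hi1) hi; move: hl; clear; lia.
Qed.

(* The second map lifts [P(i) -> L(i)] along [L(i+1) (x) L(1) -> L(i)], which kills *)
(* the image of the first one. *)
Lemma P_up2 : exists f1 f2 : 'Hom(Pq i, TL (Lq i.+1)), [/\ LUhom f1, LUhom f2,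
  exists x, f1 x != 0 & forall c, ~ forall x, f2 x = c *: f1 x].
Proof.
have [w0 hM] := is_Lq_hw (hLq i); have [v0 hL] := is_Lq_hw (hLq i.+1).
have [_ [p [hp sp _]]] := Pq_head (hPq i) hM.
have [hd hhd ehd] := L_down hM hL hi1; have [hu hhu ehu] := L_up hM hL hi1.
have [kap hkap ekap] := adj_right hhu.
have w00 := gen_neq0 hM; have v00 := gen_neq0 hL.
have kd0 : kap (hd w0) = 0.
  rewrite ehd ekap linearZ /= hhu ehu steinberg_down_coef // TL_F act0 scaler0 addr0 LF0.
  by rewrite subrr.
have kd x : kap (hd x) = 0.
  move: x; apply: (hw_ind hM) => [|a u v eu ev|k _]; first by rewrite !linear0.
    by rewrite !linearP /= eu ev scaler0 addr0.
  by rewrite hhd hkap kd0 act0.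
have kn : kap (LF 1 ∙ v0, 0) = w0.
  by rewrite ekap hhu ehu linear0 scaler0 subr0 TL_F act0 scaler0 addr0 LF0.
have sk : LUsurj kap by apply: (simple_surj hM hkap (_ : _ (LF 1 ∙ v0, 0) != 0)); rewrite kn.
have [f2 hf2 ef2] := (projP i).2 _ _ kap p (TL_type_I (hw_type_I hL)) (hw_type_I hM) hkap sk hp.
have [x ex] := sp w0.
exists (hd \o p)%VF, f2; split=> // [|| c e]; first exact: LUhom_comp.
  by exists x; rewrite comp_lfunE ex ehd; apply/eqP => -[_ e]; rewrite e eqxx in v00.
by case/negP: w00; rewrite -ex -ef2 e comp_lfunE linearZ /= kd scaler0.
Qed.

(** Here P(i+1) = L(i+1). Were the two maps not jointly onto, one would be c times the other after
    projection to L(i+1), as an endomorphism of L(i+1) is a scalar; by adjunction f2 = c f1, against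
    [P_up2]. *)
Lemma onto_two : exists2 h : 'Hom(TL (Pq i), copies 2 (Pq i.+1)), LUhom h & LUsurj h.
Proof.
have [v0 hL] := is_Lq_hw (hLq i.+1).
have [[tP _] [p hp]] := Pq_head (hPq i.+1) hL.
have [f1 [f2 [hf1 hf2 [x fx] nc]]] := P_up2.
have [g1 [hg1 eg1 [y1 gy1]]] := adj_right_neq0 hf1 fx.
have [g2 hg2 eg2] := adj_right hf2.
have [psi hpsi bpsi] := LUiso_sym (steinberg_Pq hn (hPq i.+1) hL).
have sg1 : LUsurj g1 by apply: (simple_surj (v := y1) hL hg1).
have hh1 := LUhom_comp hpsi hg1.
have sh1 : LUsurj (psi \o g1)%VF.
  case: bpsi => psi' c1 c2 w; have [y ey] := sg1 (psi' w); exists y.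
  by rewrite comp_lfunE ey c2.
have [h2 hh2 eh2] := head_lift (TL_projective (projP i)) tP (hw_type_I hL) hp hg2.
have [f hf ef] := dsum_hom hh1 hh2.
have sf : LUsurj f.
  apply: (joint_surj hL hp hh1 sh1 hh2 _ ef) => phi hphi e.
  have [c ec] : exists c, phi (psi v0) = c *: v0.
    have [z|nz] := eqVneq (phi (psi v0)) 0; first by exists 0; rewrite scale0r.
    apply: (simple_prim (n := i.+1%:Z) hL _ nz).
    by apply: (hom_prim hphi); apply: (hom_prim hpsi); exact: hw_prim hL.
  have ep y : phi (psi y) = c *: y.
    move: y; apply: (hw_ind hL) => [|a u v eu ev|k _]; first by rewrite !linear0.
      by rewrite [psi _]linearP [phi _]linearP /= eu ev scalerDr !scalerA [a * c]mulrC.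
    by rewrite hpsi hphi ec actZ.
  have eg y : g2 y = c *: g1 y by rewrite -eh2 -e comp_lfunE ep.
  apply: (nc c) => y.
  have z1 : f1 0 = (0, 0) by rewrite linear0.
  have z2 : f2 0 = (0, 0) by rewrite linear0.
  have e2 : (f2 y).2 = c *: (f1 y).2.
    by have := eg (y, 0); rewrite eg1 eg2 z1 z2 /= !scaler0 !subr0.
  have e1 : (f2 y).1 = c *: (f1 y).1.
    have := eg (0, y); rewrite eg1 eg2 z1 z2 /= !sub0r scalerN => /oppr_inj.
    by rewrite scalerA mulrC -scalerA => /(scalerI q0).
  by case: (f2 y) e1 e2 => a b /= -> ->.
have [G hG eG] := copies_hom (fun j : 'I_2 => (if j == 0 as b return LUhom (if b then (psi \o g1)%VF else h2) then hh1 else hh2)).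
exists G => // y; have [z ez] := sf (y 0, y 1); exists z; rewrite eG.
move: ez; rewrite ef => -[e1 e2]; apply/ffunP => j; rewrite ffunE.
case: j => -[|[|//]] hj /=; [rewrite e1|rewrite e2]; congr (y _); exact/val_inj.
Qed.

End NextSteinberg.

Lemma onto_one i : (i %% l)%N <> l.-1 ->
  exists2 h : 'Hom(TL (Pq i), copies 1 (Pq i.+1)), LUhom h & LUsurj h.
Proof.
move=> hi; have [v0 hL] := is_Lq_hw (hLq i.+1).
have [[tP _] [p hp]] := Pq_head (hPq i.+1) hL.
have [f hf [x fx]] := P_up hi; have [g [hg _ [y gy]]] := adj_right_neq0 hf fx.
have [h hh eh] := head_lift (TL_projective (projP i)) tP (hw_type_I hL) hp hg.
have sh : LUsurj h by apply: (head_surj (x := y) hL hp hh); rewrite eh.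
have [G hG eG] := copies_hom (fun _ : 'I_1 => hh).
exists G => // w; have [z ez] := sh (w 0); exists z; rewrite eG.
by apply/ffunP => j; rewrite ffunE ez ord1.
Qed.

Lemma onto_step n b (Q A : LUmod q) (h : 'Hom(Q, A)) : projective_type_I l Q ->
  (n <= 1)%N -> LUhom h -> LUsurj h -> nohom A b ->
  (n = 1%N -> exists2 g : 'Hom(Q, Lq b), LUhom g & exists x, g x != 0) ->
  exists2 h' : 'Hom(Q, dsum A (copies n (Pq b))), LUhom h' & LUsurj h'.
Proof.
move=> prQ n1 hh sh nA hg; have [v0 hL] := is_Lq_hw (hLq b).
have [[tP _] [p hp]] := Pq_head (hPq b) hL.
have [g hgh gx] : exists2 g : 'Hom(Q, Lq b), LUhom g & (n = 1%N -> exists x, g x != 0).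
  case: n n1 hg => [|[|//]] _ hg; last by have [//|g h1 h2] := hg; exists g.
  by exists 0 => //; exact: LUhom0.
have [g' hg' eg'] := head_lift prQ tP (hw_type_I hL) hp hgh.
apply: (onto_copies n1 hp hh sh nA hg') => /gx [x ex]; exists x; by rewrite eg'.
Qed.

Definition PL1 i r s : LUmod q :=
  dsum (dsum (copies (1 + (s == l - 2))%N (Pq i.+1))
             (copies (1 - (r == 0) * (s == 0))%N (Pq i.-1)))
       (copies (s == 0)%N (Pq (i + 2 * l - 1)%N)).

(** The summands are added one at a time; the indices i+1, i-1 and i+2l-1 are distinct, so no map
    from the earlier summands to the new simple head interferes. *)
Lemma onto_PL1 i r s : (s < l)%N -> s <> l.-1 -> i = (r * l + s)%N ->
  exists2 h : 'Hom(TL (Pq i), PL1 i r s), LUhom h & LUsurj h.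
Proof.
move=> sl sn ei; have prT := TL_projective (projP i).
have im : (i %% l = s)%N by rewrite ei modnMDl modn_small.
have nil : (i %% l)%N <> l.-1 by rewrite im.
have [h1 hh1 sh1] : exists2 h : 'Hom(TL (Pq i), copies (1 + (s == l - 2))%N (Pq i.+1)),
    LUhom h & LUsurj h.
  case: eqP => e; [rewrite addn1; apply: onto_two; by rewrite im|rewrite addn0; exact: onto_one].
have n1 : nohom (copies (1 + (s == l - 2))%N (Pq i.+1)) i.-1.
  by apply/nohom_copies/nohom_P; clear; lia.
have dn : (1 - (r == 0) * (s == 0))%N = 1%N ->
    exists2 g : 'Hom(TL (Pq i), Lq i.-1), LUhom g & exists x, g x != 0.
  move=> e; have i0 : (0 < i)%N.
    by rewrite ei; move: e hl; clear; case: r => [|r]; case: s => [|s] //; lia.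
  rewrite -[i in TL (Pq i)](prednK i0); have [f hf [x fx]] := P_down i.-1.
  by have [g [hg _ gx]] := adj_right_neq0 hf fx; exists g.
have [h2 hh2 sh2] := onto_step prT (leq_subr _ _) hh1 sh1 n1 dn.
apply: (onto_step prT _ hh2 sh2).
- by case: eqP.
- by apply: nohom_dsum; apply/nohom_copies/nohom_P; move: hl; clear; lia.
- case: eqP => // s0 _.
  have [|f hf [x fx]] := @P_far i; first by rewrite im.
  by have [g [hg _ gx]] := adj_right_neq0 hf fx; exists g.
Qed.

(** L(i+1) (x) L(1) is projective. The adjoint of [L_up] is a nonzero map to L(i); its lift to P(i)
    is onto because P(i) has simple head. *)
Lemma onto_steinberg i : (i.+1 %% l)%N = l.-1 ->
  exists2 h : 'Hom(TL (Lq i.+1), Pq i), LUhom h & LUsurj h.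
Proof.
move=> hi; have [w0 hM] := is_Lq_hw (hLq i); have [v0 hL] := is_Lq_hw (hLq i.+1).
have ni : (i %% l)%N <> l.-1.
  by move=> /modSl0; rewrite hi; move: hl; clear; lia.
have [hu hhu ehu] := L_up hM hL ni.
have hu0 : hu v0 != 0.
  by rewrite ehu; apply/eqP => -[w00]; have := gen_neq0 hM; rewrite w00 eqxx.
have [g [hg _ [y gy]]] := adj_right_neq0 hhu hu0.
have [[tP _] [p hp]] := Pq_head (hPq i) hM.
have prL := TL_projective (steinberg_projective hi hL).
have [h hh eh] := head_lift prL tP (hw_type_I hM) hp hg.
by exists h => //; apply: (head_surj (x := y) hM hp hh); rewrite eh.
Qed.

Lemma dim_dsum (V W : LUmod q) : \dim {:dsum V W} = (\dim {:V} + \dim {:W})%N.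
Proof. by rewrite !dimvf. Qed.

Lemma dim_TL (V : LUmod q) : \dim {:TL V} = (2 * \dim {:V})%N.
Proof. by rewrite !dimvf mul2n -addnn. Qed.

Lemma dim_copies n (V : LUmod q) : \dim {:copies n V} = (n * \dim {:V})%N.
Proof. by rewrite !dimvf -[n in RHS]card_ord. Qed.

Lemma dim_surj (V W : LUmod q) (f : 'Hom(V, W)) : LUsurj f -> (\dim {:W} <= \dim {:V})%N.
Proof.
by move/surj_limg => im; rewrite -im -(limg_ker_dim f {:V}) leq_addl.
Qed.

Lemma dim_iso (V W : LUmod q) : LUiso V W -> \dim {:V} = \dim {:W}.
Proof.
have le (A B : LUmod q) : LUiso A B -> (\dim {:B} <= \dim {:A})%N.
  by move=> [f _ [g _ gf]]; apply: (dim_surj (f := f)) => w; exists (g w).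
by move=> VW; apply/eqP; rewrite eqn_leq !le //; exact: LUiso_sym.
Qed.

Lemma dim_L r s : (s < l)%N -> \dim {:Lq (r * l + s)} = (r.+1 * s.+1)%N.
Proof.
move=> sl; have [v0 hL] := is_Lq_hw (hLq (r * l + s)); rewrite (hw_dim hL) -(count_mod r sl).
apply: eq_in_count => k; rewrite mem_iota add0n ltnS /= => kn.
by rewrite /good kn /= modnMDl (modn_small sl).
Qed.

Lemma dim_P_steinberg r : \dim {:Pq (r * l + l.-1)} = (r.+1 * l)%N.
Proof.
have l0 := ltnW hl; have ll : (l.-1 < l)%N by rewrite prednK.
have [v0 hL] := is_Lq_hw (hLq (r * l + l.-1)).
rewrite (dim_iso (steinberg_Pq _ (hPq _) hL)); last by rewrite modnMDl modn_small.
by rewrite dim_L // prednK.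
Qed.

(* The dimensions of the [P(r l + k - 1)], doubled at Steinberg weights, form a *)
(* concave sequence. *)
Definition pdim r k : nat :=
  if (0 < k < l)%N then \dim {:Pq (r * l + k.-1)} else (2 * (r.+1 * l))%N.

(** The ends explain the values of [pdim] there: for s = 0 the summands P(rl-1), absent if r = 0,
    and P((r+2)l-1) have total dimension rl + (r+2)l, and for s = l-2 there are two copies of
    P((r+1)l-1). *)
Lemma dim_PL1 r s : (s < l.-1)%N ->
  \dim {:PL1 (r * l + s) r s} = (pdim r s + pdim r s.+2)%N.
Proof.
move=> sl; rewrite /PL1 !dim_dsum !dim_copies.
have -> : ((1 + (s == l - 2)) * \dim {:Pq (r * l + s).+1} = pdim r s.+2)%N.
  rewrite /pdim; case: eqP => e.
    have -> : ((r * l + s).+1 = r * l + l.-1)%N by move: e hl; clear; lia.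
    rewrite dim_P_steinberg /=; case: ifP => // h; exfalso; move: e h hl; clear; lia.
  rewrite addn0 mul1n -addnS ifT //; move: e sl hl; clear; lia.
rewrite -addnA addnC; congr (_ + _)%N; rewrite /pdim.
case: s sl => [|s] sl /=; last first.
  rewrite muln0 subn0 mul1n ?mul0n ?addn0 addnS /= ifT //.
  by move: sl hl; clear; lia.
rewrite muln1 mul1n.
have -> : (r * l + 0 + 2 * l - 1 = r.+1 * l + l.-1)%N by rewrite mulSn; move: hl; clear; lia.
rewrite dim_P_steinberg; case: r => [|r] /=; first by rewrite subnn mul0n add0n mul1n.
have -> : (r.+1 * l + 0).-1 = (r * l + l.-1)%N by rewrite mulSn; move: hl; clear; lia.
by rewrite dim_P_steinberg subn0 mul1n !mulSn; clear; lia.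
Qed.

(** [concave_const], with concavity from [onto_PL1] and the inequality at the right end from
    [onto_steinberg]. *)
Lemma pdim_const r k : (k <= l)%N -> pdim r k = (2 * (r.+1 * l))%N.
Proof.
have l0 := ltnW hl; rewrite -{1}(prednK l0); move: k; apply: concave_const.
- by [].
- by rewrite prednK // /pdim ltnn andbF.
- rewrite /pdim; case: ifP => // _.
  have [|h _ sh] := @onto_steinberg (r * l + l.-1.-1).
    have -> : ((r * l + l.-1.-1).+1 = r * l + l.-1)%N by move: hl; clear; lia.
    by rewrite modnMDl modn_small // prednK.
  apply: leq_trans (dim_surj sh) _; rewrite dim_TL.
  have -> : ((r * l + l.-1.-1).+1 = r * l + l.-1)%N by move: hl; clear; lia.
  by rewrite dim_L prednK.
- move=> k kl; rewrite -dim_PL1 //.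
  have [||h _ sh] := @onto_PL1 (r * l + k) r k _ _ erefl; [move: kl; clear; lia..|].
  apply: leq_trans (dim_surj sh) _; rewrite dim_TL /pdim ifT //.
  by move: kl; clear; lia.
Qed.

Section Rules.
Variables i r s : nat.
Hypotheses (hs : (s < l)%N) (hi : i = (r * l + s)%N).

(** Both sides have dimension 4(r+1)l, so the surjection [onto_PL1] is an isomorphism. *)
Lemma P_rule : s <> l.-1 -> LUiso (TL (Pq i)) (PL1 i r s).
Proof.
move=> sn; have sl : (s < l.-1)%N by move: sn hs; clear; lia.
have [h hh sh] := onto_PL1 hs sn hi; apply: (iso_of_surj hh sh).
rewrite dim_TL hi dim_PL1 // !pdim_const; try by move: sl; clear; lia.
have := @pdim_const r s.+1; rewrite /pdim ifT; last by move: sl; clear; lia.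
by move=> -> //; clear; lia.
Qed.

(** The surjection onto both summands is an isomorphism since (r+1)s + (r+1)(s+2) = 2(r+1)(s+1). *)
Lemma L_rule : s <> l.-1 -> LUiso (TL (Lq i))
  (dsum (copies (1 - (s == 0))%N (Lq i.-1)) (copies 1 (Lq i.+1))).
Proof.
move=> sn; have [w0 hM] := is_Lq_hw (hLq i); have [v0 hL] := is_Lq_hw (hLq i.+1).
have im : (i %% l = s)%N by rewrite hi modnMDl modn_small.
have [h1 hh1 sh1] : exists2 h : 'Hom(TL (Lq i), copies (1 - (s == 0))%N (Lq i.-1)),
    LUhom h & LUsurj h.
  case: (posnP s) => [s0|s0].
    exists 0; first exact: LUhom0.
    move=> w; exists 0; apply/ffunP; case=> m hm; exfalso; move: hm.
    by rewrite subnn.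
  have i0 : (0 < i)%N by rewrite hi addn_gt0 s0 orbT.
  have -> : (1 - false = 1)%N by [].
  have [u0 hN] := is_Lq_hw (hLq i.-1).
  have im' : (i.-1 %% l)%N <> l.-1.
    have -> : i.-1 = (r * l + s.-1)%N by move: hi s0; clear; lia.
    rewrite modnMDl modn_small; move: hs s0; clear; lia.
  have hM' : hw i.-1.+1 (good i.-1.+1) w0 by rewrite prednK.
  have [hu hhu ehu] := L_up hN hM' im'.
  have hu0 : hu w0 != 0.
    by rewrite ehu; apply/eqP => -[u00]; have := gen_neq0 hN; rewrite u00 eqxx.
  have [g [hg _ [y gy]]] := adj_right_neq0 hhu hu0.
  have sg := simple_surj hN hg gy.
  have [G hG eG] := copies_hom (fun _ : 'I_1 => hg); exists G => // w.
  have [z ez] := sg (w 0); exists z; rewrite eG.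
  by apply/ffunP => j; rewrite ffunE ez ord1.
have nil : (i %% l)%N <> l.-1 by rewrite im.
have [hd hhd ehd] := L_down hM hL nil.
have hd0 : hd w0 != 0.
  by rewrite ehd; apply/eqP => -[_ v00]; have := gen_neq0 hL; rewrite v00 eqxx.
have [g [hg _ [y gy]]] := adj_right_neq0 hhd hd0.
have nn : nohom (copies (1 - (s == 0))%N (Lq i.-1)) i.+1.
  by apply/nohom_copies/nohom_L; clear; lia.
have [|h hh sh] := onto_copies (leqnn 1) (id_head _) hh1 sh1 nn hg.
  by move=> _; exists y; rewrite id_lfunE.
apply: (iso_of_surj hh sh); rewrite dim_TL dim_dsum !dim_copies hi -addnS dim_L //.
have -> : \dim {:Lq (r * l + s.+1)} = (r.+1 * s.+2)%N by apply: dim_L; move: sn hs; clear; lia.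
case: (posnP s) => [->|s0]; first by rewrite subnn mul0n mul1n add0n muln1 mulnC.
have -> : (r * l + s).-1 = (r * l + s.-1)%N by move: s0; clear; lia.
have -> : (1 - false = 1)%N by [].
rewrite dim_L; last by move: hs; clear; lia.
rewrite prednK // !mul1n -mulnDr mulnCA leq_mul2l; apply/orP; right; clear; lia.
Qed.

(** The surjection [onto_steinberg] is an isomorphism, both dimensions being 2(r+1)l; the second
    summand, with no copies, is zero. *)
Lemma steinberg_rule : s = l.-1 -> LUiso (TL (Lq i))
  (dsum (copies 1 (Pq i.-1)) (copies 0 (Lq i.+1))).
Proof.
move=> sn.
have e : i = (r * l + l.-1.-1).+1 by rewrite hi sn; move: hl; clear; lia.
have e' : (r * l + l.-1.-1).+1 = (r * l + l.-1)%N by move: hl; clear; lia.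
rewrite e /=.
have [|h hh sh] := @onto_steinberg (r * l + l.-1.-1).
  by rewrite e' modnMDl modn_small // prednK // ltnW.
have [G hG eG] := copies_hom (fun _ : 'I_1 => hh).
have [f hf ef] := dsum_hom hG (@LUhom0 _ (copies 0 (Lq (r * l + l.-1.-1).+2))).
have sf : LUsurj f.
  move=> [a b]; have [x ex] := sh (a 0); exists x; rewrite ef eG; congr pair.
    by apply/ffunP => j; rewrite ffunE ex ord1.
  by apply/ffunP => -[].
apply: (iso_of_surj hf sf); rewrite dim_TL dim_dsum !dim_copies mul0n addn0 mul1n e' dim_L.
  have := @pdim_const r l.-1; rewrite /pdim ifT; last by move: hl; clear; lia.
  by rewrite prednK ?leq_pred; [move=> ->|exact: ltnW].
by rewrite prednK // ltnW.
Qed.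

End Rules.

End Fusion.

End Weights.

(* Were the element defining [H] not in [Ures], [H] would be [0] and every type I *)
(* module would have [K = 1]. *)
Lemma Ures_H (R : realType) (l : nat) (q : R[i]) (P : LUmod q) : (2 <= l)%N -> q != 0 ->
  l.-primitive_root (q ^+ 2) -> is_Pq l 1 P -> Ures ((Phi_t2 l)^-1 *: (Ut_K ^+ (2 * l) - 1)).
Proof.
move=> hl q0 hq [V [D [m [bas _ Km _ _]] [f [hf sf kf]]] [[[p [w [W [_ _ sW hW]]]] _] [g [hg sg _]]]].
apply: contrapT => nU.
have H0 : LH q l = 0.
  by rewrite /LH /LU_of; case: pselect => // _; rewrite scaler0.
have K1 (x : P) : LUact (LK q) x = x.
  have := memvf x; rewrite -sW => /memv_sumP [v hv ->].
  rewrite act_sum; apply: eq_bigr => j _; have [] := hW j _ (hv j isT).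
  rewrite H0 act0l => /esym/eqP; rewrite scaler_eq0 intr_eq0 => /orP [/eqP ->|/eqP ->] e.
    by rewrite e expr0z scale1r.
  by rewrite act0.
have KV (y : V) : LUact (LK q) y = y by have [x <-] := sg y; rewrite -hg K1.
have q1 : q ^+ 2 != 1.
  apply/eqP => e; have := prim_order_dvd hq 1; rewrite expr1 e eqxx dvdn1 => /eqP l1.
  by rewrite l1 in hl.
(* K is the identity on L(1), so an eigenvector of K in [D] with another eigenvalue maps to 0; the
   eigenvalues q and q^-1 on the basis of [D] both differ from 1. *)
have qz (n : int) (x : D) : q ^ n != 1 -> LUact (LK q) x = q ^ n *: x -> f x = 0.
  move=> qn e; have := KV (f x); rewrite -hf e linearZ /= => /eqP.
  rewrite -subr_eq0 -[X in _ - X]scale1r -scalerBl scaler_eq0 subr_eq0 (negPf qn).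
  by move/eqP.
have f0 (x : D) : f x = 0.
  move: x; apply: (basis_ind bas) => [|a u v eu ev|x]; first exact: linear0.
    by rewrite linearP /= eu ev scaler0 addr0.
  rewrite /= !inE => /orP [] /eqP ->.
    by apply: (qz _ _ _ (Km 0%N isT)); apply: contra q1 => /eqP; rewrite expr1z => ->; rewrite expr1n.
  apply: (qz _ _ _ (Km 1%N isT)); apply: contra q1 => /eqP e.
  have : q^-1 = 1 by exact: e.
  by move/(congr1 GRing.inv); rewrite invr1 invrK => ->; rewrite expr1n.
have m0 : m 0 != 0.
  by have := basis_not0 bas (_ : m 0 \in _); apply; rewrite /= inE eqxx.
have nz : fullv != 0%VS :> {vspace D}.
  by apply: contraNneq m0 => e; rewrite -memv0 -e memvf.
(* The map to L(1) is zero, so all of [D] is in its radical; but the nonzero module [D] has a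
   maximal submodule. *)
have [//|N' [sN' _ nN' mN']] := @max_proper_submodule R q D fullv _ nz; first by move=> *; exact: memvf.
have mx : maximal_submodule N'.
  split=> //; first exact/eqP.
  by move=> M sM NM; apply: mN' => //; exact: subvf.
case/negP: nN'; apply/eqP/vspaceP => x; rewrite memvf.
by apply/idP/(proj1 (kf x) (f0 x)).
Qed.

Theorem theorem4p5 (R : realType) (l : nat) (q : R[i])
    (hl : (2 <= l)%N) (hq0 : q != 0) (hq : l.-primitive_root (q ^+ 2))
    (Lq Pq : nat -> LUmod q)
    (hLq : forall j : nat, is_Lq j (Lq j))
    (hPq : forall j : nat, is_Pq l j (Pq j))
    (i r s : nat) (hs : (s < l)%N) (hi : i = (r * l + s)%N) :
  [/\ tensor_iso (Lq i) (Lq 1%N)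
        (dsum (copies (1 - (s == 0))%N
                 (if s == l.-1 then Pq i.-1 else Lq i.-1))
              (copies (1 - (s == l.-1))%N (Lq i.+1))),
      s <> l.-1 ->
      tensor_iso (Pq i) (Lq 1%N)
        (dsum (dsum (copies (1 + (s == l - 2))%N (Pq i.+1))
                    (copies (1 - (r == 0) * (s == 0))%N (Pq i.-1)))
              (copies (s == 0)%N (Pq (i + 2 * l - 1)%N)))
    & s = l.-1 -> LUiso (Pq i) (Lq i)].
Proof.
have hU := Ures_H hl hq0 hq (hPq 1%N).
split.
- apply: (tensor_isoP (q0 := hq0) (hl := hl) (hq := hq) hU (hLq 1%N)).
  have [e|/eqP ne] := eqVneq s l.-1; last exact: (L_rule hq0 hl hq hU hLq hs hi ne).
  have -> : (s == 0)%N = false by apply/eqP; move: e hl; clear; lia.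
  exact: (steinberg_rule hq0 hl hq hU hLq hPq hi e).
- move=> ne; apply: (tensor_isoP (q0 := hq0) (hl := hl) (hq := hq) hU (hLq 1%N)).
  exact: (P_rule hq0 hl hq hU hLq hPq hs hi ne).
- move=> e; have [v0 hL] := is_Lq_hw hq0 hl hq hU (hLq i).
  apply: (steinberg_Pq hq0 hl hq hU _ (hPq i) hL).
  by rewrite hi modnMDl modn_small.
Qed.
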